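(* Let $c\in\mathbb{C}\setminus\{0\}$. On the cylinder $\mathbb{C}/2\pi\mathbb{Z}$, consider the configuration of $3$ vortices with vorticities $\Gamma,\ \Gamma',\ -\Gamma-\Gamma'$ ($\Gamma$ and $\Gamma'$ being nonzero reals of the same sign) at, respectively, $$c+\frac{2\Gamma'}{\Gamma+\Gamma'}\zeta,\qquad c-\frac{2\Gamma}{\Gamma+\Gamma'}\zeta,\qquad -c,$$ where $\zeta\in\mathbb{C}$ has initial value $\zeta(0)$. (1) There exists an open punctured neighborhood of $\zeta=0$ such that for every initial condition $\zeta(0)\neq0$ in this neighborhood, these vortices form a relative periodic orbit. (2) If $\Gamma/\Gamma'\in\mathbb{Q}$, then for a generic choice of $\zeta(0)$ (with no restriction on its size) these vortices form a relative periodic orbit, and for isolated choices of $\zeta(0)$ they form a relative equilibrium or a separatrix connecting relative equilibria.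
   Context: The radius of the cylinder is normalized to $1$, so the cylinder is $\mathbb{C}/2\pi\mathbb{Z}$. The phase space for $N$ vortices is the product of $N$ copies of the cylinder with the diagonals removed (no collisions). The motion of point vortices $z_1,\ldots,z_N$ with vorticities $\Gamma_1,\ldots,\Gamma_N\in\mathbb{R}$ is governed by $$\frac{dz_k}{dt}=\frac{i}{4\pi}\sum_{l\neq k}\Gamma_l\,\cot\frac{\overline{z_k}-\overline{z_l}}{2},\qquad k=1,\ldots,N.$$ The group $\mathbb{C}/2\pi\mathbb{Z}$ acts diagonally on the phase space by translations. A relative equilibrium is a motion that lies entirely in a single group orbit (it looks stationary up to translation). A relative periodic orbit is a motion that revisits the same group orbit after some time (it looks periodic in time up to translation). A separatrix connecting relative equilibria is a relative heteroclinic orbit: a motion that, modulo translations, is asymptotic to relative equilibria as $t\to\pm\infty$.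
   Formalization: ''Isolated choices of ζ(0)'' cannot hold pointwise, since every point of a separatrix curve is exceptional; it is read as: relative equilibria are isolated among relative equilibria, and near a separatrix value all exceptional values lie on that same motion up to translation. *)

(* Defs.v *)
(* Stdlib reals and Coquelicot; finite index types and big operators are
   MathComp's. *)
From mathcomp Require Import all_boot.
From Stdlib Require Import Reals.
From Coquelicot Require Import Coquelicot.

Set Implicit Arguments.
Unset Strict Implicit.
Unset Printing Implicit Defensive.

Open Scope R_scope.

Definition Csin (z : C) : C := (sin (Re z) * cosh (Im z), cos (Re z) * sinh (Im z)).
Definition Ccos (z : C) : C := (cos (Re z) * cosh (Im z), - (sin (Re z) * sinh (Im z))).
Definition Ccot (z : C) : C := (Ccos z / Csin z)%C.

(* Points of the cylinder C/2piZ are given by representatives in C, and curves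
   on the cylinder by their lifts to C. *)
Definition same_point (z w : C) : Prop :=
  exists n : Z, (z - w)%C = RtoC (2 * PI * IZR n).

Section Vortices.
Variable N : nat.

Definition phase_space (z : 'I_N -> C) : Prop :=
  forall k l : 'I_N, k <> l -> ~ same_point (z k) (z l).

Definition same_orbit (z w : 'I_N -> C) : Prop :=
  exists a : C, forall k, same_point (z k) (w k + a)%C.

Variable Gamma : 'I_N -> R.

(* The cotangent has period pi, so the right-hand side depends only on the
   points of the cylinder represented by [z]. *)
Definition velocity (z : 'I_N -> C) (k : 'I_N) : C :=
  (Ci / RtoC (4 * PI) *
   \big[Cplus/RtoC 0]_(l < N | l != k)
      (RtoC (Gamma l) * Ccot ((Cconj (z k) - Cconj (z l)) / RtoC 2)))%C.

Definition motion (z : R -> 'I_N -> C) : Prop :=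
  forall t : R, phase_space (z t) /\
    forall k, is_derive (fun s => z s k) t (velocity (z t) k).

Definition relative_equilibrium (z : R -> 'I_N -> C) : Prop :=
  motion z /\ forall t, same_orbit (z t) (z 0).

(* To revisit its initial group orbit a motion must first leave it, so
   relative equilibria are excluded. *)
Definition relative_periodic_orbit (z : R -> 'I_N -> C) : Prop :=
  motion z /\
  (exists T, 0 < T /\ same_orbit (z T) (z 0)) /\
  (exists t, ~ same_orbit (z t) (z 0)).

(* Translations being isometries, convergence in the orbit space is
   convergence to 0 of the distance to the group orbit. *)
Definition near_orbit (eps : R) (z e : 'I_N -> C) : Prop :=
  exists w : 'I_N -> C, same_orbit w e /\ forall k, Cmod (z k - w k)%C < eps.

Definition asymptotic_at (F : (R -> Prop) -> Prop) (z e : R -> 'I_N -> C) : Prop :=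
  forall eps, 0 < eps -> F (fun t => near_orbit eps (z t) (e 0)).

(* The two relative equilibria may coincide. *)
Definition separatrix (z : R -> 'I_N -> C) : Prop :=
  motion z /\ ~ relative_equilibrium z /\
  (exists e, relative_equilibrium e /\ asymptotic_at (Rbar_locally m_infty) z e) /\
  (exists e, relative_equilibrium e /\ asymptotic_at (Rbar_locally p_infty) z e).

Definition starts_at (z0 : 'I_N -> C) (z : R -> 'I_N -> C) : Prop :=
  forall k, z 0 k = z0 k.

(* The motion with a given initial configuration is unique, so [exists] selects
   it; it also asserts that this motion is defined for all times. *)
Definition forms (P : (R -> 'I_N -> C) -> Prop) (z0 : 'I_N -> C) : Prop :=
  exists z, starts_at z0 z /\ P z.

End Vortices.

Definition vorticities3 (G G' : R) : 'I_3 -> R :=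
  tnth [tuple G; G'; - G - G'].

Definition configuration3 (G G' : R) (c zeta : C) : 'I_3 -> C :=
  tnth [tuple (c + RtoC (2 * G' / (G + G')) * zeta)%C;
              (c - RtoC (2 * G / (G + G')) * zeta)%C;
              (- c)%C].

Definition dense (U : C -> Prop) : Prop :=
  forall (z : C) (eps : R), 0 < eps -> exists w : C, U w /\ Cmod (w - z)%C < eps.

(* A separatrix is a curve of initial values, all on one motion.  "Isolated" is
   therefore taken among motions modulo translations: relative equilibria are
   isolated points, and the exceptional values ([E]) close to one that lies on a
   separatrix all lie on that same motion. *)
Definition isolated_relative_equilibrium (G G' : R) (c zeta : C) : Prop :=
  forms (relative_equilibrium (vorticities3 G G')) (configuration3 G G' c zeta) /\
  locally' zeta (fun xi =>
    ~ forms (relative_equilibrium (vorticities3 G G')) (configuration3 G G' c xi)).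

Definition isolated_separatrix (G G' : R) (c : C) (E : C -> Prop) (zeta : C) : Prop :=
  forms (fun z => separatrix (vorticities3 G G') z /\
           locally zeta (fun xi => E xi ->
             exists t, same_orbit (z t) (configuration3 G G' c xi)))
        (configuration3 G G' c zeta).

(* Main.v *)
Require Import Defs.
From HB Require Import structures.
From mathcomp Require Import all_boot.
From Stdlib Require Import Reals Lra Lia Psatz Classical IndefiniteDescription
  ClassicalEpsilon FunctionalExtensionality.
From Coquelicot Require Import Coquelicot.
From mathcomp Require all_order all_algebra ring Rstruct complex.

Open Scope R_scope.

(** The total vorticity vanishes, so the moment [G z1 + G' z2 - (G + G') z3] is
    both conserved and invariant under translations.  It fixes the constant
    [c], and the motion modulo translations reduces to that of the single
    complex variable [z = (z1 - z2) / 2]: with [a = G' / (G + G')] and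
    [b = G / (G + G')], the other two half-differences are [c + a z] and
    [c - b z].  This reduced motion is Hamiltonian ([solution_of_motion],
    [motion_of_solution]), with energy
    [ln |sin z| - (1/a) ln |sin (c + a z)| - (1/b) ln |sin (c - b z)|], and two
    positions [z] represent the same orbit of translations exactly when they
    differ by an element of a lattice ([same_orbit_placed]).

    The dynamics on a level set that is compact modulo the lattice is that of a
    one-dimensional flow.  The field, cut off as a function of the energy, is
    globally Lipschitz, so that solutions exist for all times and are unique
    ([level_solution_exists], [level_solution_unique]).  A solution accumulates
    somewhere.  Near a regular point the level set is a single arc
    ([flow_box]), so that accumulation at a regular point makes the solution
    revisit; otherwise it converges to an isolated critical point
    ([level_dichotomy]).

    At a collision the energy tends to an infinite limit, since the logarithms
    never cancel ([rel_energy_collision]).  Hence solutions that start near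
    [z = 0] are trapped in a punctured disc, which contains no critical point,
    and they all revisit ([near_zero_revisits]): this is the first part.

    If [G / G'] is rational then the energy has a real period, and as it tends
    to minus infinity at both ends of the cylinder all its levels are compact
    modulo that period ([periodic_compact_window]).  The critical points are the
    solutions of a polynomial equation in [exp (2 i z / q)], hence isolated, and
    at least one root of the polynomial is not a collision
    ([numerator_roots], [relative_critical_exists]).  The exceptional initial
    values are those whose solution does not revisit: critical points, and
    points that tend to critical points in both directions of time.  They lie
    on isolated energy levels ([exceptional_energy]) and, near a regular point,
    on a single solution ([exceptional_on_orbit]), which makes their complement
    open and dense and the separatrices isolated. *)

(** * Modulus and neighbourhoods in the complex plane *)

Lemma Cmod_le_sum (z : C) : Cmod z <= Rabs (Re z) + Rabs (Im z).
Proof.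
have := Rmax_Cmod z; case: z => x y /= _.
rewrite /Cmod /=.
apply: Rsqr_incr_0_var; last first.
  by apply: Rplus_le_le_0_compat; apply: Rabs_pos.
rewrite Rsqr_sqrt; last by nra.
rewrite /Rsqr.
have := Rabs_pos x; have := Rabs_pos y.
have := Rsqr_abs x; have := Rsqr_abs y; rewrite /Rsqr; nra.
Qed.

Lemma Re_le_Cmod (z : C) : Rabs (Re z) <= Cmod z.
Proof. by apply: Rle_trans (Rmax_Cmod z); apply: Rmax_l. Qed.

Lemma Im_le_Cmod (z : C) : Rabs (Im z) <= Cmod z.
Proof. by apply: Rle_trans (Rmax_Cmod z); apply: Rmax_r. Qed.

Lemma Cmod_sub_comm (x y : C) : Cmod (x - y) = Cmod (y - x).
Proof. by rewrite -Cmod_opp; congr Cmod; ring. Qed.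

Lemma Cmod_sub_triangle (y x z : C) : Cmod (x - z) <= Cmod (x - y) + Cmod (y - z).
Proof.
apply: Rle_trans (Cmod_triangle _ _); apply: Req_le; congr Cmod; ring.
Qed.

Lemma Cminus_diag_uniq (x y : C) : (x - y)%C = RtoC 0 -> x = y.
Proof.
move=> E; have -> : x = (x - y + y)%C by ring.
by rewrite E Cplus_0_l.
Qed.

Lemma Cmod_sub_diag (x : C) : Cmod (x - x) = 0.
Proof. by rewrite -Cmod_0; congr Cmod; ring. Qed.

Lemma locally_Cmod (p : C) (P : C -> Prop) :
  locally p P <-> exists d, 0 < d /\ forall x, Cmod (x - p) < d -> P x.
Proof.
split.
  case=> d Hd; exists d; split=> [|x Hx]; first exact: cond_pos.
  apply: Hd; split; apply: Rle_lt_trans Hx.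
    exact: (Re_le_Cmod (x - p)).
  exact: (Im_le_Cmod (x - p)).
case=> d [d0 Hd]; have d2 : 0 < d / 2 by lra.
exists (mkposreal _ d2) => x [/= H1 H2]; apply: Hd.
apply: Rle_lt_trans (Cmod_le_sum _) _.
rewrite /ball /= /AbsRing_ball /abs /minus /plus /opp /= in H1 H2.
have -> : Re (x - p) = x.1 + - p.1 by [].
have -> : Im (x - p) = x.2 + - p.2 by [].
lra.
Qed.

(** * Cluster points *)

(** Bolzano-Weierstrass: were there no cluster point, each point of the
    rectangle would have a radius that excludes the tail of the sequence from
    some index on, and a Lebesgue number for these radii bounds the indices. *)
Lemma bounded_sequence_cluster (x : nat -> C) (a b a' b' : R) :
  (forall n, a <= Re (x n) <= b /\ a' <= Im (x n) <= b') ->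
  exists p : C, forall eps, 0 < eps -> forall N, exists n,
    (N <= n)%coq_nat /\ Cmod (x n - p) < eps.
Proof.
move=> Hx; apply: NNPP => Hno.
have Hp : forall p : C, exists d : posreal,
    forall n, / (INR n + 1) < d -> d <= Cmod (x n - p).
  move=> p; apply: NNPP => H1; apply: Hno; exists p => eps eps0 N.
  apply: NNPP => H2; apply: H1.
  have e0 : 0 < Rmin eps (/ (INR N + 1)).
    apply: Rmin_pos => //; apply: Rinv_0_lt_compat.
    by have := pos_INR N; lra.
  exists (mkposreal _ e0) => n /= Hn.
  apply: Rnot_lt_le => Hlt; apply: H2; exists n; split.
    apply: INR_le.
    have H3 : / (INR n + 1) < / (INR N + 1) by apply: Rlt_le_trans Hn (Rmin_r _ _).
    have N0 : 0 < INR n + 1 by have := pos_INR n; lra.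
    by have := Rinv_lt_cancel _ _ N0 H3; lra.
  by apply: Rlt_le_trans Hlt (Rmin_l _ _).
have [dl Hdl] := functional_choice _ Hp.
have hp (d : posreal) : 0 < d / 2 by case: d => d /= d0; lra.
have [d Hd] := compactness_value_2d a b a' b'
   (fun u v => mkposreal _ (hp (dl (u, v)))).
have [n Hn] : exists n, / (INR n + 1) < d.
  have [n [Hn n0]] := archimed_cor1 d (cond_pos d).
  exists n; apply: Rle_lt_trans Hn.
  have := lt_0_INR _ n0 => n1.
  apply: Rlt_le; apply: Rinv_lt_contravar; last by lra.
  by apply: Rmult_lt_0_compat; lra.
have [H1 H2] := Hx n.
apply: (Hd (Re (x n)) (Im (x n)) H1 H2) => -[u [v [_ [_ [H3 [H4 H5]]]]]].
rewrite /= in H3 H4 H5.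
have := Hdl (u, v) n.
have Hle := Cmod_le_sum (x n - (u, v)).
have E1 : Re (x n - (u, v)) = Re (x n) - u by [].
have E2 : Im (x n - (u, v)) = Im (x n) - v by [].
rewrite E1 E2 in Hle.
have := cond_pos (dl (u,v)) => P1 P2.
have : / (INR n + 1) < dl (u, v) by lra.
by move/P2; lra.
Qed.

(** * Existence and uniqueness for bounded Lipschitz planar fields *)

Lemma is_derive_continuity_pt (f : R -> R) (t l : R) :
  is_derive f t l -> continuity_pt f t.
Proof.
move=> Hf; apply/continuity_pt_filterlim; apply: ex_derive_continuous.
by exists l.
Qed.

Lemma mean_value (f df : R -> R) (a b : R) :
  (forall t, Rmin a b <= t <= Rmax a b -> is_derive f t (df t)) ->
  exists c, Rmin a b <= c <= Rmax a b /\ f b - f a = df c * (b - a).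
Proof.
move=> Hf; apply: MVT_gen => t Ht; first by apply: Hf; lra.
by apply: is_derive_continuity_pt (Hf t Ht).
Qed.

Lemma derive_bound_lipschitz (f df : R -> R) (B : R) :
  (forall t, is_derive f t (df t)) -> (forall t, Rabs (df t) <= B) ->
  forall s t, Rabs (f s - f t) <= B * Rabs (s - t).
Proof.
move=> Hf HB s t.
have [c [_ ->]] := mean_value f df t s (fun u _ => Hf u).
by rewrite Rabs_mult; apply: Rmult_le_compat_r; first exact: Rabs_pos.
Qed.

Lemma zero_derivative_constant (f : R -> R) :
  (forall t, is_derive f t 0) -> forall t, f t = f 0.
Proof.
move=> Hf t.
have := derive_bound_lipschitz f (fun _ => 0) 0 Hf (fun s => Req_le _ _ Rabs_R0) t 0.
rewrite Rmult_0_l => Hle; apply: Rminus_diag_uniq; apply: Rabs_eq_0.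
by have := Rabs_pos (f t - f 0); lra.
Qed.

Lemma derive_nonneg_le (f df : R -> R) (a b : R) :
  a <= b -> (forall t, a <= t <= b -> is_derive f t (df t)) ->
  (forall t, a <= t <= b -> 0 <= df t) -> f a <= f b.
Proof.
move=> Hab Hf Hp.
have [|c []] := mean_value f df a b.
  by rewrite Rmin_left // Rmax_right.
rewrite Rmin_left // Rmax_right // => Hc E.
by have := Hp c Hc; nra.
Qed.

Lemma lipschitz_continuous (f : R -> R) (B : R) :
  (forall s t, Rabs (f s - f t) <= B * Rabs (s - t)) ->
  forall t, continuous f t.
Proof.
move=> HB t; apply/filterlim_locally => eps.
have B1 : 0 < Rabs B + 1 by have := Rabs_pos B; lra.
have d0 : 0 < eps / (Rabs B + 1) by apply: Rdiv_lt_0_compat => //; exact: cond_pos.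
exists (mkposreal _ d0) => s Hs.
rewrite /ball /= /AbsRing_ball /abs /minus /plus /opp /= in Hs *.
apply: Rle_lt_trans (HB s t) _.
have -> : pos eps = (Rabs B + 1) * (eps / (Rabs B + 1)) by field; lra.
have := Rabs_pos (s - t); have := Rle_abs B.
have := cond_pos eps.
move: Hs; rewrite -/(s - t); set u := Rabs _; set e := eps / _.
by move=> *; nra.
Qed.

Lemma primitive_of_continuous (g : R -> R) :
  (forall t, continuous g t) ->
  RInt g 0 0 = 0 /\ forall t, is_derive (fun t => RInt g 0 t) t (g t).
Proof.
move=> Hg; split; first exact: RInt_point.
move=> t; apply: (is_derive_RInt g (fun t => RInt g 0 t) 0 t) => //.
apply: filter_forall => u; apply: RInt_correct.
by apply: ex_RInt_continuous.
Qed.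

(** The weight [exp (K |t|)] dominates its own integral up to the factor [/ K];
    with [K] large this makes the Picard iteration contract by one half on the
    whole time axis at once. *)
Lemma exp_weight_primitive (G g : R -> R) (M K : R) : 0 < K ->
  G 0 = 0 -> (forall t, is_derive G t (g t)) ->
  (forall t, Rabs (g t) <= M * exp (K * Rabs t)) ->
  forall t, Rabs (G t) <= M / K * exp (K * Rabs t).
Proof.
move=> K0 G0 HG Hg t.
have M0 : 0 <= M.
  have := Hg 0; rewrite Rabs_R0 Rmult_0_r exp_0; have := Rabs_pos (g 0); lra.
have MK : 0 <= M / K by apply: Rdiv_le_0_compat.
have main (s : R) (G' g' : R -> R) : G' 0 = 0 ->
    (forall t, is_derive G' t (g' t)) ->
    (forall t, Rabs (g' t) <= M * exp (K * Rabs t)) ->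
    0 <= s -> G' s <= M / K * exp (K * s).
  move=> G'0 HG' Hg' s0.
  have := derive_nonneg_le (fun u => M / K * exp (K * u) - G' u)
            (fun u => M * exp (K * u) - g' u) 0 s s0.
  rewrite G'0 Rmult_0_r exp_0.
  move=> H; suff : M / K * 1 - 0 <= M / K * exp (K * s) - G' s by lra.
  apply: H => u Hu.
    apply: is_derive_minus (HG' u).
    by auto_derive => //; field; lra.
  have := Hg' u; rewrite (Rabs_pos_eq u); last lra.
  by have := Rle_abs (g' u); lra.
have neg (G' g' : R -> R) : (forall t, is_derive G' t (g' t)) ->
    forall t, is_derive (fun u => - G' u) t (- g' t).
  by move=> HG' u; apply: is_derive_opp.
have rev (G' g' : R -> R) : (forall t, is_derive G' t (g' t)) ->
    forall t, is_derive (fun u => G' (- u)) t (- g' (- t)).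
  move=> HG' u; have := is_derive_comp G' Ropp u (g' (- u)) (- 1) (HG' _).
  rewrite /scal /= /mult /= => H.
  have -> : - g' (- u) = - 1 * g' (- u) by ring.
  by apply: H; auto_derive.
apply: Rabs_le.
case: (Rle_dec 0 t) => Ht.
  rewrite (Rabs_pos_eq t) //; split; last exact: (main t G g).
  have H : - G t <= M / K * exp (K * t).
    apply: (main t (fun u => - G u) (fun u => - g u)) => //.
    - lra.
    - exact: neg.
    - by move=> u; rewrite Rabs_Ropp.
  lra.
have E : Rabs t = - t by apply: Rabs_left; lra.
have Et : G t = G (- - t) by rewrite Ropp_involutive.
rewrite E Et; split.
  have H : - G (- (- t)) <= M / K * exp (K * - t).
    apply: (main (- t) (fun u => - G (- u)) (fun u => - - g (- u))) => //.
    - by rewrite Ropp_0; lra.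
    - exact/neg/rev.
    - by move=> u; rewrite Ropp_involutive -(Rabs_Ropp u).
    - lra.
  lra.
apply: (main (- t) (fun u => G (- u)) (fun u => - g (- u))) => //.
- by rewrite Ropp_0.
- exact: rev.
- by move=> u; rewrite Rabs_Ropp -(Rabs_Ropp u).
- lra.
Qed.

Lemma geometric_step_limit (u : nat -> R) (c : R) :
  (forall n, Rabs (u n.+1 - u n) <= c * (/ 2) ^ n) ->
  forall n, Rabs (u n - real (Lim_seq u)) <= 2 * c * (/ 2) ^ n.
Proof.
move=> Hu.
have c0 : 0 <= c by have := Hu 0%nat; have := Rabs_pos (u 1%nat - u 0%nat); rewrite /=; lra.
have hp n : 0 < (/ 2) ^ n by apply: pow_lt; lra.
have Hk n k : Rabs (u (n + k)%coq_nat - u n) <= 2 * c * (/ 2) ^ n - 2 * c * (/ 2) ^ (n + k)%coq_nat.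
  elim: k => [|k IH].
    by rewrite Nat.add_0_r Rminus_eq_0 Rabs_R0; lra.
  rewrite Nat.add_succ_r.
  have := Hu (n + k)%coq_nat.
  have := Rabs_triang (u (n + k)%coq_nat.+1 - u (n + k)%coq_nat) (u (n + k)%coq_nat - u n).
  have -> : u (n + k)%coq_nat.+1 - u (n + k)%coq_nat + (u (n + k)%coq_nat - u n) = u (n + k)%coq_nat.+1 - u n by ring.
  rewrite [(/ 2) ^ (n + k)%coq_nat.+1]/=; lra.
have Hle n m : (n <= m)%coq_nat -> Rabs (u m - u n) <= 2 * c * (/ 2) ^ n.
  move=> Hnm; have -> : m = (n + (m - n)%coq_nat)%coq_nat by lia.
  by apply: Rle_trans (Hk _ _) _; have := hp (n + (m - n)%coq_nat)%coq_nat; nra.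
have Hex : ex_finite_lim_seq u.
  apply/ex_lim_seq_cauchy_corr => eps.
  have Hg : is_lim_seq (fun n => 2 * c * (/ 2) ^ n) (2 * c * 0).
    apply: (is_lim_seq_scal_l _ (2 * c) 0); apply: is_lim_seq_geom.
    by rewrite Rabs_pos_eq; lra.
  rewrite Rmult_0_r in Hg.
  have e2 : 0 < eps / 2 by have := cond_pos eps; lra.
  have /filterlim_locally/(_ (mkposreal _ e2)) [N HN] := Hg.
  exists N => n m Hn Hm.
  have := HN N (Nat.le_refl _).
  rewrite /ball /= /AbsRing_ball /abs /minus /plus /opp /= => H.
  have := Rle_abs (2 * c * (/ 2) ^ N + - 0).
  have := Hle _ _ Hn; have := Hle _ _ Hm.
  have := Rabs_triang (u n - u N) (u N - u m).
  rewrite (Rabs_minus_sym (u N)).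
  have -> : u n - u N + (u N - u m) = u n - u m by ring.
  lra.
move=> n; have Hl := Lim_seq_correct' _ Hex.
have : Rbar_le (Rabs (real (Lim_seq u) - u n)) (2 * c * (/ 2) ^ n).
  apply: (is_lim_seq_le_loc (fun m => Rabs (u m - u n)) (fun _ => 2 * c * (/ 2) ^ n)).
  - by exists n => m Hm; apply: Hle.
  - have Hd : is_lim_seq (fun m => u m - u n) (real (Lim_seq u) - u n).
      by apply: is_lim_seq_minus' => //; exact: is_lim_seq_const.
    exact: (is_lim_seq_abs _ _ Hd).
  - exact: is_lim_seq_const.
by rewrite /= Rabs_minus_sym.
Qed.

Lemma geometric_bound_zero (x c : R) :
  (forall n, Rabs x <= c * (/ 2) ^ n) -> x = 0.
Proof.
move=> Hx.
have Hg : is_lim_seq (fun n => c * (/ 2) ^ n) (c * 0).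
  apply: (is_lim_seq_scal_l _ c 0); apply: is_lim_seq_geom.
  by rewrite Rabs_pos_eq; lra.
have : Rbar_le (Rabs x) (c * 0).
  apply: (is_lim_seq_le (fun _ => Rabs x) (fun n => c * (/ 2) ^ n)) => //.
  exact: is_lim_seq_const.
rewrite /= Rmult_0_r => H; apply: Rabs_eq_0.
by have := Rabs_pos x; lra.
Qed.

Definition lipschitz (L : R) (u : C -> R) : Prop :=
  forall x y, Rabs (u x - u y) <= L * Cmod (x - y).

Definition integral_curve (X Y : C -> R) (phi : R -> C) : Prop :=
  forall t, is_derive (fun s => Re (phi s)) t (X (phi t)) /\
            is_derive (fun s => Im (phi s)) t (Y (phi t)).

Section BoundedLipschitzField.
Variables (X Y : C -> R) (B L : R).
Hypothesis X_bounded : forall x, Rabs (X x) <= B.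
Hypothesis Y_bounded : forall x, Rabs (Y x) <= B.
Hypothesis X_lipschitz : lipschitz L X.
Hypothesis Y_lipschitz : lipschitz L Y.

(* Speed at most [2 B], as for every solution of the field; this keeps the Picard
   iterates equicontinuous, hence their limit continuous. *)
Let slow (gamma : R -> C) : Prop :=
  forall s t, Cmod (gamma s - gamma t) <= 2 * B * Rabs (s - t).

Let step (x0 : C) (gamma : R -> C) (t : R) : C :=
  (Re x0 + RInt (fun s => X (gamma s)) 0 t,
   Im x0 + RInt (fun s => Y (gamma s)) 0 t).

Lemma field_bound_nonneg : 0 <= B.
Proof. by apply: Rle_trans (X_bounded (RtoC 0)); apply: Rabs_pos. Qed.

Lemma field_lipschitz_nonneg : 0 <= L.
Proof.
have := X_lipschitz (RtoC 1) (RtoC 0).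
rewrite -RtoC_minus Cmod_R Rminus_0_r Rabs_R1 => H.
by have := Rabs_pos (X (RtoC 1) - X (RtoC 0)); lra.
Qed.

Lemma field_along_slow_continuous (Z : C -> R) (gamma : R -> C) :
  lipschitz L Z -> slow gamma -> forall t, continuous (fun s => Z (gamma s)) t.
Proof.
move=> HZ Hg; apply: (lipschitz_continuous _ (L * (2 * B))) => s t.
apply: Rle_trans (HZ _ _) _; rewrite Rmult_assoc.
by apply: Rmult_le_compat_l (Hg s t); exact: field_lipschitz_nonneg.
Qed.

Lemma derive_bound_slow (gamma : R -> C) (a b : R -> R) :
  (forall t, is_derive (fun s => Re (gamma s)) t (a t)) ->
  (forall t, is_derive (fun s => Im (gamma s)) t (b t)) ->
  (forall t, Rabs (a t) <= B) -> (forall t, Rabs (b t) <= B) -> slow gamma.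
Proof.
move=> Ha Hb HA HB s t; apply: Rle_trans (Cmod_le_sum _) _.
have -> : Re (gamma s - gamma t) = Re (gamma s) - Re (gamma t) by [].
have -> : Im (gamma s - gamma t) = Im (gamma s) - Im (gamma t) by [].
have := derive_bound_lipschitz _ _ _ Ha HA s t.
have := derive_bound_lipschitz _ _ _ Hb HB s t.
lra.
Qed.

Lemma integral_curve_slow (phi : R -> C) : integral_curve X Y phi -> slow phi.
Proof.
move=> Hphi; apply: (derive_bound_slow _ (fun t => X (phi t)) (fun t => Y (phi t))) => t //.
  by case: (Hphi t).
by case: (Hphi t).
Qed.

Lemma step_spec (x0 : C) (gamma : R -> C) : slow gamma ->
  step x0 gamma 0 = x0 /\
  (forall t, is_derive (fun s => Re (step x0 gamma s)) t (X (gamma t))) /\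
  (forall t, is_derive (fun s => Im (step x0 gamma s)) t (Y (gamma t))).
Proof.
move=> Hg.
have [X0 DX] := primitive_of_continuous _ (field_along_slow_continuous _ _ X_lipschitz Hg).
have [Y0 DY] := primitive_of_continuous _ (field_along_slow_continuous _ _ Y_lipschitz Hg).
have D (c : R) (F : R -> R) t l : is_derive F t l -> is_derive (fun s => c + F s) t l.
  move=> HF; have := is_derive_plus _ _ _ _ _ (is_derive_const c t) HF.
  by rewrite plus_zero_l.
split; last by split=> t; apply: D.
by rewrite /step X0 Y0 !Rplus_0_r; case: x0.
Qed.

Lemma step_slow (x0 : C) (gamma : R -> C) : slow gamma -> slow (step x0 gamma).
Proof.
by move=> Hg; have [_ [DX DY]] := step_spec x0 _ Hg; apply: derive_bound_slow DX DY _ _.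
Qed.

Let K := 4 * L + 1.

(** The rate [K] exceeds [4 L]: one factor [2] absorbs the two coordinates, the
    other one gives the contraction by one half. *)
Lemma step_contracts (x0 : C) (g1 g2 : R -> C) (M : R) : slow g1 -> slow g2 ->
  (forall t, Cmod (g1 t - g2 t) <= M * exp (K * Rabs t)) ->
  forall t, Cmod (step x0 g1 t - step x0 g2 t) <= M / 2 * exp (K * Rabs t).
Proof.
move=> S1 S2 HM t.
have L0 := field_lipschitz_nonneg.
have K0 : 0 < K by rewrite /K; lra.
have [E1 [DX1 DY1]] := step_spec x0 _ S1.
have [E2 [DX2 DY2]] := step_spec x0 _ S2.
have M0 : 0 <= M.
  have := HM 0; rewrite Rabs_R0 Rmult_0_r exp_0.
  have := Cmod_ge_0 (g1 0 - g2 0); lra.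
have comp (p : C -> R) (Z : C -> R) : lipschitz L Z ->
    (forall t, is_derive (fun s => p (step x0 g1 s)) t (Z (g1 t))) ->
    (forall t, is_derive (fun s => p (step x0 g2 s)) t (Z (g2 t))) ->
    Rabs (p (step x0 g1 t) - p (step x0 g2 t)) <= M / 4 * exp (K * Rabs t).
  move=> HZ D1 D2.
  apply: Rle_trans (exp_weight_primitive
    (fun s => p (step x0 g1 s) - p (step x0 g2 s))
    (fun s => Z (g1 s) - Z (g2 s)) (L * M) K K0 _ _ _ t) _.
  - by rewrite E1 E2 Rminus_eq_0.
  - by move=> s; apply: is_derive_minus.
  - move=> s; apply: Rle_trans (HZ _ _) _; rewrite Rmult_assoc.
    exact: Rmult_le_compat_l.
  - apply: Rmult_le_compat_r; first exact/Rlt_le/exp_pos.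
    apply: (Rmult_le_reg_r K) => //.
    have -> : L * M / K * K = L * M by field; lra.
    by rewrite /K; nra.
apply: Rle_trans (Cmod_le_sum _) _.
have -> : Re (step x0 g1 t - step x0 g2 t) = Re (step x0 g1 t) - Re (step x0 g2 t) by [].
have -> : Im (step x0 g1 t - step x0 g2 t) = Im (step x0 g1 t) - Im (step x0 g2 t) by [].
have := comp Re X X_lipschitz DX1 DX2.
have := comp Im Y Y_lipschitz DY1 DY2.
lra.
Qed.

(** Picard-Lindelof.  The iterates converge geometrically in the weighted
    distance, and the limit is fixed by the Picard step. *)
Theorem integral_curve_exists (x0 : C) :
  exists phi, phi 0 = x0 /\ integral_curve X Y phi.
Proof.
pose it := fix it n := if n is m.+1 then step x0 (it m) else fun _ : R => x0.
have L0 := field_lipschitz_nonneg; have B0 := field_bound_nonneg.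
have it_slow n : slow (it n).
  elim: n => [|n IH] /=; last exact: step_slow.
  move=> s t; rewrite Cmod_sub_diag.
  by have := Rabs_pos (s - t); nra.
have K0 : 0 < K by rewrite /K; lra.
have it_step n t : Cmod (it n.+1 t - it n t) <= 2 * B * (/ 2) ^ n * exp (K * Rabs t).
  elim: n t => [|n IH] t.
    rewrite /= Rmult_1_r.
    have [E0 _] := step_spec x0 _ (it_slow 0%nat).
    have := step_slow x0 _ (it_slow 0%nat) t 0; rewrite E0 Rminus_0_r => Hs.
    apply: Rle_trans Hs _; apply: Rmult_le_compat_l; first lra.
    have := exp_ineq1_le (K * Rabs t); have := Rabs_pos t.
    by rewrite /K; nra.
  have := step_contracts x0 _ _ _ (it_slow n.+1) (it_slow n) IH t.
  have -> : 2 * B * (/ 2) ^ n / 2 = 2 * B * (/ 2) ^ n.+1 by rewrite /=; field.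
  by [].
pose phi t : C := (real (Lim_seq (fun n => Re (it n t))), real (Lim_seq (fun n => Im (it n t)))).
have conv n t : Cmod (it n t - phi t) <= 8 * B * (/ 2) ^ n * exp (K * Rabs t).
  have Hc (p : C -> R) : (forall x y : C, Rabs (p x - p y) <= Cmod (x - y)) ->
      Rabs (p (it n t) - real (Lim_seq (fun n => p (it n t))))
        <= 2 * (2 * B * exp (K * Rabs t)) * (/ 2) ^ n.
    move=> Hp; apply: (geometric_step_limit (fun n => p (it n t))) => m.
    apply: Rle_trans (Hp _ _) _; apply: Rle_trans (it_step m t) _.
    by apply: Req_le; ring.
  have H1 := Hc Re (fun x y => Re_le_Cmod (x - y)).
  have H2 := Hc Im (fun x y => Im_le_Cmod (x - y)).
  apply: Rle_trans (Cmod_le_sum _) _.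
  have -> : Re (it n t - phi t) = Re (it n t) - real (Lim_seq (fun n => Re (it n t))) by [].
  have -> : Im (it n t - phi t) = Im (it n t) - real (Lim_seq (fun n => Im (it n t))) by [].
  lra.
have phi_slow : slow phi.
  move=> s t; apply: Rnot_lt_le => Hlt.
  set x := Cmod (phi s - phi t) - 2 * B * Rabs (s - t).
  suff : x = 0 by rewrite /x; lra.
  apply: (geometric_bound_zero _ (8 * B * exp (K * Rabs s) + 8 * B * exp (K * Rabs t))) => n.
  rewrite Rabs_pos_eq /x; last lra.
  have := Cmod_sub_triangle (it n s) (phi s) (phi t).
  have := Cmod_sub_triangle (it n t) (it n s) (phi t).
  rewrite (Cmod_sub_comm (phi s) (it n s)).
  have := it_slow n s t; have := conv n s; have := conv n t.
  lra.
have phi_fix t : step x0 phi t = phi t.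
  have Hz : Cmod (step x0 phi t - phi t) = 0.
    apply: (geometric_bound_zero _ (8 * B * exp (K * Rabs t))) => n.
    rewrite Rabs_pos_eq; last exact: Cmod_ge_0.
    have := step_contracts x0 _ _ _ (it_slow n) phi_slow (conv n) t.
    have := conv n.+1 t; rewrite /= => H1 H2.
    have := Cmod_sub_triangle (step x0 (it n) t) (step x0 phi t) (phi t).
    rewrite (Cmod_sub_comm (step x0 phi t) (step x0 (it n) t)); lra.
  have := Cmod_eq_0 _ Hz => E.
  have -> : step x0 phi t = (step x0 phi t - phi t + phi t)%C by ring.
  by rewrite E; ring.
have [E0 [DX DY]] := step_spec x0 _ phi_slow.
exists phi; split; first by rewrite -phi_fix.
move=> t; split.
  by apply: is_derive_ext (DX t) => s; rewrite phi_fix.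
by apply: is_derive_ext (DY t) => s; rewrite phi_fix.
Qed.

(** The squared distance of two solutions grows at most like [exp (8 L |t|)],
    in both directions of time. *)
Theorem integral_curve_unique (phi psi : R -> C) (t0 : R) :
  integral_curve X Y phi -> integral_curve X Y psi -> phi t0 = psi t0 ->
  forall t, phi t = psi t.
Proof.
move=> Hphi Hpsi E0 t.
have L0 := field_lipschitz_nonneg.
pose u s := Re (phi s) - Re (psi s); pose v s := Im (phi s) - Im (psi s).
pose du s := X (phi s) - X (psi s); pose dv s := Y (phi s) - Y (psi s).
have Du s : is_derive u s (du s).
  by apply: is_derive_minus; [case: (Hphi s) | case: (Hpsi s)].
have Dv s : is_derive v s (dv s).
  by apply: is_derive_minus; [case: (Hphi s) | case: (Hpsi s)].
pose g s := u s * u s + v s * v s.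
have Hb s : Rabs (2 * u s * du s + 2 * v s * dv s) <= 8 * L * g s.
  have Hm := Cmod_le_sum (phi s - psi s).
  have := X_lipschitz (phi s) (psi s); have := Y_lipschitz (phi s) (psi s).
  rewrite -/(du s) -/(dv s).
  have E1 : Re (phi s - psi s) = u s by [].
  have E2 : Im (phi s - psi s) = v s by [].
  rewrite E1 E2 in Hm.
  have A1 := Rabs_pos (u s); have A2 := Rabs_pos (v s) => H2 H1.
  have Q1 : u s * u s = Rabs (u s) * Rabs (u s) by rewrite -Rabs_mult Rabs_pos_eq //; nra.
  have Q2 : v s * v s = Rabs (v s) * Rabs (v s) by rewrite -Rabs_mult Rabs_pos_eq //; nra.
  apply: Rle_trans (Rabs_triang _ _) _; rewrite !Rabs_mult (Rabs_pos_eq 2); last lra.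
  rewrite /g Q1 Q2.
  have P1 := Rabs_pos (du s); have P2 := Rabs_pos (dv s).
  move: H1 H2 Hm A1 A2 P1 P2; move: (Rabs (u s)) (Rabs (v s)) (Rabs (du s)) (Rabs (dv s)) (Cmod _).
  move=> a b p q m H1 H2 Hm a0 b0 p0 q0.
  have H3 : p <= L * (a + b) by nra.
  have H4 : q <= L * (a + b) by nra.
  have H5 : a * p <= a * (L * (a + b)) by apply: Rmult_le_compat_l.
  have H6 : b * q <= b * (L * (a + b)) by apply: Rmult_le_compat_l.
  have : L * ((a + b) * (a + b)) <= L * (2 * (a * a + b * b)); last by nra.
  apply: Rmult_le_compat_l => //.
  by have := Rle_0_sqr (a - b); rewrite /Rsqr; lra.
have g0 s : 0 <= g s by rewrite /g; nra.
have gt0 : g t0 = 0 by rewrite /g /u /v E0 !Rminus_eq_0; ring.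
have gt : g t <= 0.
  have D (k s : R) : is_derive (fun s => exp (k * s) * g s) s
      (exp (k * s) * (2 * u s * du s + 2 * v s * dv s + k * g s)).
    rewrite /g; have := Du s; have := Dv s => H1 H2.
    auto_derive; first by repeat split; eexists; eauto.
    by rewrite (is_derive_unique _ _ _ H1) (is_derive_unique _ _ _ H2); ring.
  have ep k s := exp_pos (k * s).
  case: (Rle_dec t0 t) => Ht.
    have := derive_nonneg_le (fun s => - (exp (- (8 * L) * s) * g s))
      (fun s => - (exp (- (8 * L) * s) * (2 * u s * du s + 2 * v s * dv s + - (8 * L) * g s))) t0 t Ht.
    rewrite gt0 => H.
    have : - (exp (- (8 * L) * t0) * 0) <= - (exp (- (8 * L) * t) * g t).
      apply: H => s Hs; first by apply: is_derive_opp; exact: D.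
      have := Hb s; have := ep (- (8 * L)) s.
      have := Rle_abs (2 * u s * du s + 2 * v s * dv s).
      by nra.
    by have := ep (- (8 * L)) t; nra.
  have := derive_nonneg_le (fun s => exp (8 * L * s) * g s)
      (fun s => exp (8 * L * s) * (2 * u s * du s + 2 * v s * dv s + 8 * L * g s)) t t0.
  rewrite gt0 => H.
  have : exp (8 * L * t) * g t <= exp (8 * L * t0) * 0.
    apply: H => [|s Hs|s Hs]; first lra; first exact: D.
    have := Hb s; have := ep (8 * L) s.
    have := Rle_abs (- (2 * u s * du s + 2 * v s * dv s)); rewrite Rabs_Ropp.
    by nra.
  by have := ep (8 * L) t; nra.
have : g t = 0 by have := g0 t; lra.
rewrite /g /u /v => E.
have [E1 E2] := Rplus_sqr_eq_0 _ _ E.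
rewrite (surjective_pairing (phi t)) (surjective_pairing (psi t)).
by congr pair; rewrite /Re /Im in E1 E2; lra.
Qed.

End BoundedLipschitzField.

(** * Locally Lipschitz functions *)

Definition locally_lipschitz (u : C -> R) (p : C) : Prop :=
  exists d L, 0 < d /\ 0 <= L /\ forall x y, Cmod (x - p) < d -> Cmod (y - p) < d ->
    Rabs (u x - u y) <= L * Cmod (x - y).

Lemma locally_lipschitz_continuous (u : C -> R) (p : C) :
  locally_lipschitz u p -> forall eps, 0 < eps ->
  exists d, 0 < d /\ forall x, Cmod (x - p) < d -> Rabs (u x - u p) < eps.
Proof.
move=> [d [L [d0 [L0 HL]]]] eps eps0.
have e0 : 0 < eps / (L + 1) by apply: Rdiv_lt_0_compat; lra.
exists (Rmin d (eps / (L + 1))); split; first exact: Rmin_pos.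
move=> x Hx.
have H1 : Cmod (x - p) < d by apply: Rlt_le_trans Hx (Rmin_l _ _).
have H2 : Cmod (x - p) < eps / (L + 1) by apply: Rlt_le_trans Hx (Rmin_r _ _).
apply: Rle_lt_trans (HL x p H1 _) _; first by rewrite Cmod_sub_diag.
have E : eps = (L + 1) * (eps / (L + 1)) by field; lra.
have := Cmod_ge_0 (x - p); nra.
Qed.

Lemma locally_lipschitz_bounded (u : C -> R) (p : C) :
  locally_lipschitz u p ->
  exists d M, 0 < d /\ 0 <= M /\ forall x, Cmod (x - p) < d -> Rabs (u x) <= M.
Proof.
move=> /locally_lipschitz_continuous/(_ 1 Rlt_0_1) [d [d0 Hd]].
exists d, (Rabs (u p) + 1); split=> //; split; first by have := Rabs_pos (u p); lra.
move=> x /Hd H; have := Rabs_triang (u x - u p) (u p).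
have -> : u x - u p + u p = u x by ring.
  lra.
Qed.

Lemma locally_lipschitz_nonzero (u : C -> R) (p : C) : locally_lipschitz u p -> u p <> 0 ->
  exists d, 0 < d /\ forall x, Cmod (x - p) < d -> u x <> 0.
Proof.
move=> Hu u0; have e0 : 0 < Rabs (u p) by apply: Rabs_pos_lt.
have [d [d0 Hd]] := locally_lipschitz_continuous _ _ Hu _ e0.
exists d; split=> // x /Hd Hx E; move: Hx.
by rewrite E Rminus_0_l Rabs_Ropp; lra.
Qed.

Lemma locally_lipschitz_ext (u v : C -> R) (p : C) (d : R) : 0 < d ->
  (forall x, Cmod (x - p) < d -> u x = v x) ->
  locally_lipschitz u p -> locally_lipschitz v p.
Proof.
move=> d0 E [d' [L [d'0 [L0 HL]]]]; exists (Rmin d d'), L.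
split; first exact: Rmin_pos.
split=> // x y Hx Hy.
rewrite -!E; try by apply: Rlt_le_trans (Rmin_l _ _); eassumption.
by apply: HL; apply: Rlt_le_trans (Rmin_r _ _); eassumption.
Qed.

Lemma locally_lipschitz_global (u : C -> R) (L : R) (p : C) : 0 <= L ->
  lipschitz L u -> locally_lipschitz u p.
Proof. by move=> L0 HL; exists 1, L; split; [lra | split]. Qed.

Lemma locally_lipschitz_plus (u v : C -> R) (p : C) :
  locally_lipschitz u p -> locally_lipschitz v p ->
  locally_lipschitz (fun x => u x + v x) p.
Proof.
move=> [d [L [d0 [L0 HL]]]] [d' [L' [d'0 [L'0 HL']]]].
exists (Rmin d d'), (L + L'); split; first exact: Rmin_pos.
split; first lra.
move=> x y Hx Hy.
have l1 := Rmin_l d d'; have l2 := Rmin_r d d'.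
have := HL x y ltac:(lra) ltac:(lra); have := HL' x y ltac:(lra) ltac:(lra).
have := Rabs_triang (u x - u y) (v x - v y).
have -> : u x + v x - (u y + v y) = u x - u y + (v x - v y) by ring.
lra.
Qed.

Lemma locally_lipschitz_mult (u v : C -> R) (p : C) :
  locally_lipschitz u p -> locally_lipschitz v p ->
  locally_lipschitz (fun x => u x * v x) p.
Proof.
move=> Hu Hv.
have [e [M [e0 [M0 HM]]]] := locally_lipschitz_bounded _ _ Hu.
have [e' [M' [e'0 [M'0 HM']]]] := locally_lipschitz_bounded _ _ Hv.
move: Hu Hv => [d [L [d0 [L0 HL]]]] [d' [L' [d'0 [L'0 HL']]]].
exists (Rmin (Rmin d d') (Rmin e e')), (M * L' + M' * L).
split; first by repeat apply: Rmin_pos.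
split; first nra.
move=> x y Hx Hy.
have l1 := Rmin_l d d'; have l2 := Rmin_r d d'.
have l3 := Rmin_l e e'; have l4 := Rmin_r e e'.
have l5 := Rmin_l (Rmin d d') (Rmin e e'); have l6 := Rmin_r (Rmin d d') (Rmin e e').
have H1 := HL x y ltac:(lra) ltac:(lra); have H2 := HL' x y ltac:(lra) ltac:(lra).
have H3 := HM x ltac:(lra); have H4 := HM' y ltac:(lra).
have -> : u x * v x - u y * v y = u x * (v x - v y) + (u x - u y) * v y by ring.
apply: Rle_trans (Rabs_triang _ _) _; rewrite !Rabs_mult.
have c0 := Cmod_ge_0 (x - y).
have := Rabs_pos (u x); have := Rabs_pos (v y).
have := Rabs_pos (u x - u y); have := Rabs_pos (v x - v y).
move: (Rabs (u x)) (Rabs (v y)) (Rabs (u x - u y)) (Rabs (v x - v y)) H1 H2 H3 H4.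
move=> a b q r H1 H2 H3 H4 r0 q0 b0 a0.
have : a * r <= M * (L' * Cmod (x - y)) by apply: Rmult_le_compat.
have : q * b <= (L * Cmod (x - y)) * M' by apply: Rmult_le_compat.
lra.
Qed.

Lemma locally_lipschitz_const (c : R) (p : C) : locally_lipschitz (fun _ => c) p.
Proof.
apply: (locally_lipschitz_global _ 0) => [|x y]; first lra.
by rewrite Rminus_eq_0 Rabs_R0; lra.
Qed.

Lemma locally_lipschitz_scal (c : R) (u : C -> R) (p : C) :
  locally_lipschitz u p -> locally_lipschitz (fun x => c * u x) p.
Proof. by move=> Hu; apply: locally_lipschitz_mult => //; exact: locally_lipschitz_const. Qed.

Lemma locally_lipschitz_sub (u v : C -> R) (p : C) :
  locally_lipschitz u p -> locally_lipschitz v p -> locally_lipschitz (fun x => u x - v x) p.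
Proof.
move=> Hu Hv; have := locally_lipschitz_plus _ _ _ Hu (locally_lipschitz_scal (-1) _ _ Hv).
by apply: (locally_lipschitz_ext _ _ _ 1) => [|x _]; [lra | ring].
Qed.

Lemma locally_lipschitz_comp (f df : R -> R) (u : C -> R) (p : C) :
  locally (u p) (fun s => is_derive f s (df s)) -> continuous df (u p) ->
  locally_lipschitz u p -> locally_lipschitz (fun x => f (u x)) p.
Proof.
move=> [e1 He1] /filterlim_locally/(_ (mkposreal 1 Rlt_0_1)) [e2 He2] Hu.
pose e := Rmin e1 e2.
have e0 : 0 < e by apply: Rmin_pos; apply: cond_pos.
have [d [d0 Hd]] := locally_lipschitz_continuous _ _ Hu e e0.
move: Hu => [d' [L [d'0 [L0 HL]]]].
have B0 : 0 <= Rabs (df (u p)) + 1 by have := Rabs_pos (df (u p)); lra.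
exists (Rmin d d'), ((Rabs (df (u p)) + 1) * L); split; first exact: Rmin_pos.
split; first nra.
move=> x y Hx Hy.
have l1 := Rmin_l d d'; have l2 := Rmin_r d d'.
have k1 := Rmin_l e1 e2; have k2 := Rmin_r e1 e2; rewrite -/e in k1 k2.
have Hx' := Hd x ltac:(lra); have Hy' := Hd y ltac:(lra).
have Hin s : Rmin (u y) (u x) <= s <= Rmax (u y) (u x) -> Rabs (s - u p) < e.
  move: Hx' Hy' => /Rabs_def2 [a1 a2] /Rabs_def2 [b1 b2] [].
  rewrite /Rmin /Rmax; case: Rle_dec => _ h1 h2; apply: Rabs_def1; lra.
have [s [/Hin Hs ->]] : exists s, Rmin (u y) (u x) <= s <= Rmax (u y) (u x) /\
    f (u x) - f (u y) = df s * (u x - u y).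
  apply: mean_value => s /Hin Hs; apply: He1.
  by rewrite /ball /= /AbsRing_ball /abs /minus /plus /opp /=; apply: Rlt_le_trans Hs k1.
rewrite Rabs_mult Rmult_assoc; apply: Rmult_le_compat; try exact: Rabs_pos.
  have : Rabs (df s - df (u p)) < 1.
    apply: He2.
    by rewrite /ball /= /AbsRing_ball /abs /minus /plus /opp /=; apply: Rlt_le_trans Hs k2.
  have := Rabs_triang (df s - df (u p)) (df (u p)).
  have -> : df s - df (u p) + df (u p) = df s by ring.
  lra.
by apply: HL; lra.
Qed.

Lemma locally_lipschitz_inv (u : C -> R) (p : C) : u p <> 0 ->
  locally_lipschitz u p -> locally_lipschitz (fun x => / u x) p.
Proof.
move=> u0; apply: (locally_lipschitz_comp Rinv (fun s => - 1 / s ^ 2)).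
  have d0 : 0 < Rabs (u p) by apply: Rabs_pos_lt.
  exists (mkposreal _ d0) => s.
  rewrite /ball /= /AbsRing_ball /abs /minus /plus /opp /= => Hs.
  have s0 : s <> 0.
    by move=> E; move: Hs; rewrite E Rplus_0_l Rabs_Ropp; lra.
  by auto_derive => //; field.
apply: ex_derive_continuous; auto_derive; rewrite Rmult_1_r.
exact: Rmult_integral_contrapositive_currified.
Qed.

(** * Planar Hamiltonian systems with compact energy windows *)

(** A Hamiltonian [H] on a planar domain [D], with partial derivatives [Hx] and
    [Hy], invariant under a group [Lam] of translations.  The chain rule is the
    only form of differentiability that the dynamics uses. *)
Record hamiltonian_on (D : C -> Prop) (H Hx Hy : C -> R) (Lam : C -> Prop) : Prop := {
  domain_open : forall p, D p -> exists d, 0 < d /\ forall x, Cmod (x - p) < d -> D x;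
  energy_lipschitz : forall p, D p -> locally_lipschitz H p;
  energy_x_lipschitz : forall p, D p -> locally_lipschitz Hx p;
  energy_y_lipschitz : forall p, D p -> locally_lipschitz Hy p;
  energy_chain : forall (gamma : R -> C) t v w, D (gamma t) ->
    is_derive (fun s => Re (gamma s)) t v -> is_derive (fun s => Im (gamma s)) t w ->
    is_derive (fun s => H (gamma s)) t (Hx (gamma t) * v + Hy (gamma t) * w);
  lattice_0 : Lam (RtoC 0);
  lattice_opp : forall l, Lam l -> Lam (- l)%C;
  lattice_plus : forall l m, Lam l -> Lam m -> Lam (l + m)%C;
  domain_shift : forall x l, Lam l -> D x -> D (x + l)%C;
  energy_shift : forall x l, Lam l -> H (x + l)%C = H x;
  energy_x_shift : forall x l, Lam l -> Hx (x + l)%C = Hx x;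
  energy_y_shift : forall x l, Lam l -> Hy (x + l)%C = Hy x }.

(** Accumulation modulo the lattice, which is accumulation in the quotient. *)
Definition cluster (Lam : C -> Prop) (x : nat -> C) (p : C) : Prop :=
  forall eps, 0 < eps -> forall N, exists n l,
    (N <= n)%coq_nat /\ Lam l /\ Cmod (x n + l - p) < eps.

(** Compactness, modulo the lattice, of the part of the domain whose energy
    differs from [h] by at most [1]. *)
Definition compact_window (D : C -> Prop) (H : C -> R) (Lam : C -> Prop) (h : R) : Prop :=
  forall x : nat -> C, (forall n, D (x n) /\ Rabs (H (x n) - h) <= 1) ->
    exists p, D p /\ cluster Lam x p.

(** The factor [k] is the symplectic scale; its sign carries the direction of
    time. *)
Definition solution (D : C -> Prop) (Hx Hy : C -> R) (k : R) (phi : R -> C) : Prop :=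
  forall t, D (phi t) /\
    is_derive (fun s => Re (phi s)) t (- k * Hy (phi t)) /\
    is_derive (fun s => Im (phi s)) t (k * Hx (phi t)).

Definition critical (Hx Hy : C -> R) (p : C) : Prop := Hx p = 0 /\ Hy p = 0.

Definition revisits (Lam : C -> Prop) (phi : R -> C) : Prop :=
  exists T, 0 < T /\ Lam (phi T - phi 0)%C.

Section Hamiltonian.
Variables (D : C -> Prop) (H Hx Hy : C -> R) (Lam : C -> Prop).
Hypothesis HH : hamiltonian_on D H Hx Hy Lam.

Lemma domain_shift_iff (x l : C) : Lam l -> D (x + l)%C <-> D x.
Proof.
move=> Hl; split; last exact: domain_shift HH _ _ Hl.
move=> Hx'; have := domain_shift _ _ _ _ _ HH _ _ (lattice_opp _ _ _ _ _ HH _ Hl) Hx'.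
by have -> : (x + l + - l)%C = x by ring.
Qed.

Section Cutoff.
Variable h : R.
Hypothesis Hwin : compact_window D H Lam h.

Let tent (s : R) : R := Rmax 0 (1 - Rabs (s - h)).

(* The cut-off depends on the energy alone: this keeps the cut-off field tangent
   to the level sets, and the level [h] itself is left untouched. *)
Definition cutoff (u : C -> R) (x : C) : R :=
  if excluded_middle_informative (D x) then tent (H x) * u x else 0.

Lemma tent_lipschitz (s t : R) : Rabs (tent s - tent t) <= 1 * Rabs (s - t).
Proof.
have := Rabs_triang_inv2 (s - h) (t - h).
have -> : s - h - (t - h) = s - t by ring.
rewrite Rmult_1_l => H1; apply: Rle_trans H1; rewrite /tent.
have := Rle_abs (Rabs (s - h) - Rabs (t - h)).
have := Rle_abs (- (Rabs (s - h) - Rabs (t - h))); rewrite Rabs_Ropp.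
have := Rabs_pos (Rabs (s - h) - Rabs (t - h)).
rewrite /Rmax; do 2 case: Rle_dec => ? *; apply: Rabs_le; lra.
Qed.

Lemma cutoff_level (u : C -> R) (x : C) : D x -> H x = h -> cutoff u x = u x.
Proof.
move=> Dx E; rewrite /cutoff; destruct (excluded_middle_informative (D x)) => //.
rewrite /tent E Rminus_eq_0 Rabs_R0 Rmax_right /=; [ring | lra].
Qed.

Lemma cutoff_support (u : C -> R) (x : C) : cutoff u x <> 0 ->
  D x /\ Rabs (H x - h) <= 1.
Proof.
rewrite /cutoff; destruct (excluded_middle_informative (D x)) as [Dx|nDx] => //= Hn; split=> //.
apply: Rnot_lt_le => Hlt; apply: Hn; rewrite /tent Rmax_left; [ring | lra].
Qed.

Section CutoffOf.
Variable u : C -> R.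
Hypothesis u_lipschitz : forall p, D p -> locally_lipschitz u p.
Hypothesis u_shift : forall x l, Lam l -> u (x + l)%C = u x.

Lemma cutoff_shift (x l : C) : Lam l -> cutoff u (x + l)%C = cutoff u x.
Proof.
move=> Hl; rewrite /cutoff u_shift // (energy_shift _ _ _ _ _ HH) //.
have := domain_shift_iff x l Hl.
by do 2 destruct (excluded_middle_informative _) => //=; tauto.
Qed.

Lemma cutoff_locally_lipschitz (p : C) : D p -> locally_lipschitz (cutoff u) p.
Proof.
move=> Dp; have [d [d0 Hd]] := domain_open _ _ _ _ _ HH p Dp.
apply: (locally_lipschitz_ext (fun x => tent (H x) * u x) _ _ d d0).
  by move=> x /Hd Dx; rewrite /cutoff; destruct (excluded_middle_informative (D x)) => /=.
apply: locally_lipschitz_mult (u_lipschitz p Dp).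
have [e [L [e0 [L0 HL]]]] := energy_lipschitz _ _ _ _ _ HH p Dp.
exists e, L; split=> //; split=> // x y Hx' Hy'.
by apply: Rle_trans (tent_lipschitz _ _) _; rewrite Rmult_1_l; apply: HL.
Qed.

(* Both bounds below come from sequences violating them with constant n:
   modulo the lattice they cluster in the domain, where the function is locally
   Lipschitz. *)
Lemma cutoff_bounded : exists B, forall x, Rabs (cutoff u x) <= B.
Proof.
apply: NNPP => Hno.
have Hx' n : exists x, INR n < Rabs (cutoff u x).
  apply: NNPP => H1; apply: Hno; exists (INR n) => x.
  by apply: Rnot_lt_le => H2; apply: H1; exists x.
have [x Hxn] := functional_choice _ Hx'.
have Hw n : D (x n) /\ Rabs (H (x n) - h) <= 1.
  apply: (cutoff_support u) => E; have := Hxn n; rewrite E Rabs_R0.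
  by have := pos_INR n; lra.
have [p [Dp Hp]] := Hwin x Hw.
have [d [M [d0 [M0 HM]]]] := locally_lipschitz_bounded _ _ (cutoff_locally_lipschitz p Dp).
have [N HN] := INR_unbounded M.
have [n [l [Hn [Hl Hnl]]]] := Hp d d0 N.
have := HM _ Hnl; rewrite cutoff_shift //.
have := Hxn n; have := le_INR _ _ Hn; lra.
Qed.

Lemma cutoff_lipschitz : exists L, lipschitz L (cutoff u).
Proof.
have [B HB] := cutoff_bounded.
apply: NNPP => Hno.
have Hx' n : exists xy : C * C, (D xy.1 /\ Rabs (H xy.1 - h) <= 1) /\
    INR n * Cmod (xy.1 - xy.2) < Rabs (cutoff u xy.1 - cutoff u xy.2).
  apply: NNPP => H1; apply: Hno; exists (INR n) => x y.
  apply: Rnot_lt_le => H2; apply: H1.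
  case: (Req_dec (cutoff u x) 0) => Ex; last first.
    by exists (x, y); split=> //; exact: cutoff_support Ex.
  exists (y, x); split; last by rewrite Cmod_sub_comm Rabs_minus_sym.
  apply: (cutoff_support u) => Ey; move: H2; rewrite Ex Ey Rminus_eq_0 Rabs_R0.
  by have := Rmult_le_pos _ _ (pos_INR n) (Cmod_ge_0 (x - y)); lra.
have [xy Hxy] := functional_choice _ Hx'.
have [p [Dp Hp]] := Hwin (fun n => (xy n).1) (fun n => (Hxy n).1).
have [d [L [d0 [L0 HL]]]] := cutoff_locally_lipschitz p Dp.
have [N HN] := INR_unbounded (L + 4 * B / d + 1).
have d2 : 0 < d / 2 by lra.
have [n [l [Hn [Hl Hnl]]]] := Hp (d / 2) d2 N.
have [_] := Hxy n; move: (xy n).1 (xy n).2 Hnl => x y Hnl Hlt.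
have B0 : 0 <= B by apply: Rle_trans (HB (RtoC 0)); exact: Rabs_pos.
have Hn' := le_INR _ _ Hn.
have Bd0 : 0 <= 4 * B / d by apply: Rdiv_le_0_compat; lra.
have c0 := Cmod_ge_0 (x - y).
have Hsmall : Cmod (x - y) < d / 2.
  have H2B : Rabs (cutoff u x - cutoff u y) <= 2 * B.
    apply: Rle_trans (Rabs_triang _ _) _; rewrite Rabs_Ropp.
    by have := HB x; have := HB y; lra.
  apply: Rnot_le_lt => Hge.
  have H1 : 4 * B / d * (d / 2) <= INR n * Cmod (x - y).
    by apply: Rmult_le_compat; lra.
  have E : 4 * B / d * (d / 2) = 2 * B by field; lra.
  lra.
have := HL (x + l)%C (y + l)%C.
rewrite !cutoff_shift //.
have -> : (x + l - (y + l))%C = (x - y)%C by ring.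
have Hy' : Cmod (y + l - p) < d.
  have := Cmod_sub_triangle (x + l) (y + l) p.
  have -> : (y + l - (x + l))%C = (y - x)%C by ring.
  rewrite (Cmod_sub_comm y x); lra.
move/(_ ltac:(lra) Hy'); nra.
Qed.

End CutoffOf.
End Cutoff.
End Hamiltonian.

(** * Solutions on a compact level *)

Definition isolated_critical (D : C -> Prop) (Hx Hy : C -> R) : Prop :=
  forall p, D p -> critical Hx Hy p -> exists e, 0 < e /\
    forall x, D x -> critical Hx Hy x -> Cmod (x - p) < e -> x = p.

Definition converges_to (Lam : C -> Prop) (phi : R -> C) (p : C) : Prop :=
  forall eps, 0 < eps -> exists T, forall t, T <= t ->
    exists l, Lam l /\ Cmod (phi t + l - p) < eps.

Lemma is_derive_comp_affine (f : R -> R) (a b t l : R) :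
  is_derive f (a * t + b) l -> is_derive (fun s => f (a * s + b)) t (a * l).
Proof.
move=> Hf; apply: (is_derive_comp f (fun s => a * s + b) t l a Hf).
by auto_derive => //; ring.
Qed.

Lemma solution_reverse (D : C -> Prop) (Hx Hy : C -> R) (k : R) (phi : R -> C) :
  solution D Hx Hy k phi -> solution D Hx Hy (- k) (fun t => phi (- t)).
Proof.
have E t : - t = -1 * t + 0 by ring.
move=> Hs t; have [Dp [D1 D2]] := Hs (- t); split=> //.
rewrite E in D1 D2.
split.
  have := is_derive_comp_affine _ _ _ _ _ D1.
  rewrite -E; have -> : -1 * (- k * Hy (phi (- t))) = - - k * Hy (phi (- t)) by ring.
  by apply: is_derive_ext => s; rewrite -E.
have := is_derive_comp_affine _ _ _ _ _ D2.
rewrite -E; have -> : -1 * (k * Hx (phi (- t))) = - k * Hx (phi (- t)) by ring.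
by apply: is_derive_ext => s; rewrite -E.
Qed.

Lemma solution_translate (D : C -> Prop) (Hx Hy : C -> R) (k s : R) (phi : R -> C) :
  solution D Hx Hy k phi -> solution D Hx Hy k (fun t => phi (t + s)).
Proof.
have E t : t + s = 1 * t + s by ring.
move=> Hs t; have [Dp [D1 D2]] := Hs (t + s); split=> //.
rewrite E in D1 D2.
split.
  have := is_derive_comp_affine _ _ _ _ _ D1.
  by rewrite -E Rmult_1_l; apply: is_derive_ext => u; rewrite -E.
have := is_derive_comp_affine _ _ _ _ _ D2.
by rewrite -E Rmult_1_l; apply: is_derive_ext => u; rewrite -E.
Qed.

Section Level.
Variables (D : C -> Prop) (H Hx Hy : C -> R) (Lam : C -> Prop).
Hypothesis HH : hamiltonian_on D H Hx Hy Lam.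
Variable k : R.
Hypothesis k0 : k <> 0.

Let sol := solution D Hx Hy k.

Lemma energy_conserved (phi : R -> C) : sol phi -> forall t, H (phi t) = H (phi 0).
Proof.
move=> Hphi; apply: (zero_derivative_constant (fun s => H (phi s))) => s.
have [Dp [D1 D2]] := Hphi s.
have := energy_chain _ _ _ _ _ HH _ _ _ _ Dp D1 D2.
by have -> : Hx (phi s) * (- k * Hy (phi s)) + Hy (phi s) * (k * Hx (phi s)) = 0 by ring.
Qed.

Lemma solution_shift (phi : R -> C) (l : C) : Lam l -> sol phi ->
  sol (fun t => phi t + l)%C.
Proof.
move=> Hl Hphi t; have [Dp [D1 D2]] := Hphi t.
split; first exact: domain_shift HH _ _ Hl Dp.
rewrite (energy_x_shift _ _ _ _ _ HH) // (energy_y_shift _ _ _ _ _ HH) //.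
split.
  have := is_derive_plus _ _ _ _ _ D1 (is_derive_const (Re l) t).
  by rewrite plus_zero_r.
have := is_derive_plus _ _ _ _ _ D2 (is_derive_const (Im l) t).
by rewrite plus_zero_r.
Qed.

Lemma cluster_energy (x : nat -> C) (p : C) (h : R) : D p ->
  (forall n, H (x n) = h) -> cluster Lam x p -> H p = h.
Proof.
move=> Dp Hx' Hp; apply: NNPP => Hne.
have e0 : 0 < Rabs (H p - h) by apply: Rabs_pos_lt; lra.
have [d [d0 Hd]] := locally_lipschitz_continuous _ _ (energy_lipschitz _ _ _ _ _ HH p Dp) _ e0.
have [n [l [_ [Hl Hnl]]]] := Hp d d0 0%nat.
have := Hd _ Hnl; rewrite (energy_shift _ _ _ _ _ HH) // Hx' Rabs_minus_sym; lra.
Qed.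

Lemma cluster_critical (x : nat -> C) (p : C) : D p ->
  (forall n, critical Hx Hy (x n)) -> cluster Lam x p -> critical Hx Hy p.
Proof.
move=> Dp Hx' Hp.
have main (u : C -> R) : locally_lipschitz u p ->
   (forall x l, Lam l -> u (x + l)%C = u x) -> (forall n, u (x n) = 0) -> u p = 0.
  move=> Hu Hs Hn; apply: NNPP => Hne.
  have e0 : 0 < Rabs (u p) by apply: Rabs_pos_lt.
  have [d [d0 Hd]] := locally_lipschitz_continuous _ _ Hu _ e0.
  have [n [l [_ [Hl Hnl]]]] := Hp d d0 0%nat.
  by have := Hd _ Hnl; rewrite Hs // Hn Rminus_0_l Rabs_Ropp; lra.
split; apply: main.
- exact: energy_x_lipschitz HH p Dp.
- exact: energy_x_shift HH.
- by move=> n; case: (Hx' n).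
- exact: energy_y_lipschitz HH p Dp.
- exact: energy_y_shift HH.
- by move=> n; case: (Hx' n).
Qed.

Variable h : R.
Hypothesis Hwin : compact_window D H Lam h.

Let X := cutoff D H h (fun x => - k * Hy x).
Let Y := cutoff D H h (fun x => k * Hx x).

Lemma cutoff_field_bounds : exists B L,
  (forall x, Rabs (X x) <= B) /\ (forall x, Rabs (Y x) <= B) /\
  lipschitz L X /\ lipschitz L Y.
Proof.
have X1 p : D p -> locally_lipschitz (fun x => - k * Hy x) p.
  by move=> Dp; apply/locally_lipschitz_scal/(energy_y_lipschitz _ _ _ _ _ HH).
have Y1 p : D p -> locally_lipschitz (fun x => k * Hx x) p.
  by move=> Dp; apply/locally_lipschitz_scal/(energy_x_lipschitz _ _ _ _ _ HH).
have X2 x l : Lam l -> - k * Hy (x + l)%C = - k * Hy x.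
  by move=> Hl; rewrite (energy_y_shift _ _ _ _ _ HH).
have Y2 x l : Lam l -> k * Hx (x + l)%C = k * Hx x.
  by move=> Hl; rewrite (energy_x_shift _ _ _ _ _ HH).
have [B HB] := cutoff_bounded _ _ _ _ _ HH h Hwin _ X1 X2.
have [B' HB'] := cutoff_bounded _ _ _ _ _ HH h Hwin _ Y1 Y2.
have [L HL] := cutoff_lipschitz _ _ _ _ _ HH h Hwin _ X1 X2.
have [L' HL'] := cutoff_lipschitz _ _ _ _ _ HH h Hwin _ Y1 Y2.
exists (Rmax B B'), (Rmax L L'); split; last split; last split.
- by move=> x; apply: Rle_trans (HB x) (Rmax_l _ _).
- by move=> x; apply: Rle_trans (HB' x) (Rmax_r _ _).
- move=> x y; apply: Rle_trans (HL x y) _.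
  by apply: Rmult_le_compat_r (Rmax_l _ _); exact: Cmod_ge_0.
- move=> x y; apply: Rle_trans (HL' x y) _.
  by apply: Rmult_le_compat_r (Rmax_r _ _); exact: Cmod_ge_0.
Qed.

Lemma solution_integral_curve (phi : R -> C) : sol phi -> H (phi 0) = h ->
  integral_curve X Y phi.
Proof.
move=> Hphi E t; have [Dp [D1 D2]] := Hphi t.
have Et : H (phi t) = h by rewrite energy_conserved.
by rewrite /X /Y !cutoff_level.
Qed.

(** A curve of the cut-off field cannot leave the domain, since the cut-off
    field vanishes outside; in the domain it is tangent to the level sets, and
    on its own level it is the Hamiltonian field. *)
Lemma level_solution_exists (x0 : C) : D x0 -> H x0 = h ->
  exists phi, phi 0 = x0 /\ sol phi.
Proof.
move=> Dx0 Ex0.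
have [B [L [BX [BY [LX LY]]]]] := cutoff_field_bounds.
have [phi [E0 Hphi]] := integral_curve_exists X Y B L BX BY LX LY x0.
exists phi; split=> //.
have Dphi t : D (phi t).
  apply: NNPP => Dt.
  have Z u : cutoff D H h u (phi t) = 0.
    by apply: NNPP => /cutoff_support [].
  have Hc : integral_curve X Y (fun _ => phi t).
    by rewrite /X /Y => s; rewrite !Z; split; exact: is_derive_const.
  apply: Dt; rewrite -(integral_curve_unique X Y L LX LY _ _ t Hphi Hc _ 0) //.
  by rewrite E0.
have in_D u x : D x -> cutoff D H h u x = Rmax 0 (1 - Rabs (H x - h)) * u x.
  by move=> Dx; rewrite /cutoff; destruct (excluded_middle_informative (D x)).
have Hd s : is_derive (fun s => H (phi s)) s 0.
  have [D1 D2] := Hphi s.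
  have := energy_chain _ _ _ _ _ HH _ _ _ _ (Dphi s) D1 D2.
  rewrite /X /Y !in_D //; set c := Rmax _ _.
  by have -> : Hx (phi s) * (c * (- k * Hy (phi s))) + Hy (phi s) * (c * (k * Hx (phi s))) = 0 by ring.
have Ephi t : H (phi t) = h.
  by rewrite (zero_derivative_constant _ Hd) E0.
move=> t; split; first exact: Dphi.
by have := Hphi t; rewrite /X /Y !cutoff_level.
Qed.

Lemma level_solution_unique (phi psi : R -> C) (t0 : R) : sol phi -> sol psi ->
  H (phi 0) = h -> phi t0 = psi t0 -> forall t, phi t = psi t.
Proof.
move=> Hphi Hpsi E Et.
have [B [L [BX [BY [LX LY]]]]] := cutoff_field_bounds.
apply: (integral_curve_unique X Y L LX LY phi psi t0) => //.
  exact: solution_integral_curve.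
apply: solution_integral_curve => //.
by rewrite -(energy_conserved _ Hpsi t0) -Et energy_conserved.
Qed.

Lemma level_speed_bound : exists B, 0 <= B /\ forall phi, sol phi -> H (phi 0) = h ->
    forall s t, Cmod (phi s - phi t) <= B * Rabs (s - t).
Proof.
have [B [L [BX [BY [LX LY]]]]] := cutoff_field_bounds.
exists (2 * B); split.
  by have := field_bound_nonneg X B BX; lra.
move=> phi Hphi E.
exact: (integral_curve_slow X Y B BX BY) (solution_integral_curve _ Hphi E).
Qed.

(** Near a regular point the energy and the linear coordinate along the flow
    are together injective.  Since the linear coordinate increases along
    solutions, two nearby points of equal energy lie on one solution. *)
Lemma flow_box (p : C) : D p -> ~ critical Hx Hy p ->
  exists r, 0 < r /\ forall x y phi, Cmod (x - p) < r -> Cmod (y - p) < r ->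
    H x = h -> H y = h -> sol phi -> phi 0 = x ->
    exists s, Rabs s <= 1 /\ phi s = y.
Proof.
move=> Dp Hreg.
have [B [B0 HB]] := level_speed_bound.
pose gx := Hx p; pose gy := Hy p.
pose G := gx * gx + gy * gy.
have G0 : 0 < G.
  apply: Rnot_le_lt => Hle; apply: Hreg.
  by apply: Rplus_sqr_eq_0; rewrite /Rsqr; rewrite /G /gx /gy in Hle; nra.
pose q z := gx * Hx z + gy * Hy z.
have [rad [R0 [RD Rq]]] : exists rad, 0 < rad /\ (forall z, Cmod (z - p) < rad -> D z) /\ (forall z, Cmod (z - p) < rad -> G / 2 < q z).
  have Hq : locally_lipschitz q p.
    apply: locally_lipschitz_plus; apply: locally_lipschitz_scal.
      exact: energy_x_lipschitz HH p Dp.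
    exact: energy_y_lipschitz HH p Dp.
  have G2 : 0 < G / 2 by lra.
  have [d [d0 Hd]] := locally_lipschitz_continuous _ _ Hq _ G2.
  have [d' [d'0 Hd']] := domain_open _ _ _ _ _ HH p Dp.
  exists (Rmin d d'); split; first exact: Rmin_pos.
  have l1 := Rmin_l d d'; have l2 := Rmin_r d d'.
  split=> z Hz; first by apply: Hd'; lra.
  have := Hd z ltac:(lra); have -> : q p = G by [].
  by move/Rabs_def2; lra.
have inj x y : Cmod (x - p) < rad -> Cmod (y - p) < rad -> H x = H y ->
    gx * (Im y - Im x) = gy * (Re y - Re x) -> x = y.
  move=> Hx' Hy' EH EL.
  pose m := (gx * (Re y - Re x) + gy * (Im y - Im x)) / G.
  have Em1 : Re y - Re x = m * gx.
    apply: (Rmult_eq_reg_r G); last lra.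
    rewrite /m; have -> : (gx * (Re y - Re x) + gy * (Im y - Im x)) / G * gx * G =
      (gx * (Re y - Re x)) * gx + gy * (gx * (Im y - Im x)) by field; lra.
    by rewrite EL /G; ring.
  have Em2 : Im y - Im x = m * gy.
    apply: (Rmult_eq_reg_r G); last lra.
    rewrite /m; have -> : (gx * (Re y - Re x) + gy * (Im y - Im x)) / G * gy * G =
      (gy * (Re y - Re x)) * gx + gy * gy * (Im y - Im x) by field; lra.
    by rewrite -EL /G; ring.
  pose gam (s : R) : C := (Re x + s * (m * gx), Im x + s * (m * gy)).
  have Hgam s : 0 <= s <= 1 -> Cmod (gam s - p) < rad.
    move=> Hs.
    have -> : (gam s - p)%C = (RtoC (1 - s) * (x - p) + RtoC s * (y - p))%C.
      rewrite /gam -Em1 -Em2; case: (x) (y) (p) => [x1 x2] [y1 y2] [p1 p2].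
      by rewrite /Cminus /Cplus /Copp /Cmult /RtoC /=; congr pair; ring.
    apply: Rle_lt_trans (Cmod_triangle _ _) _; rewrite !Cmod_mult !Cmod_R.
    rewrite !Rabs_pos_eq; try lra.
    by case: (Req_dec s 0) => [->|]; nra.
  have [c []] : exists c, Rmin 0 1 <= c <= Rmax 0 1 /\ H (gam 1) - H (gam 0) = (m * q (gam c)) * (1 - 0).
    apply: (mean_value (fun s => H (gam s)) (fun s => m * q (gam s))) => s.
    rewrite Rmin_left ?Rmax_right; try lra; move=> Hs.
    have := energy_chain _ _ _ _ _ HH gam s (m * gx) (m * gy) (RD _ (Hgam s Hs)).
    have -> : Hx (gam s) * (m * gx) + Hy (gam s) * (m * gy) = m * q (gam s) by rewrite /q; ring.
    by apply; rewrite /gam /Re /Im /=; auto_derive => //; ring.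
  rewrite Rmin_left ?Rmax_right; try lra; move=> Hc.
  have -> : gam 0 = x by rewrite /gam; case: (x) => a b /=; congr pair; ring.
  have -> : gam 1 = y.
    rewrite /gam !Rmult_1_l -Em1 -Em2; case: (x) (y) => [a b] [a' b'] /=.
    by congr pair; ring.
  rewrite EH => Em.
  have m0 : m = 0.
    have := Rq _ (Hgam c Hc) => Hq.
    have : m * q (gam c) = 0 by lra.
    by case/Rmult_integral => //; lra.
  rewrite m0 in Em1 Em2.
  by case: (x) (y) Em1 Em2 => [a b] [a' b'] /= *; congr pair; lra.
pose s0 := Rmin 1 (rad / (4 * (B + 1))).
have s0p : 0 < s0 by apply: Rmin_pos; [lra | apply: Rdiv_lt_0_compat; lra].
have s01 : s0 <= 1 by exact: Rmin_l.
have s0B : B * s0 <= rad / 4.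
  have := Rmin_r 1 (rad / (4 * (B + 1))); rewrite -/s0 => Hs.
  have E : rad / 4 = (B + 1) * (rad / (4 * (B + 1))) by field; lra.
  by rewrite E; apply: Rmult_le_compat; lra.
have ka : 0 < Rabs k by apply: Rabs_pos_lt.
pose w := Rabs k * (G / 2) * s0 / (4 * (Rabs gx + Rabs gy + 1)).
have w0 : 0 < w.
  apply: Rdiv_lt_0_compat; last by have := Rabs_pos gx; have := Rabs_pos gy; lra.
  by repeat apply: Rmult_lt_0_compat; lra.
exists (Rmin (rad / 2) w); split; first by apply: Rmin_pos; lra.
move=> x y phi Hx' Hy' Ex Ey Hphi E0.
have l1 := Rmin_l (rad / 2) w; have l2 := Rmin_r (rad / 2) w.
have Ephi : H (phi 0) = h by rewrite E0.
have near s : Rabs s <= s0 -> Cmod (phi s - p) < rad.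
  move=> Hs; have := Cmod_sub_triangle x (phi s) p.
  have := HB phi Hphi Ephi s 0; rewrite E0 Rminus_0_r.
  have : B * Rabs s <= B * s0 by apply: Rmult_le_compat_l.
  lra.
pose ell s := (gx * Im (phi s) - gy * Re (phi s)) / k.
have Dell s : is_derive ell s (q (phi s)).
  have [_ [D1 D2]] := Hphi s.
  have := is_derive_scal _ s (/ k) _ (is_derive_minus _ _ _ _ _
     (is_derive_scal _ s gx _ D2) (is_derive_scal _ s gy _ D1)).
  rewrite /minus /plus /opp /=.
  have -> : / k * (gx * (k * Hx (phi s)) + - (gy * (- k * Hy (phi s)))) = q (phi s).
    by rewrite /q; field.
  by apply: is_derive_ext => u; rewrite /ell /plus /opp /=; field.
have grow a b : - s0 <= a -> a <= b -> b <= s0 -> ell a + G / 2 * (b - a) <= ell b.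
  move=> Ha Hab Hb.
  have [|c []] := mean_value ell (fun s => q (phi s)) a b; first by move=> *; exact: Dell.
  rewrite Rmin_left // Rmax_right // => Hc Ec.
  have := Rq _ (near c ltac:(apply: Rabs_le; lra)).
  by nra.
pose ely := (gx * Im y - gy * Re y) / k.
have Hely : Rabs (ely - ell 0) < G / 2 * s0.
  have -> : ely - ell 0 = (gx * Im (y - x) - gy * Re (y - x)) / k.
    have -> : Im (y - x) = Im y - Im x by [].
    have -> : Re (y - x) = Re y - Re x by [].
    by rewrite /ely /ell E0; field.
  rewrite Rabs_div //; apply: (Rmult_lt_reg_r (Rabs k)) => //.
  have -> : Rabs (gx * Im (y - x) - gy * Re (y - x)) / Rabs k * Rabs k =
            Rabs (gx * Im (y - x) - gy * Re (y - x)) by field; lra.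
  apply: Rle_lt_trans (Rabs_triang _ _) _; rewrite Rabs_Ropp !Rabs_mult.
  have Hyx : Cmod (y - x) < 2 * w.
    have := Cmod_sub_triangle p y x; rewrite (Cmod_sub_comm p x); lra.
  have h1 := Re_le_Cmod (y - x); have h2 := Im_le_Cmod (y - x).
  have a1 := Rabs_pos gx; have a2 := Rabs_pos gy.
  have m1 : Rabs gx * Rabs (Im (y - x)) <= Rabs gx * (2 * w) by apply: Rmult_le_compat_l; lra.
  have m2 : Rabs gy * Rabs (Re (y - x)) <= Rabs gy * (2 * w) by apply: Rmult_le_compat_l; lra.
  have Ew : w * (4 * (Rabs gx + Rabs gy + 1)) = Rabs k * (G / 2) * s0.
    by rewrite /w; field; lra.
  nra.
have [s [Hs Es]] : {s | Rmin (- s0) s0 <= s <= Rmax (- s0) s0 /\ ell s = ely}.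
  apply: IVT_gen.
    by move=> s; exact: is_derive_continuity_pt (Dell s).
  have g1 := grow (- s0) 0 ltac:(lra) ltac:(lra) ltac:(lra).
  have g2 := grow 0 s0 ltac:(lra) ltac:(lra) ltac:(lra).
  move/Rabs_def2: Hely => [u1 u2].
  rewrite Rmin_left ?Rmax_right; lra.
rewrite Rmin_left ?Rmax_right in Hs; try lra.
have Hs' : Rabs s <= s0 by apply: Rabs_le; lra.
exists s; split; first lra.
apply: inj; first exact: near; first lra.
  by rewrite energy_conserved // Ephi.
have := Rmult_eq_compat_r k _ _ Es; rewrite /ell /ely.
have -> : forall u, u / k * k = u by move=> u; field.
have -> : forall u, u / k * k = u by move=> u; field.
lra.
Qed.

End Level.

(** * Recurrence *)

Section Return.
Variables (D : C -> Prop) (H Hx Hy : C -> R) (Lam : C -> Prop).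
Hypothesis HH : hamiltonian_on D H Hx Hy Lam.
Variable k : R.
Hypothesis k0 : k <> 0.
Variable h : R.
Hypothesis Hwin : compact_window D H Lam h.

Let sol := solution D Hx Hy k.

(** Two visits of the flow box at an accumulation point lie on one solution, so
    that the orbit closes up; by uniqueness it did so from the start. *)
Lemma regular_accumulation_revisits (phi : R -> C) (tn : nat -> R) (p : C) :
  sol phi -> H (phi 0) = h -> (forall n, INR n <= tn n) ->
  D p -> ~ critical Hx Hy p -> cluster Lam (fun n => phi (tn n)) p ->
  revisits Lam phi.
Proof.
move=> Hphi E Htn Dp Hreg Hp.
have Ephi t : H (phi t) = h by rewrite (energy_conserved _ _ _ _ _ HH k phi Hphi).
have [r [r0 Hr]] := flow_box _ _ _ _ _ HH k k0 h Hwin p Dp Hreg.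
have [n [l [_ [Hl Hnl]]]] := Hp r r0 0%nat.
have [N HN] := INR_unbounded (tn n + 1).
have [m [l' [Hm [Hl' Hml]]]] := Hp r r0 N.
have Hs1 : sol (fun t => phi (t + tn n)%R + l)%C.
  by apply: (solution_shift _ _ _ _ _ HH) => //; exact: solution_translate.
have [|||s [Hs Es]] := Hr (phi (tn n) + l)%C (phi (tn m) + l')%C _ Hnl Hml _ _ Hs1.
- by rewrite (energy_shift _ _ _ _ _ HH).
- by rewrite (energy_shift _ _ _ _ _ HH).
- by rewrite Rplus_0_l.
pose T := tn m - (s + tn n).
have T0 : 0 < T.
  have := Htn m; have := le_INR _ _ Hm; have := Rle_abs s; rewrite /T; lra.
have Hs2 : sol (fun t => phi (t + T)%R + (l' - l))%C.
  apply: (solution_shift _ _ _ _ _ HH); last exact: solution_translate.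
  exact: (lattice_plus _ _ _ _ _ HH) Hl' (lattice_opp _ _ _ _ _ HH _ Hl).
have Hagree := level_solution_unique _ _ _ _ _ HH k h Hwin phi _ (s + tn n) Hphi Hs2 E.
exists T; split=> //.
have Evisit : phi (s + tn n) = (phi (s + tn n + T)%R + (l' - l))%C.
  have -> : s + tn n + T = tn m by rewrite /T; ring.
  have -> : (phi (tn m) + (l' - l))%C = (phi (tn m) + l' - l)%C by ring.
  by rewrite -Es; ring.
have -> : (phi T - phi 0)%C = (l - l')%C.
  by rewrite (Hagree Evisit 0) Rplus_0_l; ring.
exact: (lattice_plus _ _ _ _ _ HH) Hl (lattice_opp _ _ _ _ _ HH _ Hl').
Qed.

Lemma level_cluster (phi : R -> C) (tn : nat -> R) : sol phi -> H (phi 0) = h ->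
  exists p, D p /\ cluster Lam (fun n => phi (tn n)) p.
Proof.
move=> Hphi E; apply: Hwin => n; split; first by case: (Hphi (tn n)).
by rewrite (energy_conserved _ _ _ _ _ HH k phi Hphi) E Rminus_eq_0 Rabs_R0; lra.
Qed.

Theorem regular_level_revisits (phi : R -> C) : (forall p, D p -> ~ critical Hx Hy p) ->
  sol phi -> H (phi 0) = h -> revisits Lam phi.
Proof.
move=> Hreg Hphi E; have [p [Dp Hp]] := level_cluster phi INR Hphi E.
apply: (regular_accumulation_revisits phi INR p) => //; last exact: Hreg.
by move=> n; exact: Rle_refl.
Qed.

(** A solution that never revisits accumulates at critical points only; if it
    left a neighbourhood of one of them again and again, it would accumulate on
    the boundary of this neighbourhood too. *)
Theorem level_dichotomy (phi : R -> C) : isolated_critical D Hx Hy ->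
  sol phi -> H (phi 0) = h ->
  revisits Lam phi \/
  exists p, D p /\ critical Hx Hy p /\ H p = h /\ converges_to Lam phi p.
Proof.
move=> Hiso Hphi E.
have Ephi t : H (phi t) = h by rewrite (energy_conserved _ _ _ _ _ HH k phi Hphi).
case: (classic (revisits Lam phi)) => [|Hno]; first by left.
right; have [p [Dp Hp]] := level_cluster phi INR Hphi E.
have crit p' tn : (forall n, INR n <= tn n) -> D p' ->
    cluster Lam (fun n => phi (tn n)) p' -> critical Hx Hy p'.
  move=> Htn Dp' Hp'; apply: NNPP => Hreg; apply: Hno.
  exact: (regular_accumulation_revisits phi tn p').
have Cp : critical Hx Hy p by apply: (crit p INR) => // n; exact: Rle_refl.
exists p; split=> //; split=> //; split.
  exact: (cluster_energy _ _ _ _ _ HH (fun n => phi (INR n))).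
move=> eps eps0; apply: NNPP => Hnc.
have [e0 [e0p He0]] := Hiso p Dp Cp.
pose e := Rmin eps e0 / 2.
have ep : 0 < e by rewrite /e; have := Rmin_pos _ _ eps0 e0p; lra.
have eeps : e < eps by rewrite /e in ep *; have := Rmin_l eps e0; lra.
have ee0 : 2 * e <= e0 by rewrite /e; have := Rmin_r eps e0; lra.
have cont l : continuity (fun s => Cmod (phi s + l - p)).
  have [B [B0 HB]] := level_speed_bound _ _ _ _ _ HH k h Hwin.
  move=> t; apply/continuity_pt_filterlim; move: t.
  apply: (lipschitz_continuous (fun s => Cmod (phi s + l - p)) B) => s u.
  apply: Rle_trans (HB phi Hphi E s u).
  have -> : (phi s - phi u)%C = ((phi s + l - p) - (phi u + l - p))%C by ring.
  apply: Rabs_le; have := Cmod_sub_triangle (phi u + l - p) (phi s + l - p) (RtoC 0).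
  have := Cmod_sub_triangle (phi s + l - p) (phi u + l - p) (RtoC 0).
  have z x : (x - RtoC 0)%C = x by ring.
  rewrite !z (Cmod_sub_comm (phi u + l - p) (phi s + l - p)); lra.
have Hcross n : exists sl : R * C, INR n <= sl.1 /\ Lam sl.2 /\
    Cmod (phi sl.1 + sl.2 - p) = e.
  have [m [l [Hm [Hl Hml]]]] := Hp e ep n.
  have [t [Ht Hfar]] : exists t, INR m <= t /\
      forall l, Lam l -> eps <= Cmod (phi t + l - p).
    apply: NNPP => H1; apply: Hnc; exists (INR m) => t Ht.
    apply: NNPP => H2; apply: H1; exists t; split=> // l' Hl'.
    by apply: Rnot_lt_le => H3; apply: H2; exists l'.
  have [s [Hs Es]] : {s | Rmin (INR m) t <= s <= Rmax (INR m) t /\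
      Cmod (phi s + l - p) = e}.
    apply: (IVT_gen _ _ _ _ (cont l)).
    by have := Hfar l Hl => H1; rewrite Rmin_left ?Rmax_right; lra.
  exists (s, l); split=> //=.
  by have := le_INR _ _ Hm; move: Hs; rewrite Rmin_left //; lra.
have [sl Hsl] := functional_choice _ Hcross.
have [p' [Dp' Hp']] := level_cluster phi (fun n => (sl n).1) Hphi E.
have Cp' : critical Hx Hy p'.
  by apply: (crit p' (fun n => (sl n).1)) => // n; case: (Hsl n).
have e2 : 0 < e / 2 by lra.
have [n [l [_ [Hl Hnl]]]] := Hp' (e / 2) e2 0%nat.
have [_ [Hl1 He1]] := Hsl n.
move: (sl n).1 (sl n).2 Hnl Hl1 He1 => s l1 Hnl Hl1 He1.
pose p2 := (p' + (l1 - l))%C.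
have Hl2 : Lam (l1 - l)%C.
  exact: (lattice_plus _ _ _ _ _ HH) Hl1 (lattice_opp _ _ _ _ _ HH _ Hl).
have Hd : Cmod (phi s + l1 - p2) < e / 2.
  by have -> : (phi s + l1 - p2)%C = (phi s + l - p')%C by rewrite /p2; ring.
have Hp2 : p2 = p.
  apply: He0; first exact: (domain_shift _ _ _ _ _ HH).
    case: Cp' => c1 c2.
    by split; rewrite /p2 ?(energy_x_shift _ _ _ _ _ HH) ?(energy_y_shift _ _ _ _ _ HH).
  have := Cmod_sub_triangle (phi s + l1) p2 p.
  rewrite (Cmod_sub_comm p2 (phi s + l1)); lra.
by rewrite Hp2 in Hd; lra.
Qed.

(** Critical points of distinct energies tending to [h] would accumulate at a
    critical point that is not isolated. *)
Lemma critical_energies_isolated : isolated_critical D Hx Hy ->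
  exists e, 0 < e /\ forall p, D p -> critical Hx Hy p -> Rabs (H p - h) < e -> H p = h.
Proof.
move=> Hiso; apply: NNPP => Hno.
have Hx' n : exists p, (D p /\ critical Hx Hy p) /\ Rabs (H p - h) < / (INR n + 1) /\ H p <> h.
  apply: NNPP => H1; apply: Hno; exists (/ (INR n + 1)); split.
    by apply: Rinv_0_lt_compat; have := pos_INR n; lra.
  move=> p Dp Cp Hp; apply: NNPP => Hne; apply: H1; exists p.
  by split.
have [x Hxn] := functional_choice _ Hx'.
have inv_small n : / (INR n + 1) <= 1.
  rewrite -{2}Rinv_1; apply: Rinv_le_contravar; first lra.
  by have := pos_INR n; lra.
have [|p [Dp Hp]] := Hwin x.
  by move=> n; have [[Dn _] [Hn _]] := Hxn n; split=> //; have := inv_small n; lra.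
have Cp : critical Hx Hy p.
  by apply: (cluster_critical _ _ _ _ _ HH x) => // n; case: (Hxn n) => [[]].
have [e0 [e0p He0]] := Hiso p Dp Cp.
have Eall N : exists n, (N <= n)%coq_nat /\ H (x n) = H p.
  have [n [l [Hn [Hl Hnl]]]] := Hp e0 e0p N.
  have [[Dn [c1 c2]] _] := Hxn n.
  exists n; split=> //; rewrite -(energy_shift _ _ _ _ _ HH (x n) l) //.
  congr H; apply: He0 => //; first exact: (domain_shift _ _ _ _ _ HH).
  by split; rewrite ?(energy_x_shift _ _ _ _ _ HH) ?(energy_y_shift _ _ _ _ _ HH).
have [n0 [_ En0]] := Eall 0%nat.
have Hne : H p <> h by rewrite -En0; case: (Hxn n0) => _ [].
have d0 : 0 < Rabs (H p - h) by apply: Rabs_pos_lt; lra.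
have [N [HN N0]] := archimed_cor1 _ d0.
have [n [Hn En]] := Eall N.
have [_ [Hsm _]] := Hxn n.
have : / (INR n + 1) <= / INR N.
  apply: Rinv_le_contravar; first exact: lt_0_INR.
  by have := le_INR _ _ Hn; lra.
by rewrite En in Hsm; lra.
Qed.

End Return.

(** * The logarithm of the complex sine and its gradient *)

(** [|sin z|^2], and the gradient of [ln |sin z|], which is the conjugate of
    [cot z]. *)
Definition sin_sq (z : C) : R := sin (Re z) ^ 2 + sinh (Im z) ^ 2.
Definition ln_sin (z : C) : R := ln (sin_sq z) / 2.
Definition cot_re (z : C) : R := sin (Re z) * cos (Re z) / sin_sq z.
Definition cot_im (z : C) : R := sinh (Im z) * cosh (Im z) / sin_sq z.

Lemma cosh_sinh_sq (y : R) : cosh y ^ 2 = 1 + sinh y ^ 2.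
Proof.
rewrite /cosh /sinh; have := exp_plus y (- y); rewrite Rplus_opp_r exp_0 => E.
by apply: (Rmult_eq_reg_l 4); last lra; field_simplify; nra.
Qed.

Lemma cosh_ge_1 (y : R) : 1 <= cosh y.
Proof.
have c0 : 0 < cosh y by rewrite /cosh; have := exp_pos y; have := exp_pos (- y); lra.
by have := cosh_sinh_sq y; nra.
Qed.

Lemma sinh_neg (y : R) : sinh (- y) = - sinh y.
Proof. by rewrite /sinh Ropp_involutive; field. Qed.

Lemma cosh_neg (y : R) : cosh (- y) = cosh y.
Proof. by rewrite /cosh Ropp_involutive Rplus_comm. Qed.

Lemma sinh_eq_0 (y : R) : sinh y = 0 -> y = 0.
Proof. by move=> E; have := arcsinh_sinh y; rewrite E -{1}sinh_0 arcsinh_sinh. Qed.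

Lemma sin_sq_nonneg (z : C) : 0 <= sin_sq z.
Proof. by rewrite /sin_sq; have := pow2_ge_0 (sin (Re z)); have := pow2_ge_0 (sinh (Im z)); lra. Qed.

Lemma sin_sq_pos (z : C) : sin_sq z <> 0 -> 0 < sin_sq z.
Proof. by have := sin_sq_nonneg z; lra. Qed.

Lemma sin_sq_eq_0 (z : C) : sin_sq z = 0 <-> exists n : Z, z = RtoC (IZR n * PI).
Proof.
split.
  rewrite /sin_sq => E.
  have [E1 E2] : sin (Re z) = 0 /\ sinh (Im z) = 0.
    by apply: Rplus_sqr_eq_0; rewrite -!Rsqr_pow2 in E.
  have [n En] := sin_eq_0_0 _ E1; exists n.
  by rewrite (surjective_pairing z) /RtoC; congr pair; [exact: En | exact: sinh_eq_0].
case=> n ->; rewrite /sin_sq /= sinh_0.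
by rewrite sin_eq_0_1; [ring | exists n].
Qed.

Lemma sin_cos_shift (x : R) (n : Z) :
  (sin (x + IZR n * PI) = sin x /\ cos (x + IZR n * PI) = cos x) \/
  (sin (x + IZR n * PI) = - sin x /\ cos (x + IZR n * PI) = - cos x).
Proof.
have s0 : sin (IZR n * PI) = 0 by apply: sin_eq_0_1; exists n.
rewrite sin_plus cos_plus s0.
have := sin2_cos2 (IZR n * PI); rewrite s0 /Rsqr => E.
have : (cos (IZR n * PI) - 1) * (cos (IZR n * PI) + 1) = 0 by nra.
case/Rmult_integral => E1.
  left; have -> : cos (IZR n * PI) = 1 by lra.
  by split; ring.
right; have -> : cos (IZR n * PI) = -1 by lra.
by split; ring.
Qed.

Lemma sin_functions_shift (z : C) (n : Z) :
  sin_sq (z + RtoC (IZR n * PI)) = sin_sq z /\ ln_sin (z + RtoC (IZR n * PI)) = ln_sin z /\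
  cot_re (z + RtoC (IZR n * PI)) = cot_re z /\ cot_im (z + RtoC (IZR n * PI)) = cot_im z.
Proof.
have E1 : Re (z + RtoC (IZR n * PI)) = Re z + IZR n * PI by [].
have E2 : Im (z + RtoC (IZR n * PI)) = Im z + 0 by [].
have ES : sin_sq (z + RtoC (IZR n * PI)) = sin_sq z.
  rewrite /sin_sq E1 E2 Rplus_0_r.
  by case: (sin_cos_shift (Re z) n) => -[-> _]; ring.
rewrite /ln_sin /cot_re /cot_im !ES E1 E2 Rplus_0_r; split=> //; split=> //; split=> //.
by case: (sin_cos_shift (Re z) n) => -[-> ->]; rewrite /Rdiv; ring.
Qed.

Lemma ln_sin_chain_real (x y : R -> R) (t v w : R) :
  let S := sin (x t) ^ 2 + sinh (y t) ^ 2 in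
  S <> 0 -> 0 < S -> is_derive x t v -> is_derive y t w ->
  is_derive (fun s => ln (sin (x s) ^ 2 + sinh (y s) ^ 2) / 2) t
    (sin (x t) * cos (x t) / S * v + sinh (y t) * cosh (y t) / S * w).
Proof.
move=> S S0 Sp Hv Hw.
auto_derive.
  by repeat split; try (eexists; eauto); rewrite /S /= !Rmult_1_r in Sp *.
rewrite (is_derive_unique _ _ _ Hv) (is_derive_unique _ _ _ Hw) /S.
by field; rewrite /S in S0; move: S0; rewrite /= !Rmult_1_r.
Qed.

Lemma ln_sin_chain (gamma : R -> C) (t v w : R) : sin_sq (gamma t) <> 0 ->
  is_derive (fun s => Re (gamma s)) t v -> is_derive (fun s => Im (gamma s)) t w ->
  is_derive (fun s => ln_sin (gamma s)) t (cot_re (gamma t) * v + cot_im (gamma t) * w).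
Proof.
move=> H0 Hv Hw; have Hp := sin_sq_pos _ H0.
rewrite /ln_sin /cot_re /cot_im; move: H0 Hp; rewrite /sin_sq.
by move=> S0 Sp; exact: (ln_sin_chain_real (fun s => Re (gamma s)) (fun s => Im (gamma s))).
Qed.

Lemma locally_lipschitz_smooth (f df d2f : R -> R) (u : C -> R) (p : C) :
  (forall s, is_derive f s (df s)) -> (forall s, is_derive df s (d2f s)) ->
  locally_lipschitz u p -> locally_lipschitz (fun x => f (u x)) p.
Proof.
move=> H1 H2; apply: (locally_lipschitz_comp f df).
  exact: filter_forall.
by apply: ex_derive_continuous; eexists; exact: H2.
Qed.

Lemma locally_lipschitz_Re (p : C) : locally_lipschitz Re p.
Proof.
apply: (locally_lipschitz_global _ 1) => [|x y]; first lra.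
rewrite Rmult_1_l; have -> : Re x - Re y = Re (x - y) by [].
exact: Re_le_Cmod.
Qed.

Lemma locally_lipschitz_Im (p : C) : locally_lipschitz Im p.
Proof.
apply: (locally_lipschitz_global _ 1) => [|x y]; first lra.
rewrite Rmult_1_l; have -> : Im x - Im y = Im (x - y) by [].
exact: Im_le_Cmod.
Qed.

Lemma is_derive_sinh (s : R) : is_derive sinh s (cosh s).
Proof. by apply/is_derive_Reals/derivable_pt_lim_sinh. Qed.

Lemma is_derive_cosh (s : R) : is_derive cosh s (sinh s).
Proof. by apply/is_derive_Reals/derivable_pt_lim_cosh. Qed.

Lemma is_derive_nsin (s : R) : is_derive (fun s => - sin s) s (- cos s).
Proof. by auto_derive => //; ring. Qed.

Lemma sin_sq_locally_lipschitz (p : C) : locally_lipschitz sin_sq p.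
Proof.
apply: locally_lipschitz_plus.
  apply: locally_lipschitz_mult; last apply: locally_lipschitz_mult (locally_lipschitz_const _ _);
  apply: locally_lipschitz_smooth is_derive_sin is_derive_cos (locally_lipschitz_Re p).
apply: locally_lipschitz_mult; last apply: locally_lipschitz_mult (locally_lipschitz_const _ _);
apply: locally_lipschitz_smooth is_derive_sinh is_derive_cosh (locally_lipschitz_Im p).
Qed.

Lemma ln_sin_locally_lipschitz (p : C) : sin_sq p <> 0 -> locally_lipschitz ln_sin p.
Proof.
move=> H0; have Hp := sin_sq_pos _ H0.
apply: locally_lipschitz_mult (locally_lipschitz_const _ _).
apply: (locally_lipschitz_comp ln Rinv) (sin_sq_locally_lipschitz p).
  exists (mkposreal _ Hp) => s.
  rewrite /ball /= /AbsRing_ball /abs /minus /plus /opp /= => /Rabs_def2 Hs.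
  by apply: is_derive_ln; lra.
by apply: ex_derive_continuous; auto_derive.
Qed.

Lemma cot_re_locally_lipschitz (p : C) : sin_sq p <> 0 -> locally_lipschitz cot_re p.
Proof.
move=> H0; apply: locally_lipschitz_mult.
  apply: locally_lipschitz_mult.
    exact: locally_lipschitz_smooth is_derive_sin is_derive_cos (locally_lipschitz_Re p).
  exact: locally_lipschitz_smooth is_derive_cos is_derive_nsin (locally_lipschitz_Re p).
exact: locally_lipschitz_inv H0 (sin_sq_locally_lipschitz p).
Qed.

Lemma cot_im_locally_lipschitz (p : C) : sin_sq p <> 0 -> locally_lipschitz cot_im p.
Proof.
move=> H0; apply: locally_lipschitz_mult.
  apply: locally_lipschitz_mult.
    exact: locally_lipschitz_smooth is_derive_sinh is_derive_cosh (locally_lipschitz_Im p).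
  exact: locally_lipschitz_smooth is_derive_cosh is_derive_sinh (locally_lipschitz_Im p).
exact: locally_lipschitz_inv H0 (sin_sq_locally_lipschitz p).
Qed.

Definition affine (w : C) (m : R) (z : C) : C := (w + RtoC m * z)%C.

Lemma affine_sub (w : C) (m : R) (x y : C) :
  (affine w m x - affine w m y = RtoC m * (x - y))%C.
Proof. by rewrite /affine; ring. Qed.

Lemma affine_Re (w : C) (m : R) (z : C) : Re (affine w m z) = Re w + m * Re z.
Proof. by rewrite /affine; case: w z => [a b] [x y] /=; ring. Qed.

Lemma affine_Im (w : C) (m : R) (z : C) : Im (affine w m z) = Im w + m * Im z.
Proof. by rewrite /affine; case: w z => [a b] [x y] /=; ring. Qed.

Lemma locally_lipschitz_affine (u : C -> R) (w : C) (m : R) (p : C) :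
  locally_lipschitz u (affine w m p) -> locally_lipschitz (fun z => u (affine w m z)) p.
Proof.
move=> [d [L [d0 [L0 HL]]]].
have m1 : 0 < Rabs m + 1 by have := Rabs_pos m; lra.
exists (d / (Rabs m + 1)), (L * Rabs m); split; first exact: Rdiv_lt_0_compat.
split; first by apply: Rmult_le_pos => //; exact: Rabs_pos.
have Hd x : Cmod (x - p) < d / (Rabs m + 1) -> Cmod (affine w m x - affine w m p) < d.
  rewrite affine_sub Cmod_mult Cmod_R => Hx.
  have E : d = (Rabs m + 1) * (d / (Rabs m + 1)) by field; lra.
  have := Cmod_ge_0 (x - p); have := Rabs_pos m; nra.
move=> x y /Hd Hx /Hd Hy; apply: Rle_trans (HL _ _ Hx Hy) _.
by rewrite affine_sub Cmod_mult Cmod_R; apply: Req_le; ring.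
Qed.

(** * The sine near its zeros *)

Lemma slope_bounds (f df : R -> R) (lo hi : R) : f 0 = 0 ->
  (forall s, is_derive f s (df s)) -> continuous df 0 -> lo < df 0 < hi ->
  exists r, 0 < r /\ forall x, Rabs x < r ->
    lo <= df x <= hi /\ exists c, lo <= c <= hi /\ f x = x * c.
Proof.
move=> f0 Hf /filterlim_locally Hc Hb.
have e0 : 0 < Rmin (df 0 - lo) (hi - df 0) by apply: Rmin_pos; lra.
have [r Hr] := Hc (mkposreal _ e0).
have Hin x : Rabs x < r -> lo <= df x <= hi.
  move=> Hx; have := Hr x.
  rewrite /ball /= /AbsRing_ball /abs /minus /plus /opp /= Ropp_0 Rplus_0_r => /(_ Hx).
  have := Rmin_l (df 0 - lo) (hi - df 0); have := Rmin_r (df 0 - lo) (hi - df 0).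
  by move=> ? ? /Rabs_def2; lra.
exists r; split; first exact: cond_pos.
move=> x Hx; split; first exact: Hin.
have [|c [Hcx Ec]] := mean_value f df 0 x; first by [].
exists (df c); split; last by move: Ec; rewrite f0 => Ec; lra.
apply: Hin; move: Hx Hcx => /Rabs_def2 Hx; rewrite /Rmin /Rmax.
by case: Rle_dec => ? ?; apply: Rabs_def1; lra.
Qed.

(** [|sin z|] is comparable to [|z|], and [Re (z cot z)] is close to [1].  For
    [Re (z cot z)] the lower bound has to be positive and more than a quarter of
    the upper one, see [no_critical_near_zero]. *)
Lemma sine_near_zero : exists r, 0 < r /\ forall z, Cmod z < r -> z <> RtoC 0 ->
  4 / 9 * Cmod z ^ 2 <= sin_sq z <= 9 / 4 * Cmod z ^ 2 /\ 0 < sin_sq z /\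
  2 / 3 <= Re z * cot_re z + Im z * cot_im z <= 3 / 2.
Proof.
have [r1 [r10 H1]] : exists r, 0 < r /\ forall x, Rabs x < r ->
    5 / 6 <= cos x <= 6 / 5 /\ exists c, 5 / 6 <= c <= 6 / 5 /\ sin x = x * c.
  apply: (slope_bounds sin cos) => //; first exact: sin_0.
  - exact: is_derive_sin.
  - by apply: ex_derive_continuous; eexists; exact: is_derive_cos.
  - by rewrite cos_0; lra.
have [r2 [r20 H2]] : exists r, 0 < r /\ forall x, Rabs x < r ->
    5 / 6 <= cosh x <= 6 / 5 /\ exists c, 5 / 6 <= c <= 6 / 5 /\ sinh x = x * c.
  apply: (slope_bounds sinh cosh) => //; first exact: sinh_0.
  - exact: is_derive_sinh.
  - by apply: ex_derive_continuous; eexists; exact: is_derive_cosh.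
  - by rewrite cosh_0; lra.
exists (Rmin r1 r2); split; first exact: Rmin_pos.
move=> z Hz z0.
have [B1 [c [Bc Ec]]] := H1 (Re z) (Rle_lt_trans _ _ _ (Re_le_Cmod z) (Rlt_le_trans _ _ _ Hz (Rmin_l _ _))).
have [B2 [d [Bd Ed]]] := H2 (Im z) (Rle_lt_trans _ _ _ (Im_le_Cmod z) (Rlt_le_trans _ _ _ Hz (Rmin_r _ _))).
have EC : Cmod z ^ 2 = Re z ^ 2 + Im z ^ 2.
  rewrite /Cmod pow2_sqrt //.
  by have := pow2_ge_0 z.1; have := pow2_ge_0 z.2; lra.
have C0 : 0 < Cmod z ^ 2 by apply: pow_lt; apply/Cmod_gt_0.
have ES : sin_sq z = Re z ^ 2 * c ^ 2 + Im z ^ 2 * d ^ 2 by rewrite /sin_sq Ec Ed; ring.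
have X0 := pow2_ge_0 (Re z); have Y0 := pow2_ge_0 (Im z).
have sqb (e : R) : 5 / 6 <= e <= 6 / 5 -> 4 / 9 <= e ^ 2 <= 9 / 4 by move=> ?; nra.
have Hc2 := sqb c Bc; have Hd2 := sqb d Bd.
have bnd : 4 / 9 * Cmod z ^ 2 <= sin_sq z <= 9 / 4 * Cmod z ^ 2 by rewrite EC ES; nra.
have S0 : 0 < sin_sq z by lra.
split=> //; split=> //.
have -> : Re z * cot_re z + Im z * cot_im z =
   (Re z ^ 2 * (c * cos (Re z)) + Im z ^ 2 * (d * cosh (Im z))) / sin_sq z.
  by rewrite /cot_re /cot_im Ec Ed; field; lra.
have ratio (e f : R) : 5 / 6 <= e <= 6 / 5 -> 5 / 6 <= f <= 6 / 5 ->
   2 / 3 * e ^ 2 <= e * f <= 3 / 2 * e ^ 2.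
  by move=> He Hf; split; nra.
have R1 := ratio _ _ Bc B1; have R2 := ratio _ _ Bd B2.
split; apply: (Rmult_le_reg_r (sin_sq z)) => //.
  have -> : forall u, u / sin_sq z * sin_sq z = u by move=> u; field; lra.
  by rewrite ES; nra.
have -> : forall u, u / sin_sq z * sin_sq z = u by move=> u; field; lra.
by rewrite ES; nra.
Qed.

Lemma ln_sin_near_zero : exists r M, 0 < r /\ forall z, 0 < Cmod z -> Cmod z < r ->
  sin_sq z <> 0 /\ Rabs (ln_sin z - ln (Cmod z)) <= M.
Proof.
have [r [r0 Hr]] := sine_near_zero.
exists r, (Rabs (ln (4 / 9)) / 2 + Rabs (ln (9 / 4)) / 2); split=> // z z0 Hz.
have zn : z <> RtoC 0 by move=> E; move: z0; rewrite E Cmod_0; lra.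
have [[B1 B2] [S0 _]] := Hr z Hz zn.
split; first lra.
have C2 : 0 < Cmod z ^ 2 by apply: pow_lt.
have E : ln (Cmod z ^ 2) = 2 * ln (Cmod z).
  by rewrite /= Rmult_1_r ln_mult //; ring.
have L1 : ln (4 / 9) + 2 * ln (Cmod z) <= ln (sin_sq z).
  rewrite -E -ln_mult //; last lra.
  by apply: ln_le => //; apply: Rmult_lt_0_compat => //; lra.
have L2 : ln (sin_sq z) <= ln (9 / 4) + 2 * ln (Cmod z).
  by rewrite -E -ln_mult //; [apply: ln_le | lra].
have := Rle_abs (- ln (4 / 9)); rewrite Rabs_Ropp.
have := Rle_abs (ln (9 / 4)).
have := Rabs_pos (ln (9 / 4)); have := Rabs_pos (ln (4 / 9)).
by move=> *; apply: Rabs_le; rewrite /ln_sin; lra.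
Qed.

(** A factor [ln |sin (w + m z)|] has a logarithmic singularity of weight [1]
    at its zeros, and weight [0] elsewhere. *)
Lemma ln_sin_affine_singularity (w : C) (m : R) (p : C) : m <> 0 ->
  exists s r M, (s = 0 \/ s = 1) /\ (sin_sq (affine w m p) = 0 -> s = 1) /\ 0 < r /\
    forall z, 0 < Cmod (z - p) -> Cmod (z - p) < r ->
      sin_sq (affine w m z) <> 0 /\
      Rabs (ln_sin (affine w m z) - s * ln (Cmod (z - p))) <= M.
Proof.
move=> m0; have m1 : 0 < Rabs m by apply: Rabs_pos_lt.
case: (Req_dec (sin_sq (affine w m p)) 0) => [E|Hne]; last first.
  have Hl := locally_lipschitz_affine _ _ _ _ (sin_sq_locally_lipschitz (affine w m p)).
  have [d [d0 Hd]] := locally_lipschitz_nonzero _ _ Hl Hne.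
  have Hl2 := locally_lipschitz_affine _ _ _ _ (ln_sin_locally_lipschitz (affine w m p) Hne).
  have [d' [M [d'0 [M0 HM]]]] := locally_lipschitz_bounded _ _ Hl2.
  exists 0, (Rmin d d'), M; split; first by left.
  split; first by move=> E.
  split; first exact: Rmin_pos.
  move=> z z0 Hz; split; first by apply: Hd; have := Rmin_l d d'; lra.
  by rewrite Rmult_0_l Rminus_0_r; apply: HM; have := Rmin_r d d'; lra.
have [n En] := proj1 (sin_sq_eq_0 _) E.
have [r [M [r0 Hr]]] := ln_sin_near_zero.
exists 1, (r / Rabs m), (M + Rabs (ln (Rabs m))).
split; first by right.
split=> //; split; first exact: Rdiv_lt_0_compat.
move=> z z0 Hz.
have -> : affine w m z = (RtoC m * (z - p) + RtoC (IZR n * PI))%C.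
  by rewrite -En -(affine_sub w); ring.
have [-> [-> _]] := sin_functions_shift (RtoC m * (z - p)) n.
have EC : Cmod (RtoC m * (z - p)) = Rabs m * Cmod (z - p) by rewrite Cmod_mult Cmod_R.
have C0 : 0 < Cmod (RtoC m * (z - p)) by rewrite EC; apply: Rmult_lt_0_compat.
have C1 : Cmod (RtoC m * (z - p)) < r.
  rewrite EC; have -> : r = Rabs m * (r / Rabs m) by field; lra.
  exact: Rmult_lt_compat_l.
have [H1 H2] := Hr _ C0 C1; split=> //.
move: H2; rewrite EC ln_mult // => H2.
have := Rabs_triang (ln_sin (RtoC m * (z - p)) - (ln (Rabs m) + ln (Cmod (z - p)))) (ln (Rabs m)).
have -> : ln_sin (RtoC m * (z - p)) - (ln (Rabs m) + ln (Cmod (z - p))) + ln (Rabs m)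
  = ln_sin (RtoC m * (z - p)) - 1 * ln (Cmod (z - p)) by ring.
lra.
Qed.

(** * The relative motion of three vortices as a Hamiltonian system *)

Section Relative.
Variables (a b : R) (c : C).

(** Half the differences of the positions of the three vortices are [z],
    [c + a z] and [c - b z]; the energy of the relative motion is, up to
    normalization, the sum of the interactions of the three pairs. *)
Definition rel_energy (z : C) : R :=
  ln_sin z - / a * ln_sin (affine c a z) - / b * ln_sin (affine c (- b) z).
Definition rel_energy_x (z : C) : R :=
  cot_re z - cot_re (affine c a z) + cot_re (affine c (- b) z).
Definition rel_energy_y (z : C) : R :=
  cot_im z - cot_im (affine c a z) + cot_im (affine c (- b) z).
Definition no_collision (z : C) : Prop :=
  sin_sq z <> 0 /\ sin_sq (affine c a z) <> 0 /\ sin_sq (affine c (- b) z) <> 0.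

(** The translations of [z] that leave the configuration unchanged modulo
    translations of the cylinder. *)
Definition period_lattice (l : C) : Prop :=
  exists m n : Z, l = RtoC (IZR m * PI) /\ a * IZR m = IZR n.

Hypothesis a0 : 0 < a.
Hypothesis b0 : 0 < b.
Hypothesis ab : a + b = 1.

Lemma period_lattice_shift (z l : C) : period_lattice l ->
  exists m n k : Z,
    (z + l)%C = (z + RtoC (IZR m * PI))%C /\
    affine c a (z + l) = (affine c a z + RtoC (IZR n * PI))%C /\
    affine c (- b) (z + l) = (affine c (- b) z + RtoC (IZR k * PI))%C.
Proof.
case=> m [n [-> E]]; exists m, n, (n - m)%Z; split=> //; split.
  by rewrite /affine -E !RtoC_mult; ring.
have -> : - b = a - 1 by lra.
by rewrite minus_IZR -E /affine !(RtoC_mult, RtoC_minus); ring.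
Qed.

Lemma no_collision_open (p : C) : no_collision p ->
  exists d, 0 < d /\ forall x, Cmod (x - p) < d -> no_collision x.
Proof.
case=> [H1 [H2 H3]].
have [d1 [d10 D1]] := locally_lipschitz_nonzero _ _ (sin_sq_locally_lipschitz p) H1.
have [d2 [d20 D2]] := locally_lipschitz_nonzero _ _
  (locally_lipschitz_affine _ c a p (sin_sq_locally_lipschitz _)) H2.
have [d3 [d30 D3]] := locally_lipschitz_nonzero _ _
  (locally_lipschitz_affine _ c (- b) p (sin_sq_locally_lipschitz _)) H3.
exists (Rmin d1 (Rmin d2 d3)); split; first by repeat apply: Rmin_pos.
move=> x Hx; have l1 := Rmin_l d1 (Rmin d2 d3); have l2 := Rmin_r d1 (Rmin d2 d3).
have l3 := Rmin_l d2 d3; have l4 := Rmin_r d2 d3.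
split; first by apply: D1; lra.
by split; [apply: D2; lra | apply: D3; lra].
Qed.

Lemma affine_chain (w : C) (m : R) (gamma : R -> C) (t v v' : R) :
  sin_sq (affine w m (gamma t)) <> 0 ->
  is_derive (fun s => Re (gamma s)) t v -> is_derive (fun s => Im (gamma s)) t v' ->
  is_derive (fun s => ln_sin (affine w m (gamma s))) t
    (m * (cot_re (affine w m (gamma t)) * v + cot_im (affine w m (gamma t)) * v')).
Proof.
move=> H0 D1 D2.
have E1 : is_derive (fun s => Re (affine w m (gamma s))) t (m * v).
  have := is_derive_plus _ _ _ _ _ (is_derive_const (Re w) t) (is_derive_scal _ _ m _ D1).
  rewrite plus_zero_l; apply: is_derive_ext => s; exact/esym/affine_Re.
have E2 : is_derive (fun s => Im (affine w m (gamma s))) t (m * v').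
  have := is_derive_plus _ _ _ _ _ (is_derive_const (Im w) t) (is_derive_scal _ _ m _ D2).
  rewrite plus_zero_l; apply: is_derive_ext => s; exact/esym/affine_Im.
have := ln_sin_chain (fun s => affine w m (gamma s)) t _ _ H0 E1 E2.
by have -> : m * (cot_re (affine w m (gamma t)) * v + cot_im (affine w m (gamma t)) * v') =
  cot_re (affine w m (gamma t)) * (m * v) + cot_im (affine w m (gamma t)) * (m * v') by ring.
Qed.

Lemma relative_hamiltonian :
  hamiltonian_on no_collision rel_energy rel_energy_x rel_energy_y period_lattice.
Proof.
split.
- exact: no_collision_open.
- move=> p [H1 [H2 H3]]; apply: locally_lipschitz_sub.
    apply: locally_lipschitz_sub; first exact: ln_sin_locally_lipschitz.
    by apply/locally_lipschitz_scal/locally_lipschitz_affine/ln_sin_locally_lipschitz.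
  by apply/locally_lipschitz_scal/locally_lipschitz_affine/ln_sin_locally_lipschitz.
- move=> p [H1 [H2 H3]]; apply: locally_lipschitz_plus.
    apply: locally_lipschitz_sub; first exact: cot_re_locally_lipschitz.
    by apply/locally_lipschitz_affine/cot_re_locally_lipschitz.
  by apply/locally_lipschitz_affine/cot_re_locally_lipschitz.
- move=> p [H1 [H2 H3]]; apply: locally_lipschitz_plus.
    apply: locally_lipschitz_sub; first exact: cot_im_locally_lipschitz.
    by apply/locally_lipschitz_affine/cot_im_locally_lipschitz.
  by apply/locally_lipschitz_affine/cot_im_locally_lipschitz.
- move=> gamma t v w [H1 [H2 H3]] D1 D2.
  have := is_derive_minus _ _ _ _ _ (is_derive_minus _ _ _ _ _
     (ln_sin_chain gamma t _ _ H1 D1 D2)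
     (is_derive_scal _ _ (/ a) _ (affine_chain c a gamma t _ _ H2 D1 D2)))
     (is_derive_scal _ _ (/ b) _ (affine_chain c (- b) gamma t _ _ H3 D1 D2)).
  rewrite /minus /plus /opp /=.
  set l := (X in is_derive _ _ X -> _); set l' := (X in _ -> is_derive _ _ X).
  have -> : l = l'; last by [].
  by rewrite /l /l' /rel_energy_x /rel_energy_y; field; lra.
- by exists 0%Z, 0%Z; rewrite Rmult_0_l Rmult_0_r.
- move=> l [m [n [-> E]]]; exists (- m)%Z, (- n)%Z.
  by rewrite !opp_IZR -RtoC_opp -E; split; [congr RtoC|]; ring.
- move=> l l' [m [n [-> E]]] [m' [n' [-> E']]]; exists (m + m')%Z, (n + n')%Z.
  by rewrite !plus_IZR -RtoC_plus -E -E'; split; [congr RtoC|]; ring.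
- move=> x l /(period_lattice_shift x) [m [n [k [E1 [E2 E3]]]]] [H1 [H2 H3]].
  rewrite /no_collision E2 E3 E1.
  have [-> _] := sin_functions_shift x m.
  have [-> _] := sin_functions_shift (affine c a x) n.
  by have [-> _] := sin_functions_shift (affine c (- b) x) k.
- move=> x l /(period_lattice_shift x) [m [n [k [E1 [E2 E3]]]]].
  rewrite /rel_energy E2 E3 E1.
  have [_ [-> _]] := sin_functions_shift x m.
  have [_ [-> _]] := sin_functions_shift (affine c a x) n.
  by have [_ [-> _]] := sin_functions_shift (affine c (- b) x) k.
- move=> x l /(period_lattice_shift x) [m [n [k [E1 [E2 E3]]]]].
  rewrite /rel_energy_x E2 E3 E1.
  have [_ [_ [-> _]]] := sin_functions_shift x m.
  have [_ [_ [-> _]]] := sin_functions_shift (affine c a x) n.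
  by have [_ [_ [-> _]]] := sin_functions_shift (affine c (- b) x) k.
- move=> x l /(period_lattice_shift x) [m [n [k [E1 [E2 E3]]]]].
  rewrite /rel_energy_y E2 E3 E1.
  have [_ [_ [_ ->]]] := sin_functions_shift x m.
  have [_ [_ [_ ->]]] := sin_functions_shift (affine c a x) n.
  by have [_ [_ [_ ->]]] := sin_functions_shift (affine c (- b) x) k.
Qed.

(** Near a collision the energy is [rho ln |z - p|] up to a bounded term.
    Whichever pairs collide, the weight [rho] is one of [1], [- 1 / a],
    [- 1 / b] or a sum of these, and never vanishes as [0 < a, b < 1]. *)
Lemma rel_energy_collision (p : C) : ~ no_collision p ->
  exists rho r M, rho <> 0 /\ 0 < r /\ forall z, 0 < Cmod (z - p) -> Cmod (z - p) < r ->
    no_collision z /\ Rabs (rel_energy z - rho * ln (Cmod (z - p))) <= M.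
Proof.
move=> Hp.
have n1 : 1 <> 0 by lra.
have na : a <> 0 by lra.
have nb : - b <> 0 by lra.
have Eid z : affine (RtoC 0) 1 z = z by rewrite /affine; ring.
have [s1 [r1 [M1 [B1 [S1 [r10 H1]]]]]] := ln_sin_affine_singularity (RtoC 0) 1 p n1.
have [s2 [r2 [M2 [B2 [S2 [r20 H2]]]]]] := ln_sin_affine_singularity c a p na.
have [s3 [r3 [M3 [B3 [S3 [r30 H3]]]]]] := ln_sin_affine_singularity c (- b) p nb.
exists (s1 - / a * s2 - / b * s3), (Rmin r1 (Rmin r2 r3)), (M1 + / a * M2 + / b * M3).
have ia : 1 < / a by rewrite -Rinv_1; apply: Rinv_lt_contravar; lra.
have ib : 1 < / b by rewrite -Rinv_1; apply: Rinv_lt_contravar; lra.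
split.
  have : s1 = 1 \/ s2 = 1 \/ s3 = 1.
    apply: NNPP => Hno; apply: Hp; split; first by rewrite -{1}(Eid p); tauto.
    by split; tauto.
  by move: B1 B2 B3 => [] -> [] -> [] ->; lra.
split; first by repeat apply: Rmin_pos.
move=> z z0 Hz.
have l1 := Rmin_l r1 (Rmin r2 r3); have l2 := Rmin_r r1 (Rmin r2 r3).
have l3 := Rmin_l r2 r3; have l4 := Rmin_r r2 r3.
have [N1 L1] := H1 z z0 ltac:(lra); have [N2 L2] := H2 z z0 ltac:(lra).
have [N3 L3] := H3 z z0 ltac:(lra).
rewrite Eid in N1 L1; split=> //.
move: L1 L2 L3; rewrite /rel_energy.
set x1 := ln_sin z; set x2 := ln_sin (affine c a z); set x3 := ln_sin _; set y := ln _.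
move=> L1 L2 L3.
have -> : x1 - / a * x2 - / b * x3 - (s1 - / a * s2 - / b * s3) * y =
  (x1 - s1 * y) + (- (/ a * (x2 - s2 * y)) + - (/ b * (x3 - s3 * y))) by ring.
apply: Rle_trans (Rabs_triang _ _) _.
have := Rabs_triang (- (/ a * (x2 - s2 * y))) (- (/ b * (x3 - s3 * y))).
rewrite !Rabs_Ropp !Rabs_mult (Rabs_pos_eq (/ a)); last lra.
rewrite (Rabs_pos_eq (/ b)); last lra.
have := Rmult_le_compat_l (/ a) _ _ ltac:(lra) L2.
have := Rmult_le_compat_l (/ b) _ _ ltac:(lra) L3.
lra.
Qed.

End Relative.

(** * Compactness of the levels of the relative energy *)

Lemma hamiltonian_on_subdomain (D D' : C -> Prop) (H Hx Hy : C -> R) (Lam : C -> Prop) :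
  hamiltonian_on D H Hx Hy Lam -> (forall z, D' z -> D z) ->
  (forall p, D' p -> exists d, 0 < d /\ forall x, Cmod (x - p) < d -> D' x) ->
  hamiltonian_on D' H Hx Hy (fun l => l = RtoC 0).
Proof.
move=> [? HL HX HY Hc ? ? ? ? ? ? ?] Hsub Hop.
have z x : (x + RtoC 0)%C = x by ring.
split=> //.
- by move=> p /Hsub; exact: HL.
- by move=> p /Hsub; exact: HX.
- by move=> p /Hsub; exact: HY.
- by move=> gamma t v w /Hsub; exact: Hc.
- by move=> l ->; ring.
- by move=> l m -> ->; ring.
- by move=> x l ->; rewrite z.
- by move=> x l ->; rewrite z.
- by move=> x l ->; rewrite z.
- by move=> x l ->; rewrite z.
Qed.

Lemma exp_le_mono (x y : R) : x <= y -> exp x <= exp y.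
Proof. by case=> [h|->]; [exact/Rlt_le/exp_increasing | exact: Rle_refl]. Qed.

Lemma sinh_lower (u : R) : 1 <= Rabs u -> exp (Rabs u) / 4 <= Rabs (sinh u).
Proof.
move=> Hu.
have main v : 1 <= v -> exp v / 4 <= sinh v.
  move=> Hv; rewrite /sinh.
  have h1 := exp_ineq1_le v.
  have h2 : exp (- v) <= 1 by rewrite -exp_0; apply: exp_le_mono; lra.
  lra.
have := main _ Hu; case: (Rle_dec 0 u) => h0.
  by rewrite !(Rabs_pos_eq u) //; have := Rle_abs (sinh u); lra.
rewrite !(Rabs_left u); try lra.
by rewrite sinh_neg; have := Rle_abs (- sinh u); rewrite Rabs_Ropp; lra.
Qed.

Lemma ln_sin_lower (z : C) : 1 <= Rabs (Im z) -> Rabs (Im z) - ln 4 <= ln_sin z.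
Proof.
move=> /sinh_lower Hs.
have e0 := exp_pos (Rabs (Im z)).
have H2 : (exp (Rabs (Im z)) / 4) ^ 2 <= sin_sq z.
  apply: Rle_trans (pow_incr _ _ 2 _) _; first by split; last exact: Hs; lra.
  by rewrite /sin_sq RPow_abs Rabs_pos_eq; have := pow2_ge_0 (sin (Re z)); have := pow2_ge_0 (sinh (Im z)); lra.
have q0 : 0 < exp (Rabs (Im z)) / 4 by lra.
have : ln ((exp (Rabs (Im z)) / 4) ^ 2) <= ln (sin_sq z).
  by apply: ln_le => //; apply: pow_lt.
rewrite /= Rmult_1_r ln_mult // /Rdiv ln_mult //; last lra.
by rewrite ln_exp ln_Rinv /ln_sin; lra.
Qed.

Lemma ln_sin_upper (z : C) : sin_sq z <> 0 -> ln_sin z <= Rabs (Im z).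
Proof.
move=> /sin_sq_pos S0.
have c1 := cosh_ge_1 (Im z).
have H2 : sin_sq z <= exp (Rabs (Im z)) ^ 2.
  apply: (Rle_trans _ (cosh (Im z) ^ 2)).
    rewrite cosh_sinh_sq /sin_sq.
    by have := sin2_cos2 (Re z); rewrite !Rsqr_pow2; have := pow2_ge_0 (cos (Re z)); lra.
  apply: pow_incr; split; first lra.
  have := Rle_abs (Im z); have := Rle_abs (- Im z); rewrite Rabs_Ropp => h1 h2.
  by rewrite /cosh; have := exp_le_mono _ _ h1; have := exp_le_mono _ _ h2; lra.
have : ln (sin_sq z) <= ln (exp (Rabs (Im z)) ^ 2) by apply: ln_le.
have e0 := exp_pos (Rabs (Im z)).
by rewrite /= Rmult_1_r ln_mult // ln_exp /ln_sin; lra.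
Qed.

Section RelativeMotion.
Variables (a b : R) (c : C).
Hypothesis a0 : 0 < a.
Hypothesis b0 : 0 < b.
Hypothesis ab : a + b = 1.

Let E := rel_energy a b c.
Let Ex := rel_energy_x a b c.
Let Ey := rel_energy_y a b c.
Let D := no_collision a b c.
Let HH := relative_hamiltonian a b c a0 b0 ab.

Lemma rel_energy_blowup (p : C) : ~ D p -> forall K, exists r, 0 < r /\
  forall z, 0 < Cmod (z - p) -> Cmod (z - p) < r -> D z /\ K < Rabs (E z).
Proof.
move=> Hp K.
have [rho [r [M [rho0 [r0 Hr]]]]] := rel_energy_collision a b c a0 b0 ab p Hp.
have rp : 0 < Rabs rho by apply: Rabs_pos_lt.
pose Q := (Rabs K + Rabs M) / Rabs rho.
exists (Rmin r (exp (- Q))); split; first by apply: Rmin_pos => //; exact: exp_pos.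
move=> z z0 Hz; have l1 := Rmin_l r (exp (- Q)); have l2 := Rmin_r r (exp (- Q)).
have [Dz HE] := Hr z z0 ltac:(lra); split=> //.
have Hln : ln (Cmod (z - p)) < - Q.
  by rewrite -(ln_exp (- Q)); apply: ln_increasing => //; lra.
have Q0 : 0 <= Q.
  by apply: Rdiv_le_0_compat => //; have := Rabs_pos K; have := Rabs_pos M; lra.
have HQ : Rabs K + Rabs M < Rabs (rho * ln (Cmod (z - p))).
  rewrite Rabs_mult (Rabs_left (ln _)); last lra.
  have -> : Rabs K + Rabs M = Rabs rho * Q by rewrite /Q; field; lra.
  by apply: Rmult_lt_compat_l; lra.
have := Rabs_triang (rho * ln (Cmod (z - p)) - rel_energy a b c z) (rel_energy a b c z).
have -> : rho * ln (Cmod (z - p)) - rel_energy a b c z + rel_energy a b c z = rho * ln (Cmod (z - p)) by ring.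
rewrite (Rabs_minus_sym (rho * _)) /E.
by have := Rle_abs K; have := Rle_abs M; lra.
Qed.

Lemma bounded_window_cluster (h B B' A A' : R) (x : nat -> C) :
  (forall n, D (x n) /\ Rabs (E (x n) - h) <= 1) ->
  (forall n, A <= Re (x n) <= B /\ A' <= Im (x n) <= B') ->
  exists p, D p /\ forall eps, 0 < eps -> forall N, exists n,
    (N <= n)%coq_nat /\ Cmod (x n - p) < eps.
Proof.
move=> Hw /bounded_sequence_cluster [p Hp]; exists p; split=> //.
apply: NNPP => Dp.
have [r [r0 Hr]] := rel_energy_blowup p Dp (Rabs h + 1).
have [n [_ Hn]] := Hp r r0 0%nat.
have [Dn HE] := Hw n.
have Hne : 0 < Cmod (x n - p).
  apply/Cmod_gt_0 => Hz; apply: Dp.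
  by have <- : x n = p by rewrite -(Cplus_0_r p) -Hz; ring.
have [_ HK] := Hr _ Hne Hn.
have := Rabs_triang (E (x n) - h) h.
have -> : E (x n) - h + h = E (x n) by ring.
lra.
Qed.

(** Towards both ends of the cylinder the energy behaves like
    [|Im z| - a |Im z| / a - b |Im z| / b = - |Im z|]. *)
Lemma rel_energy_strip (K : R) : exists Y, forall z, D z -> K <= E z -> Rabs (Im z) <= Y.
Proof.
pose L := Rabs (Im c) + ln 4.
have ln4 : 0 <= ln 4 by rewrite -ln_1; apply: ln_le; lra.
pose Y1 := (Rabs (Im c) + 1) / a; pose Y2 := (Rabs (Im c) + 1) / b.
pose Y3 := L * (/ a + / b) - K.
exists (Rmax Y1 (Rmax Y2 Y3)) => z [H1 [H2 H3]] HK.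
have l1 := Rmax_l Y1 (Rmax Y2 Y3); have l2 := Rmax_r Y1 (Rmax Y2 Y3).
have l3 := Rmax_l Y2 Y3; have l4 := Rmax_r Y2 Y3.
apply: Rnot_lt_le => Hlt.
have low m : 0 < Rabs m -> (Rabs (Im c) + 1) / Rabs m < Rabs (Im z) ->
    Rabs m * Rabs (Im z) - L <= ln_sin (affine c m z).
  move=> m0 Hm.
  have Him : Rabs m * Rabs (Im z) - Rabs (Im c) <= Rabs (Im (affine c m z)).
    rewrite affine_Im -Rabs_mult.
    have := Rabs_triang (Im c + m * Im z) (- Im c).
    have -> : Im c + m * Im z + - Im c = m * Im z by ring.
    by rewrite Rabs_Ropp; lra.
  have Hge : Rabs (Im c) + 1 < Rabs m * Rabs (Im z).
    have -> : Rabs (Im c) + 1 = Rabs m * ((Rabs (Im c) + 1) / Rabs m) by field; lra.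
    exact: Rmult_lt_compat_l.
  have := ln_sin_lower (affine c m z) ltac:(lra); rewrite /L; lra.
have La := low a; have Lb := low (- b).
rewrite Rabs_Ropp !(Rabs_pos_eq b) in Lb; try lra.
rewrite !(Rabs_pos_eq a) in La; try lra.
have {}La := La ltac:(lra) ltac:(rewrite -/Y1; lra).
have {}Lb := Lb ltac:(lra) ltac:(rewrite -/Y2; lra).
have U := ln_sin_upper z H1.
have ia : 0 < / a by apply: Rinv_0_lt_compat.
have ib : 0 < / b by apply: Rinv_0_lt_compat.
have Ma := Rmult_le_compat_l (/ a) _ _ ltac:(lra) La.
have Mb := Rmult_le_compat_l (/ b) _ _ ltac:(lra) Lb.
have Ea : / a * (a * Rabs (Im z) - L) = Rabs (Im z) - / a * L by field; lra.
have Eb : / b * (b * Rabs (Im z) - L) = Rabs (Im z) - / b * L by field; lra.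
rewrite Ea in Ma; rewrite Eb in Mb.
move: HK; rewrite /E /rel_energy => HK.
have E3 : Y3 = L * (/ a + / b) - K by [].
lra.
Qed.

(** With a real period the level sets of the energy are compact modulo this
    period: the strip bound, the period and the blow-up of the energy at
    collisions confine them. *)
Lemma periodic_compact_window (tau h : R) : 0 < tau ->
  (forall k : Z, period_lattice a (RtoC (IZR k * tau))) ->
  compact_window D E (period_lattice a) h.
Proof.
move=> tau0 Hper x Hx.
have [Y HY] := rel_energy_strip (h - 1).
have Hk n : exists k : Z, 0 <= Re (x n) + IZR k * tau <= tau.
  have [A1 A2] := archimed (- Re (x n) / tau); exists (up (- Re (x n) / tau)).
  set u := IZR _ in A1 A2 *.
  have B1 := Rmult_lt_compat_r tau _ _ tau0 A1.
  have B2 := Rmult_le_compat_r tau _ _ (Rlt_le _ _ tau0) A2.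
  have Eq : - Re (x n) / tau * tau = - Re (x n) by field; lra.
  by rewrite Rmult_minus_distr_r Eq in B2; rewrite Eq in B1; lra.
have [k Hk'] := functional_choice _ Hk.
pose y n := (x n + RtoC (IZR (k n) * tau))%C.
have EyE n : E (y n) = E (x n) by apply: (energy_shift _ _ _ _ _ HH).
have [||p [Dp Hp]] := bounded_window_cluster h tau Y 0 (- Y) y.
- move=> n; have [Dn Hn] := Hx n; rewrite EyE; split=> //.
  exact: (domain_shift _ _ _ _ _ HH).
- move=> n; have [Dn Hn] := Hx n.
  split; first exact: Hk'.
  have -> : Im (y n) = Im (x n) by rewrite /y /= Rplus_0_r.
  have /Rabs_le_between := Hn => Hn'.
  by have /Rabs_le_between := HY (x n) Dn ltac:(lra).
exists p; split=> // eps eps0 N; have [n [HN Hn]] := Hp eps eps0 N.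
by exists n, (RtoC (IZR (k n) * tau)).
Qed.

(** The product of [z] with the energy gradient tends to [1] at [0] if only the
    first two vortices collide there, and to [1 - 1 / a - 1 / b <= -3] if all
    three do. *)
Lemma no_critical_near_zero : exists r, 0 < r /\
  forall z, 0 < Cmod z -> Cmod z < r -> ~ critical Ex Ey z.
Proof.
have [r [r0 Hr]] := sine_near_zero.
have neq z : 0 < Cmod z -> z <> RtoC 0 by move=> h e; move: h; rewrite e Cmod_0; lra.
suff [r' [r'0 Hr']] : exists r', 0 < r' /\ forall z, 0 < Cmod z -> Cmod z < r' ->
    Re z * Ex z + Im z * Ey z <> 0.
  exists r'; split=> // z z0 Hz [e1 e2]; apply: (Hr' z z0 Hz).
  by rewrite e1 e2; ring.
case: (Req_dec (sin_sq c) 0) => [|Hc].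
  case/sin_sq_eq_0 => n En.
  pose rad m z := Re z * cot_re (affine c m z) + Im z * cot_im (affine c m z).
  have Hrad m z : 0 < Rabs m <= 1 -> 0 < Cmod z -> Cmod z < r ->
      2 / 3 <= m * rad m z.
    move=> [m0 m1] z0 Hz.
    have C1 : Cmod (RtoC m * z) = Rabs m * Cmod z by rewrite Cmod_mult Cmod_R.
    have C0 : 0 < Cmod (RtoC m * z) by rewrite C1; apply: Rmult_lt_0_compat.
    have C2 : Cmod (RtoC m * z) < r by rewrite C1; nra.
    have [_ [_ [Hlo _]]] := Hr _ C2 (neq _ C0).
    rewrite /rad; have -> : affine c m z = (RtoC m * z + RtoC (IZR n * PI))%C.
      by rewrite /affine En; ring.
    have [_ [_ [-> ->]]] := sin_functions_shift (RtoC m * z) n.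
    have E1 : Re (RtoC m * z) = m * Re z by case: (z) => u v /=; ring.
    have E2 : Im (RtoC m * z) = m * Im z by case: (z) => u v /=; ring.
    by rewrite E1 E2 in Hlo; lra.
  exists r; split=> // z z0 Hz.
  have [_ [_ [_ Hup]]] := Hr _ Hz (neq _ z0).
  have Ra := Hrad a z; rewrite (Rabs_pos_eq a) in Ra; last lra.
  have Rb := Hrad (- b) z; rewrite Rabs_Ropp (Rabs_pos_eq b) in Rb; last lra.
  have {}Ra := Ra ltac:(lra) z0 Hz; have {}Rb := Rb ltac:(lra) z0 Hz.
  have -> : Re z * Ex z + Im z * Ey z =
     Re z * cot_re z + Im z * cot_im z - rad a z + rad (- b) z.
    by rewrite /Ex /Ey /rel_energy_x /rel_energy_y /rad; ring.
  (* rad a >= 2/(3a), - rad (-b) >= 2/(3b), and 1/a + 1/b >= 4 *)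
  have Pa : 0 < rad a z by nra.
  have Pb : 0 < - rad (- b) z by nra.
  have : 4 * (2 / 3) <= rad a z + - rad (- b) z.
    move: Ra Rb Pa Pb; set u := rad a z; set v := rad (- b) z => Ra Rb Pa Pb.
    have Q : 2 / 3 / a + 2 / 3 / b <= u + - v.
      apply: Rplus_le_compat; [apply: (Rmult_le_reg_l a) | apply: (Rmult_le_reg_l b)] => //.
        by have -> : a * (2 / 3 / a) = 2 / 3 by field; lra.
      by have -> : b * (2 / 3 / b) = 2 / 3; [field; lra | lra].
    apply: Rle_trans Q; apply: (Rmult_le_reg_r (a * b)); first exact: Rmult_lt_0_compat.
    have -> : (2 / 3 / a + 2 / 3 / b) * (a * b) = 2 / 3 * (a + b) by field; lra.
    by rewrite ab; have := Rle_0_sqr (a - b); rewrite /Rsqr; nra.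
  lra.
have H0 m : affine c m (RtoC 0) = c by rewrite /affine; ring.
have bnd (u : C -> R) m : locally_lipschitz u c ->
    exists d M, 0 < d /\ 0 <= M /\ forall x, Cmod x < d -> Rabs (u (affine c m x)) <= M.
  move=> Hu; rewrite -(H0 m) in Hu.
  have [d [M [d0 [M0 HM]]]] := locally_lipschitz_bounded _ _ (locally_lipschitz_affine _ _ _ _ Hu).
  by exists d, M; split=> //; split=> // x Hx; apply: HM; rewrite (_ : x - RtoC 0 = x)%C //; ring.
have [d1 [M1 [d10 [M10 B1]]]] := bnd cot_re a (cot_re_locally_lipschitz c Hc).
have [d2 [M2 [d20 [M20 B2]]]] := bnd cot_im a (cot_im_locally_lipschitz c Hc).
have [d3 [M3 [d30 [M30 B3]]]] := bnd cot_re (- b) (cot_re_locally_lipschitz c Hc).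
have [d4 [M4 [d40 [M40 B4]]]] := bnd cot_im (- b) (cot_im_locally_lipschitz c Hc).
pose M := M1 + M2 + M3 + M4 + 1.
have iM : 0 < / (2 * M) by apply: Rinv_0_lt_compat; rewrite /M; lra.
exists (Rmin (Rmin r (/ (2 * M))) (Rmin (Rmin d1 d2) (Rmin d3 d4))).
split; first by repeat apply: Rmin_pos.
move=> z z0 Hz.
have k1 := Rmin_l (Rmin r (/ (2 * M))) (Rmin (Rmin d1 d2) (Rmin d3 d4)).
have k2 := Rmin_r (Rmin r (/ (2 * M))) (Rmin (Rmin d1 d2) (Rmin d3 d4)).
have k3 := Rmin_l r (/ (2 * M)); have k4 := Rmin_r r (/ (2 * M)).
have k5 := Rmin_l (Rmin d1 d2) (Rmin d3 d4); have k6 := Rmin_r (Rmin d1 d2) (Rmin d3 d4).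
have k7 := Rmin_l d1 d2; have k8 := Rmin_r d1 d2.
have k9 := Rmin_l d3 d4; have k10 := Rmin_r d3 d4.
have [_ [_ [Hlo _]]] := Hr z ltac:(lra) (neq _ z0).
have sm x y u N : Rabs x <= y -> Rabs u <= N -> Rabs (x * u) <= y * N.
  by move=> *; rewrite Rabs_mult; apply: Rmult_le_compat => //; exact: Rabs_pos.
have hx := Re_le_Cmod z; have hy := Im_le_Cmod z.
have t1 := sm _ _ _ _ hx (B1 z ltac:(lra)); have t2 := sm _ _ _ _ hy (B2 z ltac:(lra)).
have t3 := sm _ _ _ _ hx (B3 z ltac:(lra)); have t4 := sm _ _ _ _ hy (B4 z ltac:(lra)).
have -> : Re z * Ex z + Im z * Ey z =
  Re z * cot_re z + Im z * cot_im z
  - Re z * cot_re (affine c a z) - Im z * cot_im (affine c a z)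
  + Re z * cot_re (affine c (- b) z) + Im z * cot_im (affine c (- b) z).
  by rewrite /Ex /Ey /rel_energy_x /rel_energy_y; ring.
move/Rabs_le_between: t1 => t1; move/Rabs_le_between: t2 => t2.
move/Rabs_le_between: t3 => t3; move/Rabs_le_between: t4 => t4.
have : Cmod z * M <= / 2.
  have -> : / 2 = / (2 * M) * M by field; rewrite /M; lra.
  by apply: Rmult_le_compat_r; [rewrite /M; lra | lra].
rewrite /M; lra.
Qed.

Lemma zero_collision : ~ D (RtoC 0).
Proof.
by case=> H _; apply: H; apply/sin_sq_eq_0; exists 0%Z; rewrite Rmult_0_l.
Qed.

(** Solutions that start close enough to [0] are trapped there: the absolute
    value of the energy is larger than on the boundary circle of a disc without
    critical points.  A level in this punctured disc is compact, so that its
    solutions close up. *)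
Theorem near_zero_revisits (k : R) : k <> 0 ->
  exists V : C -> Prop, open V /\ V (RtoC 0) /\
    forall z, V z -> z <> RtoC 0 -> D z /\ ~ critical Ex Ey z /\
      exists phi, phi 0 = z /\ solution D Ex Ey k phi /\ revisits (period_lattice a) phi.
Proof.
move=> k0.
have [rho [r1 [M [rho0 [r10 H1]]]]] := rel_energy_collision a b c a0 b0 ab _ zero_collision.
have [r2 [r20 H2]] := no_critical_near_zero.
pose r0 := Rmin r1 r2 / 2.
have r00 : 0 < r0 by rewrite /r0; have := Rmin_pos _ _ r10 r20; lra.
have r01 : r0 < r1 by rewrite /r0 in r00 *; have := Rmin_l r1 r2; lra.
have r02 : r0 < r2 by rewrite /r0 in r00 *; have := Rmin_r r1 r2; lra.
have z0 x : (x - RtoC 0)%C = x by ring.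
have {}H1 z : 0 < Cmod z -> Cmod z <= r0 -> D z /\ Rabs (E z - rho * ln (Cmod z)) <= M.
  by move=> *; have := H1 z; rewrite z0; apply; lra.
pose K := Rabs (rho * ln r0) + M + 1.
pose D0 z := 0 < Cmod z /\ Cmod z < r0.
have D0sub z : D0 z -> D z by case=> h1 h2; apply: (proj1 (H1 z h1 _)); lra.
have D0open p : D0 p -> exists d, 0 < d /\ forall x, Cmod (x - p) < d -> D0 x.
  case=> h1 h2; exists (Rmin (Cmod p) (r0 - Cmod p)); split; first by apply: Rmin_pos; lra.
  move=> x Hx; have l1 := Rmin_l (Cmod p) (r0 - Cmod p); have l2 := Rmin_r (Cmod p) (r0 - Cmod p).
  have := Cmod_sub_triangle p x (RtoC 0); have := Cmod_sub_triangle x p (RtoC 0).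
  rewrite !z0 (Cmod_sub_comm p x) => *; split; last lra.
  lra.
have HH0 := hamiltonian_on_subdomain _ _ _ _ _ _ HH D0sub D0open.
have win h : K < Rabs h -> compact_window D0 E (fun l => l = RtoC 0) h.
  move=> Hh x Hx.
  have [||p [Dp Hp]] := bounded_window_cluster h r0 r0 (- r0) (- r0) x.
  - by move=> n; have [Dn Hn] := Hx n; split=> //; exact: D0sub.
  - move=> n; have [[_ Dn] _] := Hx n.
    have := Re_le_Cmod (x n); have := Im_le_Cmod (x n).
    move=> /Rabs_le_between h1 /Rabs_le_between h2; lra.
  have p0 : 0 < Cmod p.
    apply/Cmod_gt_0 => e; apply: zero_collision; by rewrite -e.
  have pr : Cmod p <= r0.
    apply: Rnot_lt_le => Hlt.
    have [n [_ Hn]] := Hp (Cmod p - r0) ltac:(lra) 0%nat.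
    have [[_ Dn] _] := Hx n.
    have := Cmod_sub_triangle (x n) p (RtoC 0); rewrite !z0 (Cmod_sub_comm p); lra.
  have pr' : Cmod p < r0.
    case: pr => // Ep; exfalso.
    have [_ Hb] := H1 p p0 ltac:(lra); rewrite Ep in Hb.
    have Eb : Rabs (E p) <= K - 1.
      have := Rabs_triang (E p - rho * ln r0) (rho * ln r0).
      have -> : E p - rho * ln r0 + rho * ln r0 = E p by ring.
      rewrite /K; lra.
    have [d [d0 Hd]] := locally_lipschitz_continuous _ _ (energy_lipschitz _ _ _ _ _ HH p Dp)
        (Rabs h - K) ltac:(lra).
    have [n [_ Hn]] := Hp d d0 0%nat.
    have [_ Hw] := Hx n.
    have := Hd _ Hn => He.
    have := Rabs_triang (E (x n) - E p) (E p).
    have -> : E (x n) - E p + E p = E (x n) by ring.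
    have := Rabs_triang (h - E (x n)) (E (x n)).
    have -> : h - E (x n) + E (x n) = h by ring.
    rewrite (Rabs_minus_sym h); rewrite -/E in He; lra.
  exists p; split=> // eps eps0 N; have [n [HN Hn]] := Hp eps eps0 N.
  by exists n, (RtoC 0); split=> //; split=> //; rewrite Cplus_0_r.
exists (fun z => z = RtoC 0 \/ (D0 z /\ K < Rabs (E z))); split; last split.
- move=> p; case=> [->|[Dp Hp]]; apply/locally_Cmod.
    have [r [rp Hr]] := rel_energy_blowup _ zero_collision K.
    exists (Rmin r r0); split; first exact: Rmin_pos.
    move=> x; rewrite z0 => Hx.
    have l1 := Rmin_l r r0; have l2 := Rmin_r r r0.
    case: (Req_dec (Cmod x) 0) => [/Cmod_eq_0|Hn]; first by left.
    have x0 : 0 < Cmod x by have := Cmod_ge_0 x; lra.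
    right; split; first by split=> //; lra.
    by have := Hr x; rewrite z0 => Hr'; apply: (proj2 (Hr' x0 _)); lra.
  have [d [d0 Hd]] := D0open p Dp.
  have [d' [d'0 Hd']] := locally_lipschitz_continuous _ _
    (energy_lipschitz _ _ _ _ _ HH p (D0sub _ Dp)) (Rabs (E p) - K) ltac:(lra).
  exists (Rmin d d'); split; first exact: Rmin_pos.
  move=> x Hx; have l1 := Rmin_l d d'; have l2 := Rmin_r d d'.
  right; split; first by apply: Hd; lra.
  have := Hd' x ltac:(lra) => He.
  have := Rabs_triang (E p - E x) (E x).
  have -> : E p - E x + E x = E p by ring.
  rewrite Rabs_minus_sym; rewrite -/E in He; lra.
- by left.
- move=> z [//|[Dz Hz]] _; split; first exact: D0sub.
  have nc p : D0 p -> ~ critical Ex Ey p by case=> h1 h2; apply: H2; lra.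
  split; first exact: nc.
  have [phi [E0 Hphi]] := level_solution_exists _ _ _ _ _ HH0 k _ (win _ Hz) z Dz erefl.
  exists phi; split=> //; split.
    by move=> t; have [Dt Ht] := Hphi t; split=> //; exact: D0sub.
  have [T [T0 ET]] := regular_level_revisits _ _ _ _ _ HH0 k k0 _ (win _ Hz) phi nc Hphi (f_equal E E0).
  exists T; split=> //; rewrite ET.
  exact: (lattice_0 _ _ _ _ _ HH).
Qed.

End RelativeMotion.

(** * The critical equation *)

Module CriticalEquation.
Import ssrnat all_order all_algebra Rstruct mathcomp.algebra_tactics.ring.
Import Order.TTheory GRing.Theory Num.Theory.
Local Open Scope ring_scope.

Section ClosedField.
Variables (K : numClosedFieldType) (w w' : K) (p r : nat).
Hypotheses (p_gt0 : (0 < p)%N) (r_gt0 : (0 < r)%N) (pr_coprime : coprime p r) (ww' : w * w' = 1).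
Let q := (p + r)%N.

(* A constant, so that all the coefficients live in the same structure. *)
Let m6 : K := - 6%:R.
(* [w ('X^(2 q) + low)] is the expansion of the polynomial [numerator] below. *)
Let low : {poly K} := w%:P * 'X^(q + p) + w'%:P * 'X^(q + r) + m6%:P * 'X^q
   + w%:P * 'X^p + w'%:P * 'X^r + 1.
Let P : {poly K} := 'X^(q + q) + low.

Lemma unity_coprime (u : K) : u ^+ q = 1 -> u ^+ r = 1 -> u = 1.
Proof.
move=> uq ur; have up : u ^+ p = 1 by move: uq; rewrite exprD ur mulr1.
have [a _ /dvdnP [b Eb]] := Bezoutl r p_gt0.
move: Eb; rewrite (eqP pr_coprime) => Eb.
have : u ^+ (1 + a * r) = 1 by rewrite Eb mulnC exprM up expr1n.
by rewrite exprD expr1 mulnC exprM ur expr1n mulr1.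
Qed.

(** Triple collisions correspond to the roots [v] with [v ^ q = 1] and
    [v ^ r = w]; the quotient of two of them is a root of unity of order
    dividing the coprime [q] and [r]. *)
Lemma triple_unique (u v : K) : u ^+ q = 1 -> u ^+ r = w -> v ^+ q = 1 -> v ^+ r = w ->
  u = v.
Proof.
move=> uq ur vq vr.
have q0 : (0 < q)%N by rewrite addn_gt0 p_gt0.
have v0 : v != 0.
  apply/eqP => E; move: vq; rewrite E expr0n (gtn_eqF q0) => /esym/eqP.
  by rewrite oner_eq0.
have w0 : w != 0 by rewrite -vr expf_neq0.
have : u / v = 1.
  by apply: unity_coprime; rewrite expr_div_n ?ur ?vr ?uq ?vq divff ?oner_neq0.
by move/divr1_eq.
Qed.

Lemma size_low : (size low <= q + q)%N.
Proof.
have s (c : K) n : (n < q + q)%N -> (size (c%:P * 'X^n)%R <= q + q)%N.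
  by move=> Hn; rewrite mul_polyC; apply: leq_trans (size_scale_leq _ _) _; rewrite size_polyXn.
have pq : (p < q)%N by rewrite -[X in (X < _)%N]addn0 ltn_add2l.
have rq : (r < q)%N by rewrite /q addnC -[X in (X < _)%N]addn0 ltn_add2l.
have q0 : (0 < q)%N by apply: leq_ltn_trans pq.
rewrite /low; apply: leq_trans (size_polyD _ _) _; rewrite geq_max; apply/andP; split; last by rewrite size_poly1 addn_gt0 q0.
apply: leq_trans (size_polyD _ _) _; rewrite geq_max; apply/andP; split; last by apply: s; apply: ltn_trans rq _; rewrite -[X in (X < _)%N]addn0 ltn_add2l.
apply: leq_trans (size_polyD _ _) _; rewrite geq_max; apply/andP; split; last by apply: s; apply: ltn_trans pq _; rewrite -[X in (X < _)%N]addn0 ltn_add2l.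
apply: leq_trans (size_polyD _ _) _; rewrite geq_max; apply/andP; split; last by apply: s; rewrite -[X in (X < _)%N]addn0 ltn_add2l.
by apply: leq_trans (size_polyD _ _) _; rewrite geq_max; apply/andP; split; apply: s; rewrite ltn_add2l.
Qed.

Lemma horner_P (v : K) : P.[v] = v ^+ (q + q) + (w * v ^+ (q + p) + w' * v ^+ (q + r)
   + m6 * v ^+ q + w * v ^+ p + w' * v ^+ r + 1).
Proof. by rewrite /P /low !hornerE. Qed.

(** Were all the roots equal to the double root [v0] of a triple collision, [P]
    would be [('X - v0) ^ (2 q)], of value [4 ^ q] at [- v0]; but its value there
    is [0], [8] or [- 8]. *)
Lemma critical_roots : exists rs : seq K,
  (forall v, P.[v] = 0 <-> v \in rs) /\
  exists v, v \in rs /\ ~ (v ^+ q = 1 /\ v ^+ r = w).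
Proof.
have [rs Ers] := closed_field_poly_normal P.
have sX : size ('X^(q + q) : {poly K}) = (q + q).+1 by rewrite size_polyXn.
have sP : size P = (q + q).+1 by rewrite /P size_polyDl ?sX // ltnS size_low.
have lP : lead_coef P = 1.
  by rewrite /P lead_coefDl ?sX ?ltnS ?size_low // lead_coefXn.
rewrite lP scale1r in Ers.
have root_rs v : P.[v] = 0 <-> v \in rs.
  by rewrite -root_prod_XsubC -Ers; split; move/eqP.
have srs : size rs = (q + q)%N by move: sP; rewrite Ers size_prod_XsubC => -[].
exists rs; split=> //; apply: NNPP => Hno.
have Hall v : v \in rs -> v ^+ q = 1 /\ v ^+ r = w.
  by move=> Hv; apply: NNPP => Hn; apply: Hno; exists v.
have q0 : (0 < q)%N by rewrite addn_gt0 p_gt0.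
case Es : rs => [|v0 s]; first by move: srs; rewrite Es; case: (q) q0.
have Hv0 : v0 \in rs by rewrite Es mem_head.
have [vq vr] := Hall _ Hv0.
have Ens : rs = nseq (q + q) v0.
  rewrite -srs; apply/all_pred1P/allP => u /Hall [uq ur] /=.
  by apply/eqP; exact: triple_unique.
have EP : P.[- v0] = (4 ^ q)%:R.
  rewrite Ers Ens horner_prod big_nseq iter_mulr_1 hornerXsubC -opprD -mulr2n -[v0 *+ 2]mulr_natl.
  by rewrite exprD -exprMn mulrNN mulrACA -natrM !exprMn vq !mulr1 natrX.
have vp : v0 ^+ p = w' by rewrite -[RHS]mul1r -vq exprD vr -mulrA ww' mulr1.
move: EP; rewrite horner_P (exprD _ q q) (exprD _ q p) (exprD _ q r) !(exprNn v0) vq vr vp.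
have sg n : (-1 : K) ^+ n = 1 \/ (-1 : K) ^+ n = -1.
  by rewrite -signr_odd; case: (odd n); [right | left].
rewrite [(-1) ^+ q]exprD !mulr1.
have four_gt0 : 0 < (4 ^ q)%:R :> K by rewrite ltr0n expn_gt0.
have not8 : (4 ^ q)%:R <> 8%:R :> K.
  move/eqP; rewrite eqr_nat -[4%N]/(2 ^ 2)%N -expnM -[8%N]/(2 ^ 3)%N eqn_exp2l //.
  by case: (q) => [|[|n]] //; rewrite !mulnS.
case: (sg p) => ->; case: (sg r) => -> E; move: E four_gt0 not8.
- have -> : 1 * 1 * (1 * 1) + (w * (1 * 1 * (1 * w')) + w' * (1 * 1 * (1 * w)) +
     m6 * (1 * 1) + w * (1 * w') + w' * (1 * w) + 1) = 4%:R * (w * w') - 4%:R.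
    by rewrite /m6; ring.
  by rewrite ww' mulr1 subrr => <-; rewrite ltxx.
- have -> : 1 * -1 * (1 * -1) + (w * (1 * -1 * (1 * w')) + w' * (1 * -1 * (-1 * w)) +
     m6 * (1 * -1) + w * (1 * w') + w' * (-1 * w) + 1) = 8%:R :> K.
    by rewrite /m6; ring.
  by move=> ->.
- have -> : -1 * 1 * (-1 * 1) + (w * (-1 * 1 * (-1 * w')) + w' * (-1 * 1 * (1 * w)) +
     m6 * (-1 * 1) + w * (-1 * w') + w' * (1 * w) + 1) = 8%:R :> K.
    by rewrite /m6; ring.
  by move=> ->.
- have -> : -1 * -1 * (-1 * -1) + (w * (-1 * -1 * (-1 * w')) + w' * (-1 * -1 * (-1 * w)) +
     m6 * (-1 * -1) + w * (-1 * w') + w' * (-1 * w) + 1) = - 4%:R * (w * w') - 4%:R.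
    by rewrite /m6; ring.
  by rewrite ww' mulr1 -opprD -natrD => <-; rewrite oppr_gt0 ltrn0.
Qed.

End ClosedField.
End CriticalEquation.

Module ComplexTransfer.
Import ssrnat all_order all_algebra Rstruct.
Import Order.TTheory GRing.Theory Num.Theory CriticalEquation.
Local Open Scope ring_scope.

Import mathcomp.real_closed.complex.

Definition to_C (z : Rdefinitions.R[i]%type) : C := (complex.Re z, complex.Im z).

Definition of_C (z : C) : Rdefinitions.R[i]%type := Complex z.1 z.2.

Lemma of_CK (z : C) : to_C (of_C z) = z.
Proof. by case: z. Qed.

Lemma to_C_inj (x y : Rdefinitions.R[i]) : to_C x = to_C y -> x = y.
Proof. by case: x y => [a b] [a' b'] [-> ->]. Qed.

Lemma to_C_add (x y : Rdefinitions.R[i]) : to_C (x + y) = Cplus (to_C x) (to_C y).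
Proof. by case: x y => [a b] [a' b']. Qed.

Lemma to_C_mul (x y : Rdefinitions.R[i]) : to_C (x * y) = Cmult (to_C x) (to_C y).
Proof. by case: x y => [a b] [a' b']. Qed.

Lemma to_C_exp (x : Rdefinitions.R[i]) n : to_C (x ^+ n) = Cpow (to_C x) n.
Proof.
elim: n => [|n IH] //.
by rewrite exprS to_C_mul IH.
Qed.

Lemma to_C_m6 : to_C (- 6%:R) = RtoC (-6).
Proof.
have nat n : to_C n%:R = RtoC (INR n).
  elim: n => [|n IH] //.
  by rewrite -natr1 to_C_add IH S_INR RtoC_plus.
have : Cplus (to_C (- 6%:R)) (RtoC 6) = RtoC 0.
  have -> : RtoC 6 = to_C 6%:R by rewrite nat; congr RtoC => /=; lra.
  by rewrite -to_C_add addNr.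
move=> E; have -> : to_C (- 6%:R) = Cminus (Cplus (to_C (- 6%:R)) (RtoC 6)) (RtoC 6).
  by ring.
by rewrite E -RtoC_minus; congr RtoC; lra.
Qed.

Local Close Scope ring_scope.
Local Open Scope C_scope.

(** Numerator of [cot z - cot (c + a z) + cot (c - b z)], for [a = p / (p + r)]
    and [b = r / (p + r)]: the cotangents are rational functions of
    [x y], [w x] and [w / y], with [x = v ^ p], [y = v ^ r],
    [v = exp (2 i z / (p + r))] and [w = exp (2 i c)]. *)
Definition numerator (w x y : C) : C :=
  (x * y + 1) * (w * x - 1) * (w - y) - (w * x + 1) * (x * y - 1) * (w - y)
  + (w + y) * (x * y - 1) * (w * x - 1).

Lemma numerator_roots (p r : nat) (w : C) : is_true (ssrnat.leq 1 p) -> is_true (ssrnat.leq 1 r) ->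
  is_true (div.coprime p r) -> w <> 0 ->
  exists s : list C, (forall v, numerator w (v ^ p) (v ^ r) = 0 -> List.In v s) /\
    exists v, numerator w (v ^ p) (v ^ r) = 0 /\ ~ (v ^ p * v ^ r = 1 /\ v ^ r = w).
Proof.
move=> p0 r0 pr w0.
have ww : GRing.mul (of_C w) (of_C (/ w)) = GRing.one _.
  by apply: to_C_inj; rewrite to_C_mul !of_CK Cinv_r.
have [rs [Hrs [v [Hv Hnv]]]] := critical_roots _ _ _ _ _ p0 r0 pr ww.
have EN x : w * to_C (horner ('X^(p + r + (p + r)) + ((of_C w)%:P * 'X^(p + r + p)
  + (of_C (/ w))%:P * 'X^(p + r + r) + (- 6%:R)%:P * 'X^(p + r) + (of_C w)%:P * 'X^p
  + (of_C (/ w))%:P * 'X^r + 1))%R x) = numerator w (to_C x ^ p) (to_C x ^ r).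
  rewrite horner_P.
  rewrite ?(to_C_add, to_C_mul, to_C_exp, to_C_m6, of_CK, Cpow_add_r).
  have -> : to_C (GRing.one _) = RtoC 1 by [].
  move: (Cpow (to_C x) p) (Cpow (to_C x) r) => X Y.
  by rewrite /numerator; field.
have cancel (A : C) : w * A = 0 -> A = 0.
  move=> H; have -> : A = / w * (w * A) by field.
  by rewrite H; ring.
have mem_In (l : list Rdefinitions.R[i]%type) (u : Rdefinitions.R[i]%type) : u \in l -> List.In u l.
  elim: l => [|a l IH] //; rewrite inE => /orP [/eqP -> | /IH]; first by left.
  by right.
exists (List.map to_C rs); split.
  move=> u Hu; rewrite -(of_CK u); apply/List.in_map/mem_In/Hrs/to_C_inj.
  apply: cancel; have := EN (of_C u); rewrite of_CK Hu; exact.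
exists (to_C v); split.
  rewrite -EN; move/Hrs: Hv => Hv.
  apply: (eq_trans (f_equal (fun A => w * to_C A) Hv)).
  have -> : to_C (GRing.zero : Rdefinitions.R[i]%type) = RtoC 0 by [].
  by ring.
move=> [H1 H2]; apply: Hnv; split; apply: to_C_inj.
  by rewrite to_C_exp Cpow_add_r.
by rewrite to_C_exp of_CK.
Qed.

End ComplexTransfer.
Import ComplexTransfer.


(** * The complex exponential and the cotangent *)

(** This is [exp (i z)]. *)
Definition cis (z : C) : C := (exp (- Im z) * cos (Re z), exp (- Im z) * sin (Re z)).

Lemma cis_plus (z w : C) : cis (z + w) = (cis z * cis w)%C.
Proof.
have E1 : Re (z + w) = Re z + Re w by [].
have E2 : - Im (z + w) = - Im z + - Im w by rewrite -Ropp_plus_distr.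
rewrite /cis E1 E2 exp_plus cos_plus sin_plus /Cmult /=.
by congr pair; ring.
Qed.

Lemma cis_0 : cis (RtoC 0) = RtoC 1.
Proof. by rewrite /cis /= Ropp_0 exp_0 cos_0 sin_0 /RtoC; congr pair; ring. Qed.

Lemma cis_neq_0 (z : C) : cis z <> RtoC 0.
Proof.
move=> E; have := cis_plus z (- z); rewrite E Cplus_opp_r cis_0 Cmult_0_l.
by move=> [H]; lra.
Qed.

Lemma cis_mult_nat (n : nat) (z : C) : cis (RtoC (INR n) * z) = (cis z ^ n)%C.
Proof.
elim: n => [|n IH]; first by rewrite /= Cmult_0_l cis_0.
have -> : (RtoC (INR n.+1) * z = z + RtoC (INR n) * z)%C by rewrite S_INR RtoC_plus; ring.
by rewrite cis_plus IH.
Qed.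

Lemma cis_surjective (v : C) : v <> RtoC 0 -> exists z, cis z = v.
Proof.
move=> v0; have m0 : 0 < Cmod v by apply/Cmod_gt_0.
have E2 : Re v ^ 2 + Im v ^ 2 = Cmod v ^ 2.
  rewrite /Cmod pow2_sqrt //.
  by have := pow2_ge_0 v.1; have := pow2_ge_0 v.2; lra.
have [th [Ec Es]] : exists th, Cmod v * cos th = Re v /\ Cmod v * sin th = Im v.
  pose t := Re v / Cmod v.
  have Et : Cmod v * t = Re v by rewrite /t; field; lra.
  have Ht : -1 <= t <= 1.
    have := Re_le_Cmod v => /Rabs_le_between [h1 h2].
    by split; apply: (Rmult_le_reg_l (Cmod v)) => //; lra.
  have Es : (Cmod v * sin (acos t)) ^ 2 = Im v ^ 2.
    have := sin2_cos2 (acos t); rewrite cos_acos // !Rsqr_pow2 => H.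
    have -> : Im v ^ 2 = Cmod v ^ 2 - (Cmod v * t) ^ 2 by rewrite Et; lra.
    rewrite Rpow_mult_distr; have -> : sin (acos t) ^ 2 = 1 - t ^ 2 by lra.
    by ring.
  have /Rmult_integral : (Cmod v * sin (acos t) - Im v) * (Cmod v * sin (acos t) + Im v) = 0 by nra.
  case=> E.
    by exists (acos t); rewrite cos_acos //; lra.
  by exists (- acos t); rewrite cos_neg sin_neg cos_acos //; lra.
exists (th, - ln (Cmod v)).
rewrite /cis /= Ropp_involutive exp_ln // Ec Es.
by case: (v).
Qed.

Lemma cis_eq (z w : C) : cis z = cis w -> exists k : Z, (z - w)%C = RtoC (2 * (IZR k * PI)).
Proof.
move=> E.
set d := (z - w)%C.
have Ed : cis d = RtoC 1 by rewrite cis_plus E -cis_plus Cplus_opp_r cis_0.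
have E1 : exp (- Im d) * cos (Re d) = 1 by exact: (f_equal fst Ed).
have E2 : exp (- Im d) * sin (Re d) = 0 by exact: (f_equal snd Ed).
have ep := exp_pos (- Im d).
have S0 : sin (Re d) = 0 by case: (Rmult_integral _ _ E2) => // H; lra.
have C2 := sin2_cos2 (Re d); rewrite S0 /Rsqr in C2.
have C1 : cos (Re d) = 1 by nra.
rewrite C1 Rmult_1_r in E1.
have I0 : Im d = 0.
  have : ln (exp (- Im d)) = 0 by rewrite E1 ln_1.
  by rewrite ln_exp; lra.
have : sin (Re d / 2) = 0.
  have := cos_2a_sin (Re d / 2).
  have -> : 2 * (Re d / 2) = Re d by field.
  by rewrite C1 => H; nra.
case/sin_eq_0_0 => k Ek; exists k.
rewrite (surjective_pairing d) /RtoC; congr pair => //.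
have -> : d.1 = Re d by [].
lra.
Qed.

(** [cot z = i (exp (2 i z) + 1) / (exp (2 i z) - 1)], away from the zeros of
    the sine, where [exp (2 i z) = 1]. *)
Definition cot_C (z : C) : C := (cot_re z, - cot_im z).

Lemma cis_double (z : C) : exists E, 0 < E /\
  cis (z + z) = (E ^ 2 * (1 - 2 * sin (Re z) ^ 2), E ^ 2 * (2 * sin (Re z) * cos (Re z))) /\
  sinh (Im z) = (/ E - E) / 2 /\ cosh (Im z) = (/ E + E) / 2.
Proof.
exists (exp (- Im z)); split; first exact: exp_pos.
have Ei : / exp (- Im z) = exp (Im z) by rewrite -exp_Ropp Ropp_involutive.
split; last by rewrite /sinh /cosh Ei.
have E1 : Re (z + z) = 2 * Re z by rewrite (_ : Re (z + z) = Re z + Re z) //; ring.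
have E2 : - Im (z + z) = - Im z + - Im z by rewrite -Ropp_plus_distr.
rewrite /cis E1 E2 exp_plus sin_2a cos_2a_sin.
by congr pair; ring.
Qed.

Lemma cis_double_eq_1 (z : C) : cis (z + z) = RtoC 1 -> sin_sq z = 0.
Proof.
have [E [E0 [-> [Es Ec]]]] := cis_double z.
move=> [H1 H2]; rewrite /sin_sq Es.
have Q : sin (Re z) ^ 2 + cos (Re z) ^ 2 = 1.
  by have := sin2_cos2 (Re z); rewrite !Rsqr_pow2.
have -> : sin (Re z) ^ 2 + ((/ E - E) / 2) ^ 2 =
  ((E ^ 2 * (1 - 2 * sin (Re z) ^ 2) - 1) ^ 2
    + (E ^ 2 * (2 * sin (Re z) * cos (Re z))) ^ 2) / (4 * E ^ 2).
  have -> : (E ^ 2 * (2 * sin (Re z) * cos (Re z))) ^ 2 =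
      E ^ 4 * 4 * sin (Re z) ^ 2 * (1 - sin (Re z) ^ 2).
    by rewrite -Q; ring.
  by field; lra.
by rewrite H1 H2; field; lra.
Qed.

Lemma cot_cis (z : C) : sin_sq z <> 0 ->
  ((cis (z + z) - 1) * cot_C z = Ci * (cis (z + z) + 1))%C.
Proof.
have [E [E0 [-> [Es Ec]]]] := cis_double z.
rewrite /cot_C /cot_re /cot_im => S0.
have Q : cos (Re z) ^ 2 = 1 - sin (Re z) ^ 2.
  by have := sin2_cos2 (Re z); rewrite !Rsqr_pow2; lra.
have ES : sin_sq z = (4 * E ^ 2 * sin (Re z) ^ 2 + (1 - E ^ 2) ^ 2) / (4 * E ^ 2).
  by rewrite /sin_sq Es; field; lra.
have E4 : 0 < 4 * E ^ 2 by have := pow_lt E 2 E0; lra.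
set T := 4 * E ^ 2 * sin (Re z) ^ 2 + (1 - E ^ 2) ^ 2 in ES.
have T0 : T <> 0 by move=> T0; apply: S0; rewrite ES T0; field; lra.
rewrite Es Ec ES.
move: Q T0; rewrite /T; move: (sin (Re z)) (cos (Re z)) => s c Q T0.
rewrite /Cmult /Cminus /Cplus /Copp /Ci /RtoC /=.
congr pair.
  by field; split => //; lra.
have -> : forall X, (E * (E * 1) * (1 - 2 * (s * (s * 1))) + -1) * - X +
   (E * (E * 1) * (2 * s * c) + - 0) * (s * c / ((4 * (E * (E * 1)) * (s * (s * 1)) +
      (1 - E * (E * 1)) * ((1 - E * (E * 1)) * 1)) / (4 * (E * (E * 1))))) =
   (E ^ 2 * (1 - 2 * s ^ 2) - 1) * - X + E ^ 2 * 2 * s ^ 2 * c ^ 2 /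
     ((4 * E ^ 2 * s ^ 2 + (1 - E ^ 2) ^ 2) / (4 * E ^ 2)).
  by move=> X; field; split=> //; lra.
by rewrite Q; field; split=> //; lra.
Qed.


(** * Critical points for commensurable vorticities *)

Lemma locally_lipschitz_cis (p : C) :
  locally_lipschitz (fun z => Re (cis z)) p /\ locally_lipschitz (fun z => Im (cis z)) p.
Proof.
have He : locally_lipschitz (fun z => exp (- Im z)) p.
  apply: (locally_lipschitz_smooth exp exp exp (fun z => - Im z)); try exact: is_derive_exp.
  have := locally_lipschitz_scal (-1) _ _ (locally_lipschitz_Im p).
  by apply: (locally_lipschitz_ext _ _ _ 1) => [|x _]; [lra | ring].
split; apply: locally_lipschitz_mult => //.
  exact: locally_lipschitz_smooth is_derive_cos is_derive_nsin (locally_lipschitz_Re p).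
exact: locally_lipschitz_smooth is_derive_sin is_derive_cos (locally_lipschitz_Re p).
Qed.

Lemma cis_avoids_finite (w : C) (m : R) (p : C) (s : list C) :
  exists d, 0 < d /\ forall z, Cmod (z - p) < d ->
    List.In (cis (affine w m z)) s -> cis (affine w m z) = cis (affine w m p).
Proof.
elim: s => [|e s [d [d0 IH]]]; first by exists 1; split; [lra|].
case: (classic (e = cis (affine w m p))) => [He|Hne].
  by exists d; split=> // z Hz [<-|] //; exact: IH.
have [L1 L2] := locally_lipschitz_cis (affine w m p).
pose g := Cmod (e - cis (affine w m p)) / 2.
have g0 : 0 < g.
  have : 0 < Cmod (e - cis (affine w m p)).
    by apply/Cmod_gt_0 => E; apply/Hne/Cminus_diag_uniq.
  by rewrite /g; lra.
have [d1 [d10 H1]] := locally_lipschitz_continuous _ _ (locally_lipschitz_affine _ _ _ _ L1) _ g0.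
have [d2 [d20 H2]] := locally_lipschitz_continuous _ _ (locally_lipschitz_affine _ _ _ _ L2) _ g0.
exists (Rmin d (Rmin d1 d2)); split; first by repeat apply: Rmin_pos.
move=> z Hz; have l1 := Rmin_l d (Rmin d1 d2); have l2 := Rmin_r d (Rmin d1 d2).
have l3 := Rmin_l d1 d2; have l4 := Rmin_r d1 d2.
case=> [E|]; last by apply: IH; lra.
exfalso; have := H1 z ltac:(lra); have := H2 z ltac:(lra); rewrite -E.
have := Cmod_le_sum (e - cis (affine w m p)).
have -> : Re (e - cis (affine w m p)) = Re e - Re (cis (affine w m p)) by [].
have -> : Im (e - cis (affine w m p)) = Im e - Im (cis (affine w m p)) by [].
rewrite /g; lra.
Qed.

Section RationalCriticalPoints.
Variables (p r : nat) (c : C).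
Hypotheses (p_gt0 : is_true (leq 1 p)) (r_gt0 : is_true (leq 1 r)).
Hypothesis pr_coprime : is_true (div.coprime p r).

Let q := INR p + INR r.
Let a := INR p / q.
Let b := INR r / q.
Let w := cis (c + c).

Lemma INR_gt0 (n : nat) : is_true (leq 1 n) -> 0 < INR n.
Proof. by move=> /ssrnat.leP; exact: lt_0_INR. Qed.

Lemma rational_q_gt0 : 0 < q.
Proof. by have := INR_gt0 p p_gt0; have := INR_gt0 r r_gt0; rewrite /q; lra. Qed.

Let root (z : C) : C := cis (affine (RtoC 0) (2 / q) z).

Lemma root_powers (z : C) :
  cis (z + z) = (root z ^ p * root z ^ r)%C /\
  cis (affine c a z + affine c a z) = (w * root z ^ p)%C /\
  (cis (affine c (- b) z + affine c (- b) z) * root z ^ r)%C = w.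
Proof.
have q0 := rational_q_gt0.
rewrite /root -!cis_mult_nat /w -!cis_plus /affine.
split; last split; congr cis.
- have E : 2 = INR p * (2 / q) + INR r * (2 / q) by rewrite -Rmult_plus_distr_r -/q; field; lra.
  have -> : (z + z = RtoC 2 * z)%C by ring.
  by rewrite [in LHS]E RtoC_plus !RtoC_mult; ring.
- have -> : RtoC a = (RtoC (INR p) * RtoC (2 / q) / 2)%C.
    by rewrite -RtoC_mult -RtoC_div; [congr RtoC; rewrite /a; field; lra | lra].
  by field.
- have -> : RtoC (- b) = (- (RtoC (INR r) * RtoC (2 / q) / 2))%C.
    by rewrite -RtoC_mult -RtoC_div -?RtoC_opp; [congr RtoC; rewrite /b; field; lra | lra].
  by field.
Qed.

Lemma critical_cot (z : C) : critical (rel_energy_x a b c) (rel_energy_y a b c) z <->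
  (cot_C z - cot_C (affine c a z) + cot_C (affine c (- b) z) = 0)%C.
Proof.
rewrite /critical /rel_energy_x /rel_energy_y /cot_C.
split.
  move=> [E1 E2]; apply: injective_projections; rewrite /=; lra.
by move=> E; have := f_equal fst E; have := f_equal snd E; rewrite /=; lra.
Qed.

Lemma critical_numerator (z : C) : no_collision a b c z ->
  critical (rel_energy_x a b c) (rel_energy_y a b c) z <->
  numerator w (root z ^ p) (root z ^ r) = RtoC 0.
Proof.
move=> [H1 [H2 H3]].
have [P1 [P2 P3]] := root_powers z.
have K1 := cot_cis z H1; have K2 := cot_cis _ H2; have K3 := cot_cis _ H3.
have N1 : (cis (z + z) - 1)%C <> RtoC 0.
  by move=> E; apply/H1/cis_double_eq_1/Cminus_diag_uniq.
have N2 : (cis (affine c a z + affine c a z) - 1)%C <> RtoC 0.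
  by move=> E; apply/H2/cis_double_eq_1/Cminus_diag_uniq.
have N3 : (cis (affine c (- b) z + affine c (- b) z) - 1)%C <> RtoC 0.
  by move=> E; apply/H3/cis_double_eq_1/Cminus_diag_uniq.
have N4 : (root z ^ r)%C <> RtoC 0 by apply/Cpow_nz/cis_neq_0.
rewrite critical_cot.
move: P1 P2 P3 K1 K2 K3 N1 N2 N3 N4.
move: (root z ^ p)%C (root z ^ r)%C (cis (z + z)) (cis (affine c a z + affine c a z))
  (cis (affine c (- b) z + affine c (- b) z)) (cot_C z) (cot_C (affine c a z))
  (cot_C (affine c (- b) z)) => x y u al be k1 k2 k3 P1 P2 P3 K1 K2 K3 N1 N2 N3 N4.
have key : ((k1 - k2 + k3) * ((u - 1) * (al - 1) * (be - 1) * y) = Ci * numerator w x y)%C.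
  have -> : ((k1 - k2 + k3) * ((u - 1) * (al - 1) * (be - 1) * y) =
    ((u - 1) * k1) * (al - 1) * (be * y - y) - ((al - 1) * k2) * (u - 1) * (be * y - y)
    + ((be - 1) * k3) * y * (u - 1) * (al - 1))%C by ring.
  rewrite K1 K2 K3 P3 P1 P2.
  have -> : (Ci * (be + 1) * y = Ci * (be * y + y))%C by ring.
  by rewrite P3 /numerator; ring.
have Ci0 : Ci <> RtoC 0 by move=> [] H; lra.
split=> E.
  rewrite E Cmult_0_l in key.
  have -> : numerator w x y = (/ Ci * (Ci * numerator w x y))%C by field.
  by rewrite -key; ring.
rewrite E Cmult_0_r in key.
have N : ((u - 1) * (al - 1) * (be - 1) * y)%C <> RtoC 0 by repeat apply: Cmult_neq_0.
have -> : (k1 - k2 + k3 = (k1 - k2 + k3) * ((u - 1) * (al - 1) * (be - 1) * y)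
   / ((u - 1) * (al - 1) * (be - 1) * y))%C by field.
by rewrite key /Cdiv; ring.
Qed.

(** The roots [v] of the numerator are finitely many, and each corresponds to one
    class of points [z] modulo [(p + r) PI]. *)
Lemma relative_critical_isolated :
  isolated_critical (no_collision a b c) (rel_energy_x a b c) (rel_energy_y a b c).
Proof.
move=> z0 D0 C0.
have q0 := rational_q_gt0.
have [s [Hs _]] := numerator_roots p r w p_gt0 r_gt0 pr_coprime (cis_neq_0 _).
have [d [d0 Hd]] := cis_avoids_finite (RtoC 0) (2 / q) z0 s.
exists (Rmin d q); split; first exact: Rmin_pos.
move=> z Dz Cz Hz; have l1 := Rmin_l d q; have l2 := Rmin_r d q.
have : cis (affine (RtoC 0) (2 / q) z) = cis (affine (RtoC 0) (2 / q) z0).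
  by apply: Hd; [lra | apply/Hs/critical_numerator].
move/cis_eq=> [k]; rewrite affine_sub => Ek.
have Ez : (z - z0)%C = RtoC (q * IZR k * PI).
  have -> : (z - z0)%C = (RtoC (q / 2) * (RtoC (2 / q) * (z - z0)))%C.
    rewrite Cmult_assoc -RtoC_mult; have -> : q / 2 * (2 / q) = 1 by field; lra.
    by ring.
  by rewrite Ek -RtoC_mult; congr RtoC; field.
have k0 : k = 0%Z.
  rewrite Ez Cmod_R (Rabs_mult _ PI) (Rabs_mult q) (Rabs_pos_eq q) in Hz; last lra.
  rewrite (Rabs_pos_eq PI) in Hz; last by have := PI_RGT_0; lra.
  have P3 := PI2_3_2.
  have : Rabs (IZR k) < 1.
    have := Rabs_pos (IZR k) => h; apply: (Rmult_lt_reg_l q) => //.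
    have : q * Rabs (IZR k) * 1 <= q * Rabs (IZR k) * PI.
      apply: Rmult_le_compat_l; last by lra.
      by apply: Rmult_le_pos; lra.
    lra.
  by rewrite -abs_IZR => /lt_IZR; lia.
rewrite k0 Rmult_0_r Rmult_0_l in Ez.
exact: Cminus_diag_uniq.
Qed.

(** A root of the numerator other than a triple collision is not a collision at
    all, as two coinciding pairs make the third coincide. *)
Lemma relative_critical_exists :
  exists z, no_collision a b c z /\ critical (rel_energy_x a b c) (rel_energy_y a b c) z.
Proof.
have q0 := rational_q_gt0.
have w0 : w <> RtoC 0 := cis_neq_0 _.
have [_ [_ [v [Hv Hnv]]]] := numerator_roots p r w p_gt0 r_gt0 pr_coprime w0.
have v0 : v <> RtoC 0.
  move=> E; move: Hv; rewrite E.
  have Z n : is_true (leq 1 n) -> (RtoC 0 ^ n)%C = RtoC 0.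
    by case: n => [|n] //= _; rewrite Cmult_0_l.
  rewrite !Z // /numerator => Hw; apply: w0.
  by rewrite -Hw; ring.
have [z' Ez'] := cis_surjective v v0.
pose z := (RtoC (q / 2) * z')%C.
have Ez : root z = v.
  rewrite /root /affine /z -Ez'; congr cis.
  rewrite Cplus_0_l Cmult_assoc -RtoC_mult; have -> : 2 / q * (q / 2) = 1 by field; lra.
  by ring.
have [P1 [P2 P3]] := root_powers z; rewrite Ez in P1 P2 P3.
have y0 : (v ^ r)%C <> RtoC 0 by exact: Cpow_nz.
have coll t : sin_sq t = 0 -> cis (t + t) = RtoC 1.
  case/sin_sq_eq_0 => n ->; rewrite -RtoC_plus /cis /= Ropp_0 exp_0.
  have -> : IZR n * PI + IZR n * PI = 2 * (IZR n * PI) by ring.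
  have s0 : sin (IZR n * PI) = 0 by apply: sin_eq_0_1; exists n.
  by rewrite cos_2a_sin sin_2a s0 /RtoC; congr pair; ring.
have cancel (x y : C) : (x * y = 0)%C -> x = 0%C \/ y = 0%C.
  move=> E; case: (classic (x = 0%C)) => Hx; first by left.
  by right; have -> : y = (/ x * (x * y))%C; [field | rewrite E; ring].
have sub0 := Cminus_diag_uniq.
have two0 : RtoC 2 <> 0%C by move=> [] ?; lra.
(* Here 1 = x y, 1 = w x and w = y stand for the collisions of the three pairs. *)
move: Hv Hnv P1 P2 P3 y0; set x := (v ^ p)%C; set y := (v ^ r)%C => Hv Hnv P1 P2 P3 y0.
have T12 : (x * y = 1 -> w * x = 1 -> False)%C.
  move=> h1 h2; apply: Hnv; split=> //.
  have -> : y = (w * x * y)%C by rewrite h2; ring.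
  by rewrite -Cmult_assoc h1; ring.
have T13 : (x * y = 1 -> w = y -> False)%C by move=> h1 h3; apply: Hnv.
have T23 : (w * x = 1 -> w = y -> False)%C.
  by move=> h2 h3; apply: Hnv; split=> //; rewrite -h3 -h2; ring.
have D : no_collision a b c z.
  split; last split.
  - move=> /coll; rewrite P1 => h1; move: Hv.
    have -> : numerator w x y = (2 * ((w * x - 1) * (w - y)))%C by rewrite /numerator h1; ring.
    case/cancel => // /cancel [] /sub0; [exact: T12 | exact: T13].
  - move=> /coll; rewrite P2 => h2; move: Hv.
    have -> : numerator w x y = (2 * (- (x * y - 1) * (w - y)))%C by rewrite /numerator h2; ring.
    case/cancel => // /cancel [E|/sub0]; last exact: T23.
    apply: T12 => //; apply: sub0.
    by have -> : (x * y - 1 = - - (x * y - 1))%C; [ring | rewrite E; ring].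
  - move=> /coll h3; rewrite h3 Cmult_1_l in P3; move: Hv.
    have -> : numerator w x y = (2 * (w * ((x * y - 1) * (w * x - 1))))%C.
      by rewrite /numerator P3; ring.
    case/cancel => // /cancel [] // /cancel [] /sub0 h; first exact: T13.
    exact: T23.
exists z; split=> //; apply/critical_numerator => //.
by rewrite Ez.
Qed.

End RationalCriticalPoints.

(** * From motions of three vortices to the relative motion *)

Lemma is_derive_C (f : R -> C) (t : R) (l : C) :
  is_derive f t l <->
  is_derive (fun s => Re (f s)) t (Re l) /\ is_derive (fun s => Im (f s)) t (Im l).
Proof.
split.
  move=> H; split.
    exact: (filterdiff_comp' f fst t (fun y => scal y l) fst H (filterdiff_linear _ is_linear_fst)).
  exact: (filterdiff_comp' f snd t (fun y => scal y l) snd H (filterdiff_linear _ is_linear_snd)).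
move=> [H1 H2].
have H := filterdiff_comp'_2 (fun s => Re (f s)) (fun s => Im (f s)) (fun x y => (x, y) : C) t
   (fun y => scal y (Re l)) (fun y => scal y (Im l)) (fun x y => (x, y) : C) H1 H2.
have Hid : filterdiff (fun x : R * R => (x.1, x.2)) (locally (Re (f t), Im (f t)))
    (fun x : R * R => (x.1, x.2)).
  apply: (filterdiff_ext_lin _ (fun x => x)); last by case.
  by apply: (filterdiff_ext (fun x => x)) (filterdiff_id _) => -[].
have {}H := H Hid.
apply: (filterdiff_ext (fun s => (Re (f s), Im (f s)) : C)) => [s|].
  by case: (f s).
exact: H.
Qed.

HB.instance Definition _ := Monoid.isComLaw.Build C (RtoC 0) Cplus Cplus_assoc Cplus_comm Cplus_0_l.

Definition o1 : 'I_3 := @Ordinal 3 0 isT.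
Definition o2 : 'I_3 := @Ordinal 3 1 isT.
Definition o3 : 'I_3 := @Ordinal 3 2 isT.

Lemma ord3P (P : 'I_3 -> Prop) : P o1 -> P o2 -> P o3 -> forall k, P k.
Proof.
move=> H1 H2 H3 [[|[|[|k]]] Hk] //.
- by have -> : Ordinal Hk = o1 by exact: val_inj.
- by have -> : Ordinal Hk = o2 by exact: val_inj.
- by have -> : Ordinal Hk = o3 by exact: val_inj.
Qed.

Lemma big_ord3 (F : 'I_3 -> C) (P : pred 'I_3) :
  \big[Cplus/RtoC 0]_(l < 3 | P l) F l =
  ((if P o1 then F o1 else 0) + (if P o2 then F o2 else 0) + (if P o3 then F o3 else 0))%C.
Proof.
rewrite big_mkcond !big_ord_recl big_ord0.
have -> : ord0 = o1 by exact: val_inj.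
have -> : lift o1 ord0 = o2 by exact: val_inj.
have -> : lift o1 (lift ord0 ord0) = o3 by exact: val_inj.
by rewrite /=; ring.
Qed.

Lemma Ccot_cot_C (z : C) : sin_sq z <> 0 -> Ccot z = cot_C z.
Proof.
move=> S0.
have Q1 := cosh_sinh_sq (Im z).
have Q2 : cos (Re z) ^ 2 = 1 - sin (Re z) ^ 2.
  by have := sin2_cos2 (Re z); rewrite !Rsqr_pow2; lra.
have Hs : Csin z <> 0%C.
  move=> E; apply: S0.
  have E1 : sin (Re z) * cosh (Im z) = 0 := f_equal fst E.
  have E2 : cos (Re z) * sinh (Im z) = 0 := f_equal snd E.
  have -> : sin_sq z = (sin (Re z) * cosh (Im z)) ^ 2 + (cos (Re z) * sinh (Im z)) ^ 2.
    have -> : (sin (Re z) * cosh (Im z)) ^ 2 + (cos (Re z) * sinh (Im z)) ^ 2 =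
      sin (Re z) ^ 2 * cosh (Im z) ^ 2 + cos (Re z) ^ 2 * sinh (Im z) ^ 2 by ring.
    by rewrite Q1 Q2 /sin_sq; ring.
  by rewrite E1 E2; ring.
have E : (cot_C z * Csin z)%C = Ccos z.
  rewrite /Csin /Ccos /cot_C /cot_re /cot_im /Cmult /=; congr pair.
    by move: S0; rewrite /sin_sq => S0; field.
  have -> : sin (Re z) * cos (Re z) / sin_sq z * (cos (Re z) * sinh (Im z)) +
    - (sinh (Im z) * cosh (Im z) / sin_sq z) * (sin (Re z) * cosh (Im z)) =
    sin (Re z) * sinh (Im z) * (cos (Re z) ^ 2 - cosh (Im z) ^ 2) / sin_sq z by field.
  by rewrite Q1 Q2; move: S0; rewrite /sin_sq => S0; field.
by rewrite /Ccot -E; field.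
Qed.

Lemma sin_sq_conj (z : C) : sin_sq (Cconj z) = sin_sq z.
Proof. by case: z => x y; rewrite /sin_sq /= sinh_neg; ring. Qed.

Lemma cot_C_conj (z : C) : cot_C (Cconj z) = Cconj (cot_C z).
Proof.
case: z => x y; rewrite /cot_C /cot_re /cot_im sin_sq_conj /Cconj /= sinh_neg cosh_neg.
by congr pair; rewrite /Rdiv; ring.
Qed.

Lemma sin_sq_opp (z : C) : sin_sq (- z) = sin_sq z.
Proof. by case: z => x y; rewrite /sin_sq /= sin_neg sinh_neg; ring. Qed.

Lemma cot_C_opp (z : C) : cot_C (- z) = (- cot_C z)%C.
Proof.
case: z => x y; rewrite /cot_C /cot_re /cot_im sin_sq_opp /Copp /= sin_neg cos_neg sinh_neg cosh_neg.
by congr pair; rewrite /Rdiv; ring.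
Qed.

Lemma same_point_sin (x y : C) : same_point x y <-> sin_sq ((x - y) / 2)%C = 0.
Proof.
rewrite sin_sq_eq_0; split=> -[n E]; exists n.
  by rewrite E -RtoC_div; [congr RtoC; field | lra].
have -> : (x - y)%C = (RtoC 2 * ((x - y) / 2))%C by field; move=> [] ?; lra.
by rewrite E -RtoC_mult; congr RtoC; ring.
Qed.

Lemma Ccot_half_conj (x y : C) : ~ same_point x y ->
  Ccot ((Cconj x - Cconj y) / 2) = Cconj (cot_C ((x - y) / 2)).
Proof.
rewrite same_point_sin => S0.
have E : ((Cconj x - Cconj y) / 2 = Cconj ((x - y) / 2))%C.
  by rewrite /Cconj; case: (x) (y) => [? ?] [? ?]; rewrite /Cdiv /Cminus /Cmult /=; congr pair; field.
by rewrite E Ccot_cot_C ?cot_C_conj ?sin_sq_conj.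
Qed.

Lemma continuous_along (u : C -> R) (phi : R -> C) (t v w : R) :
  locally_lipschitz u (phi t) ->
  is_derive (fun s => Re (phi s)) t v -> is_derive (fun s => Im (phi s)) t w ->
  continuous (fun s => u (phi s)) t.
Proof.
move=> Hu D1 D2; apply/filterlim_locally => eps.
have [d [d0 Hd]] := locally_lipschitz_continuous _ _ Hu eps (cond_pos eps).
have d2 : 0 < d / 2 by lra.
have C1 : continuous (fun s => Re (phi s)) t by apply: ex_derive_continuous; exists v.
have C2 : continuous (fun s => Im (phi s)) t by apply: ex_derive_continuous; exists w.
move/filterlim_locally/(_ (mkposreal _ d2)): C1 => C1.
move/filterlim_locally/(_ (mkposreal _ d2)): C2 => C2.
apply: filter_imp (filter_and _ _ C1 C2) => s [].
rewrite /ball /= /AbsRing_ball /abs /minus /plus /opp /= => h1 h2.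
apply: Hd; apply: Rle_lt_trans (Cmod_le_sum _) _.
have -> : Re (phi s - phi t) = Re (phi s) + - Re (phi t) by [].
have -> : Im (phi s - phi t) = Im (phi s) + - Im (phi t) by [].
lra.
Qed.

Lemma zero_derivative_constant_C (f : R -> C) :
  (forall t, is_derive f t (RtoC 0)) -> forall t, f t = f 0.
Proof.
move=> Hf t; apply: injective_projections.
  by apply: (zero_derivative_constant (fun s => Re (f s))) => s; case/is_derive_C: (Hf s).
by apply: (zero_derivative_constant (fun s => Im (f s))) => s; case/is_derive_C: (Hf s).
Qed.

Section ThreeVortices.
Variables (G G' : R) (c : C).
Hypothesis GG : 0 < G * G'.

(** The positions of the first two vortices relative to the third one are
    [2 (c + share1 z)] and [2 (c - share2 z)]; [speed] is the time scale of the
    resulting motion of [z]. *)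
Definition total : R := G + G'.
Definition share1 : R := G' / total.
Definition share2 : R := G / total.
Definition speed : R := total / (8 * PI).

Let a := share1.
Let b := share2.
Let k := speed.
Let Gam := vorticities3 G G'.

Lemma total_neq_0 : total <> 0.
Proof. by rewrite /total; nra. Qed.

Lemma share1_gt0 : 0 < a.
Proof.
have T2 : 0 < total * total by have := total_neq_0; rewrite -/(Rsqr total) => h; exact: Rsqr_pos_lt.
apply: (Rmult_lt_reg_r (total * total)) => //.
have -> : a * (total * total) = G' * total by rewrite /a /share1; field; exact: total_neq_0.
by rewrite /total; nra.
Qed.

Lemma share2_gt0 : 0 < b.
Proof.
have T2 : 0 < total * total by have := total_neq_0; rewrite -/(Rsqr total) => h; exact: Rsqr_pos_lt.
apply: (Rmult_lt_reg_r (total * total)) => //.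
have -> : b * (total * total) = G * total by rewrite /b /share2; field; exact: total_neq_0.
by rewrite /total; nra.
Qed.

Lemma shares_sum : a + b = 1.
Proof. by rewrite /a /b /share1 /share2 /total; field; exact: total_neq_0. Qed.

Lemma speed_neq_0 : k <> 0.
Proof.
have := PI_RGT_0 => P0; rewrite /k /speed /Rdiv; apply: Rmult_integral_contrapositive_currified.
  exact: total_neq_0.
by apply: Rinv_neq_0_compat; lra.
Qed.

(** The configuration with relative position [z] whose third vortex is at [u]. *)
Definition placed (z u : C) : 'I_3 -> C :=
  tnth [tuple (u + 2 * affine c a z)%C; (u + 2 * affine c (- b) z)%C; u].

Lemma placed_half_differences (z u : C) :
  ((placed z u o1 - placed z u o2) / 2 = z /\
   (placed z u o1 - placed z u o3) / 2 = affine c a z /\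
   (placed z u o2 - placed z u o3) / 2 = affine c (- b) z)%C.
Proof.
have two0 : RtoC 2 <> 0%C by move=> [] ?; lra.
rewrite /placed /tnth /=.
split; last by split; field.
rewrite /affine; have -> : a = 1 - b by have := shares_sum; lra.
by rewrite RtoC_minus RtoC_opp; field.
Qed.

Lemma configuration3_placed (z : C) (i : 'I_3) :
  configuration3 G G' c z i = placed z (- c)%C i.
Proof.
have T := total_neq_0.
move: i; apply: ord3P; rewrite /configuration3 /placed /tnth /= /affine.
- have -> : RtoC (2 * G' / (G + G')) = (2 * RtoC a)%C.
    by rewrite -RtoC_mult; congr RtoC; rewrite /a /share1 -/total; field.
  by ring.
- have -> : RtoC (2 * G / (G + G')) = (2 * RtoC b)%C.
    by rewrite -RtoC_mult; congr RtoC; rewrite /b /share2 -/total; field.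
  by rewrite RtoC_opp; ring.
- by [].
Qed.

Lemma phase_space3 (z : 'I_3 -> C) :
  phase_space z <->
  sin_sq ((z o1 - z o2) / 2) <> 0 /\ sin_sq ((z o1 - z o3) / 2) <> 0 /\
  sin_sq ((z o2 - z o3) / 2) <> 0.
Proof.
have sym x y : ~ same_point x y -> ~ same_point y x.
  move=> H [n E]; apply: H; exists (- n)%Z.
  have -> : (x - y = - (y - x))%C by ring.
  by rewrite E -RtoC_opp opp_IZR; congr RtoC; ring.
rewrite -!same_point_sin; split.
  by move=> H; split; [exact: H | split; exact: H].
move=> [H1 [H2 H3]]; apply: ord3P; apply: ord3P => // _; try exact: sym.
Qed.

Lemma phase_space_placed (z u : C) :
  phase_space (placed z u) <-> no_collision a b c z.
Proof.
have [E1 [E2 E3]] := placed_half_differences z u.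
by rewrite phase_space3 E1 E2 E3.
Qed.

Let K : C := (Ci / RtoC (4 * PI))%C.

Lemma velocity3 (z : 'I_3 -> C) : phase_space z ->
  let d12 := Cconj (cot_C ((z o1 - z o2) / 2)) in
  let d13 := Cconj (cot_C ((z o1 - z o3) / 2)) in
  let d23 := Cconj (cot_C ((z o2 - z o3) / 2)) in
  (velocity Gam z o1 = K * (G' * d12 + (- G - G')%R * d13) /\
   velocity Gam z o2 = K * (- (G * d12) + (- G - G')%R * d23) /\
   velocity Gam z o3 = K * (- (G * d13) - G' * d23))%C.
Proof.
move=> Hz d12 d13 d23.
have rev (i j : 'I_3) : i <> j ->
    Ccot ((Cconj (z i) - Cconj (z j)) / 2) = (- Cconj (cot_C ((z j - z i) / 2)))%C.
  move=> Hij; rewrite Ccot_half_conj; last exact: Hz.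
  have -> : ((z i - z j) / 2 = - ((z j - z i) / 2))%C by field; move=> [] ?; lra.
  by rewrite cot_C_opp; apply: injective_projections => /=; ring.
have fwd (i j : 'I_3) : i <> j ->
    Ccot ((Cconj (z i) - Cconj (z j)) / 2) = Cconj (cot_C ((z i - z j) / 2)).
  by move=> Hij; rewrite Ccot_half_conj //; exact: Hz.
rewrite /velocity !big_ord3 /=.
rewrite (fwd o1 o2) // (fwd o1 o3) // (rev o2 o1) // (fwd o2 o3) // (rev o3 o1) // (rev o3 o2) //.
rewrite -/d12 -/d13 -/d23 /Gam /vorticities3 /tnth /= -/K.
by split; last split; ring.
Qed.

Let D := no_collision a b c.
Let Ex := rel_energy_x a b c.
Let Ey := rel_energy_y a b c.
Let sol := solution D Ex Ey k.

Definition relative_field (z : C) : C := ((- k * Ey z)%R, (k * Ex z)%R).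

Lemma relative_field_cot (x : R) (z : C) :
  (K * (x * Cconj (cot_C z - cot_C (affine c a z) + cot_C (affine c (- b) z)))
   = 2 * RtoC (x / total) * relative_field z)%C.
Proof.
have P0 := PI_RGT_0; have T0 := total_neq_0.
rewrite /relative_field /K /Ex /Ey /rel_energy_x /rel_energy_y /cot_C.
rewrite /Cconj /Ci /Cdiv /Cinv /Cmult /Cplus /Cminus /Copp /RtoC /= /k /speed.
by congr pair; field; split=> //; lra.
Qed.

Lemma solution_field (phi : R -> C) :
  sol phi <-> forall t, D (phi t) /\ is_derive phi t (relative_field (phi t)).
Proof.
split=> H t; have [H1 H2] := H t; split=> //.
  exact: (proj2 (is_derive_C phi t (relative_field (phi t))) H2).
exact: (proj1 (is_derive_C phi t (relative_field (phi t))) H2).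
Qed.

Definition third_velocity (z : C) : C :=
  (K * (- (G * Cconj (cot_C (affine c a z))) - G' * Cconj (cot_C (affine c (- b) z))))%C.

Lemma velocity_placed (z u : C) : D z ->
  (velocity Gam (placed z u) o1 = third_velocity z + 2 * RtoC a * relative_field z /\
   velocity Gam (placed z u) o2 = third_velocity z + 2 * RtoC (- b) * relative_field z /\
   velocity Gam (placed z u) o3 = third_velocity z)%C.
Proof.
move=> Dz; have [-> [-> ->]] := velocity3 (placed z u) (proj2 (phase_space_placed z u) Dz).
have [-> [-> ->]] := placed_half_differences z u.
have F1 := relative_field_cot G' z; have F2 := relative_field_cot G z.
have conj3 (x y w : C) : (Cconj (x - y + w) = Cconj x - Cconj y + Cconj w)%C.
  by apply: injective_projections => /=; ring.
rewrite conj3 in F1 F2.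
rewrite /third_velocity RtoC_opp (_ : RtoC a = RtoC (G' / total)) // (_ : RtoC b = RtoC (G / total)) //.
have -> : (2 * - RtoC (G / total) * relative_field z = - (2 * RtoC (G / total) * relative_field z))%C by ring.
rewrite -F1 -F2 RtoC_minus RtoC_opp.
by split; last split; ring.
Qed.

Lemma is_derive_affine (u phi : R -> C) (m t : R) (v w : C) :
  is_derive u t v -> is_derive phi t w ->
  is_derive (fun s => (u s + 2 * affine c m (phi s))%C) t (v + 2 * RtoC m * w)%C.
Proof.
move=> /is_derive_C [U1 U2] /is_derive_C [W1 W2]; apply/is_derive_C.
have lin (f g : R -> R) df dg d : is_derive f t df -> is_derive g t dg ->
    is_derive (fun s => f s + (2 * d + 2 * m * g s)) t (df + 2 * m * dg).
  move=> Hf Hg.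
  have := is_derive_plus _ _ _ _ _ Hf (is_derive_plus _ _ _ _ _
    (is_derive_const (2 * d) t) (is_derive_scal _ _ (2 * m) _ Hg)).
  by rewrite plus_zero_l.
split.
  have -> : Re (v + 2 * RtoC m * w) = Re v + 2 * m * Re w.
    by case: v U1 U2 w W1 W2 => ? ? _ _ [? ?] _ _ /=; ring.
  apply: is_derive_ext (lin _ _ _ _ (Re c) U1 W1) => s.
  by rewrite /affine; case: (u s) (c) (phi s) => ? ? [? ?] [? ?] /=; ring.
have -> : Im (v + 2 * RtoC m * w) = Im v + 2 * m * Im w.
  by case: v U1 U2 w W1 W2 => ? ? _ _ [? ?] _ _ /=; ring.
apply: is_derive_ext (lin _ _ _ _ (Im c) U2 W2) => s.
by rewrite /affine; case: (u s) (c) (phi s) => ? ? [? ?] [? ?] /=; ring.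
Qed.

(** The third vortex moves with a velocity that depends on the relative
    position only; its position is recovered by integration. *)
Lemma motion_of_solution (phi : R -> C) : sol phi ->
  exists u, u 0 = (- c)%C /\ motion Gam (fun t => placed (phi t) (u t)).
Proof.
move=> Hphi.
have Hcont (f : C -> R) : (forall z, D z -> locally_lipschitz f z) ->
    forall t, continuous (fun s => f (phi s)) t.
  move=> Hf t; have [Dt [D1 D2]] := Hphi t.
  exact: continuous_along (Hf _ Dt) D1 D2.
have LA1 z : D z -> locally_lipschitz (fun z => cot_re (affine c a z)) z.
  by move=> [_ [H _]]; apply/locally_lipschitz_affine/cot_re_locally_lipschitz.
have LA2 z : D z -> locally_lipschitz (fun z => cot_im (affine c a z)) z.
  by move=> [_ [H _]]; apply/locally_lipschitz_affine/cot_im_locally_lipschitz.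
have LB1 z : D z -> locally_lipschitz (fun z => cot_re (affine c (- b) z)) z.
  by move=> [_ [_ H]]; apply/locally_lipschitz_affine/cot_re_locally_lipschitz.
have LB2 z : D z -> locally_lipschitz (fun z => cot_im (affine c (- b) z)) z.
  by move=> [_ [_ H]]; apply/locally_lipschitz_affine/cot_im_locally_lipschitz.
pose X z := / (4 * PI) * (G * cot_im (affine c a z) + G' * cot_im (affine c (- b) z)).
pose Y z := - / (4 * PI) * (G * cot_re (affine c a z) + G' * cot_re (affine c (- b) z)).
have XY z : third_velocity z = (X z, Y z).
  have P0 := PI_RGT_0.
  rewrite /third_velocity /K /cot_C /X /Y.
  rewrite /Cconj /Ci /Cdiv /Cinv /Cmult /Cplus /Cminus /Copp /RtoC /=.
  by congr pair; field; lra.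
have CX : forall t, continuous (fun s => X (phi s)) t.
  apply: (Hcont X) => z Dz; apply: locally_lipschitz_scal; apply: locally_lipschitz_plus.
    by apply: locally_lipschitz_scal; exact: LA2.
  by apply: locally_lipschitz_scal; exact: LB2.
have CY : forall t, continuous (fun s => Y (phi s)) t.
  apply: (Hcont Y) => z Dz; apply: locally_lipschitz_scal; apply: locally_lipschitz_plus.
    by apply: locally_lipschitz_scal; exact: LA1.
  by apply: locally_lipschitz_scal; exact: LB1.
have [X0 DX] := primitive_of_continuous _ CX.
have [Y0 DY] := primitive_of_continuous _ CY.
pose u t : C := (- c + (RInt (fun s => X (phi s)) 0 t, RInt (fun s => Y (phi s)) 0 t))%C.
have u0 : u 0 = (- c)%C by rewrite /u X0 Y0 -/(RtoC 0) Cplus_0_r.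
have Du t : is_derive u t (third_velocity (phi t)).
  rewrite XY; apply/is_derive_C; split.
    have := is_derive_plus _ _ _ _ _ (is_derive_const (Re (- c)) t) (DX t).
    by rewrite plus_zero_l.
  have := is_derive_plus _ _ _ _ _ (is_derive_const (Im (- c)) t) (DY t).
  by rewrite plus_zero_l.
exists u; split=> // t.
have [Dt Dphi] := proj1 (solution_field phi) Hphi t.
split; first exact/phase_space_placed.
have [V1 [V2 V3]] := velocity_placed _ (u t) Dt.
apply: ord3P; rewrite ?V1 ?V2 ?V3.
- exact: is_derive_affine.
- exact: is_derive_affine.
- exact: Du.
Qed.

(** The total vorticity being zero, the moment [G z1 + G' z2 - (G + G') z3] is
    a translation-invariant constant of motion; it ties the two relative
    positions together. *)
Lemma solution_of_motion (z : R -> 'I_3 -> C) (z0 : C) :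
  motion Gam z -> (forall i, z 0 i = configuration3 G G' c z0 i) ->
  exists phi, phi 0 = z0 /\ sol phi /\ forall t i, z t i = placed (phi t) (z t o3) i.
Proof.
move=> Hz Hz0.
have T0 := total_neq_0.
have Tc : RtoC total <> 0%C by move=> [].
have [E1 [E2 E3]] := placed_half_differences z0 (- c).
pose P t : C := (G * z t o1 + G' * z t o2 - total * z t o3)%C.
have lin3 (f g h : R -> C) t df dg dh (x y w : R) : is_derive f t df -> is_derive g t dg ->
   is_derive h t dh -> is_derive (fun s => (x * f s + y * g s - w * h s)%C) t (x * df + y * dg - w * dh)%C.
  move=> /is_derive_C [F1 F2] /is_derive_C [G1 G2] /is_derive_C [H1 H2]; apply/is_derive_C.
  have lin (f' g' h' : R -> R) df' dg' dh' : is_derive f' t df' -> is_derive g' t dg' ->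
    is_derive h' t dh' -> is_derive (fun s => x * f' s + y * g' s - w * h' s) t (x * df' + y * dg' - w * dh').
    move=> A1 A2 A3; exact: (is_derive_minus _ _ _ _ _ (is_derive_plus _ _ _ _ _
      (is_derive_scal _ _ x _ A1) (is_derive_scal _ _ y _ A2)) (is_derive_scal _ _ w _ A3)).
  have ER (p q r : C) : Re (x * p + y * q - w * r) = x * Re p + y * Re q - w * Re r.
    by case: p q r => ? ? [? ?] [? ?] /=; ring.
  have EI (p q r : C) : Im (x * p + y * q - w * r) = x * Im p + y * Im q - w * Im r.
    by case: p q r => ? ? [? ?] [? ?] /=; ring.
  rewrite ER EI; split.
    by apply: is_derive_ext (lin _ _ _ _ _ _ F1 G1 H1) => s; rewrite ER.
  by apply: is_derive_ext (lin _ _ _ _ _ _ F2 G2 H2) => s; rewrite EI.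
have DP t : is_derive P t (RtoC 0).
  have [Hp Hd] := Hz t.
  have [V1 [V2 V3]] := velocity3 _ Hp.
  have := lin3 _ _ _ t _ _ _ G G' total (Hd o1) (Hd o2) (Hd o3).
  rewrite V1 V2 V3; set v := (X in is_derive _ _ X -> _).
  have -> : v = RtoC 0; last by [].
  by rewrite /v /total RtoC_plus RtoC_minus RtoC_opp; ring.
have EP t : P t = (2 * total * c)%C.
  rewrite (zero_derivative_constant_C P DP t) /P !Hz0 /configuration3 /tnth /=.
  rewrite -/total.
  have -> : RtoC (2 * G' / total) = (2 * G' / total)%C by rewrite RtoC_div // RtoC_mult.
  have -> : RtoC (2 * G / total) = (2 * G / total)%C by rewrite RtoC_div // RtoC_mult.
  have -> : RtoC total = (G + G')%C by rewrite /total RtoC_plus.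
  by field; rewrite -RtoC_plus.
have two0 : RtoC 2 <> 0%C by move=> [] ?; lra.
pose phi t := ((z t o1 - z t o2) / 2)%C.
have Epl t i : z t i = placed (phi t) (z t o3) i.
  have EPt := EP t; rewrite /P in EPt.
  have Ea : RtoC a = (G' / total)%C by rewrite -RtoC_div.
  have Eb : RtoC b = (G / total)%C by rewrite -RtoC_div.
  have Et : RtoC total = (G + G')%C by rewrite /total RtoC_plus.
  move: i; apply: ord3P; rewrite /placed /tnth /= /affine /phi //.
    have -> : (z t o3 + 2 * (c + a * ((z t o1 - z t o2) / 2)) =
        z t o3 + (2 * total * c + G' * (z t o1 - z t o2)) / total)%C by rewrite Ea; field.
    rewrite -EPt Et; field; by rewrite -Et.
  have -> : (z t o3 + 2 * (c + (- b)%R * ((z t o1 - z t o2) / 2)) =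
      z t o3 + (2 * total * c - G * (z t o1 - z t o2)) / total)%C by rewrite RtoC_opp Eb; field.
  rewrite -EPt Et; field; by rewrite -Et.
exists phi; split; last split=> //.
  by rewrite /phi !Hz0 !configuration3_placed.
apply/solution_field => t; have [Hp Hd] := Hz t.
have [F1 [F2 F3]] := placed_half_differences (phi t) (z t o3).
rewrite -!Epl in F1 F2 F3.
have Dt : D (phi t).
  by have := proj1 (phase_space3 _) Hp; rewrite F1 F2 F3.
split=> //.
have [V1 [V2 _]] := velocity3 _ Hp.
have := lin3 _ _ _ t _ _ _ (1 / 2) (- (1 / 2)) 0 (Hd o1) (Hd o2) (Hd o3).
rewrite V1 V2 F1 F2 F3; set v := (X in is_derive _ _ X -> _).
have Ev : v = relative_field (phi t).
  have FF := relative_field_cot total (phi t).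
  have conj3 (x y w : C) : (Cconj (x - y + w) = Cconj x - Cconj y + Cconj w)%C.
    by apply: injective_projections => /=; ring.
  have E11 : total / total = 1 by field.
  rewrite conj3 E11 Cmult_1_r in FF.
  have -> : relative_field (phi t) = (/ 2 * (2 * relative_field (phi t)))%C by field.
  have Es : RtoC (- G - G') = (- G - G')%C by rewrite RtoC_minus RtoC_opp.
  have Et : RtoC total = (G + G')%C by rewrite /total RtoC_plus.
  have Eh : RtoC (1 / 2) = (1 / 2)%C by rewrite RtoC_div.
  by rewrite -FF /v RtoC_opp Es Et Eh; field.
rewrite Ev; apply: is_derive_ext.
have Eh : RtoC (1 / 2) = (1 / 2)%C by rewrite RtoC_div.
have Ephi s : (RtoC (1 / 2) * z s o1 + RtoC (- (1 / 2)) * z s o2 - 0 * z s o3)%C = phi s.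
  by rewrite /phi RtoC_opp Eh; field.
exact: Ephi.
Qed.

Lemma same_orbit_placed (z u z' u' : C) :
  same_orbit (placed z u) (placed z' u') <-> period_lattice a (z - z')%C.
Proof.
have sum : a + b = 1 := shares_sum.
have Eb : b = 1 - a by lra.
split.
  case=> al Hal.
  have [n1 N1] := Hal o1; have [n2 N2] := Hal o2; have [n3 N3] := Hal o3.
  have [F1 [F2 _]] := placed_half_differences z u.
  have [F1' [F2' _]] := placed_half_differences z' u'.
  have two0 : RtoC 2 <> 0%C by move=> [] ?; lra.
  have D12 : (z - z')%C = RtoC (IZR (n1 - n2) * PI).
    rewrite -F1 -F1'.
    have -> : ((placed z u o1 - placed z u o2) / 2 - (placed z' u' o1 - placed z' u' o2) / 2 =
      ((placed z u o1 - (placed z' u' o1 + al)) - (placed z u o2 - (placed z' u' o2 + al))) / 2)%C by field.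
    by rewrite N1 N2 -RtoC_minus -RtoC_div; [congr RtoC; rewrite minus_IZR; field | lra].
  have D13 : (RtoC a * (z - z'))%C = RtoC (IZR (n1 - n3) * PI).
    rewrite -(affine_sub c) -F2 -F2'.
    have -> : ((placed z u o1 - placed z u o3) / 2 - (placed z' u' o1 - placed z' u' o3) / 2 =
      ((placed z u o1 - (placed z' u' o1 + al)) - (placed z u o3 - (placed z' u' o3 + al))) / 2)%C by field.
    by rewrite N1 N3 -RtoC_minus -RtoC_div; [congr RtoC; rewrite minus_IZR; field | lra].
  exists (n1 - n2)%Z, (n1 - n3)%Z; split=> //.
  rewrite D12 -RtoC_mult in D13; have E := RtoC_inj _ _ D13.
  have P0 := PI_RGT_0.
  by apply: (Rmult_eq_reg_r PI); [rewrite -E; ring | lra].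
case=> m [n [E1 E2]]; exists (u - u')%C.
apply: ord3P; rewrite /placed /tnth /=.
- exists n.
  have -> : (u + 2 * affine c a z - (u' + 2 * affine c a z' + (u - u')) =
    2 * (affine c a z - affine c a z'))%C by ring.
  by rewrite affine_sub E1 -!RtoC_mult; congr RtoC; rewrite -E2; ring.
- exists (n - m)%Z.
  have -> : (u + 2 * affine c (- b) z - (u' + 2 * affine c (- b) z' + (u - u')) =
    2 * (affine c (- b) z - affine c (- b) z'))%C by ring.
  rewrite affine_sub E1 -!RtoC_mult; congr RtoC; rewrite minus_IZR -E2.
  by rewrite Eb; ring.
- exists 0%Z; have -> : (u - (u' + (u - u')) = 0)%C by ring.
  by congr RtoC; ring.
Qed.

End ThreeVortices.

(** * Periodic orbits, equilibria and separatrices *)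

Section Classification.
Variables (G G' : R) (c : C).
Hypothesis GG : 0 < G * G'.

Let a := share1 G G'.
Let b := share2 G G'.
Let k := speed G G'.
Let Gam := vorticities3 G G'.
Let D := no_collision a b c.
Let E := rel_energy a b c.
Let Ex := rel_energy_x a b c.
Let Ey := rel_energy_y a b c.
Let Lam := period_lattice a.
Let sol := solution D Ex Ey k.
Let HH := relative_hamiltonian a b c (share1_gt0 G G' GG) (share2_gt0 G G' GG) (shares_sum G G' GG).
Let k0 : k <> 0 := speed_neq_0 G G' GG.

Lemma configuration3_eq (z : C) : configuration3 G G' c z = placed G G' c z (- c).
Proof. by apply: functional_extensionality; exact: configuration3_placed. Qed.

Lemma phase_space_configuration3 (z : C) : phase_space (configuration3 G G' c z) <-> D z.
Proof. by rewrite configuration3_eq; exact: phase_space_placed. Qed.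

(** A solution that stays in one class modulo the lattice is constant: the
    lattice is a discrete set of real numbers. *)
Lemma regular_solution_moves (phi : R -> C) : sol phi -> ~ critical Ex Ey (phi 0) ->
  exists t, ~ Lam (phi t - phi 0)%C.
Proof.
move=> Hphi Hreg; apply: NNPP => Hno; apply: Hreg.
have Hlat t : Lam (phi t - phi 0)%C by apply: NNPP => h; apply: Hno; exists t.
have [_ [D1 D2]] := Hphi 0.
have P0 := PI_RGT_0.
have EIm t : Im (phi t) = Im (phi 0).
  have [m [n [Em _]]] := Hlat t; have := f_equal snd Em.
  have -> : snd (phi t - phi 0)%C = Im (phi t) - Im (phi 0) by [].
  by rewrite /=; lra.
have ERe t : Re (phi t) = Re (phi 0).
  have mult s : exists m : Z, Re (phi s) - Re (phi 0) = IZR m * PI.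
    have [m [n [Em _]]] := Hlat s; exists m; exact: (f_equal fst Em).
  have [m Em] := mult t.
  have cont : continuity (fun s => Re (phi s)).
    by move=> s; have [_ [D1' _]] := Hphi s; exact: is_derive_continuity_pt D1'.
  (* between two different lattice values the real part would take the value
     that lies half a period away from the initial one *)
  have half (sg : R) : (sg = 1 \/ sg = -1) ->
      ~ (Rmin (Re (phi 0)) (Re (phi t)) <= Re (phi 0) + sg * (PI / 2) <= Rmax (Re (phi 0)) (Re (phi t))).
    move=> Hsg Hb; have [s [_ Es]] := IVT_gen _ 0 t _ cont Hb.
    have [n En] := mult s; rewrite Es in En.
    have : IZR n * 2 = sg by nra.
    by case: Hsg => ->; rewrite -mult_IZR => /eq_IZR; lia.
  have := half 1 ltac:(by left); have := half (-1) ltac:(by right).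
  case: (Z.eq_dec m 0) => [m0|m0].
    by move=> _ _; rewrite m0 in Em; lra.
  have : IZR m <= -1 \/ 1 <= IZR m.
    have [h|h] : (m <= -1)%Z \/ (1 <= m)%Z by lia.
      by left; exact: (IZR_le _ (-1)).
    by right; exact: (IZR_le 1).
  rewrite /Rmin /Rmax; case: Rle_dec => ? [] ? h1 h2; exfalso.
  - nra.
  - by apply: h2; nra.
  - by apply: h1; nra.
  - nra.
have Z1 : - k * Ey (phi 0) = 0.
  rewrite -(is_derive_unique _ _ _ D1); transitivity (Derive (fun _ => Re (phi 0)) 0).
    by apply: Derive_ext => s; exact: ERe.
  exact: Derive_const.
have Z2 : k * Ex (phi 0) = 0.
  rewrite -(is_derive_unique _ _ _ D2); transitivity (Derive (fun _ => Im (phi 0)) 0).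
    by apply: Derive_ext => s; exact: EIm.
  exact: Derive_const.
by split; [case/Rmult_integral: Z2 | case/Rmult_integral: Z1] => // h; exfalso; apply: k0; lra.
Qed.

Lemma Lam0 (x : C) : Lam (x - x)%C.
Proof.
have -> : (x - x)%C = RtoC 0 by ring.
exact: (lattice_0 _ _ _ _ _ HH).
Qed.

Lemma relative_periodic_of_revisits (phi : R -> C) (z : C) : sol phi -> phi 0 = z ->
  ~ critical Ex Ey z -> revisits Lam phi ->
  forms (relative_periodic_orbit Gam) (configuration3 G G' c z).
Proof.
move=> Hphi E0 Hreg [T [T0 HT]].
have [u [u0 Hm]] := motion_of_solution G G' c GG phi Hphi.
exists (fun t => placed G G' c (phi t) (u t)); split.
  by move=> i; rewrite E0 u0 configuration3_eq.
split=> //; split.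
  by exists T; split=> //; exact/(same_orbit_placed G G' c GG).
have [t Ht] : exists t, ~ Lam (phi t - phi 0)%C by apply: regular_solution_moves; rewrite ?E0.
by exists t => /(same_orbit_placed G G' c GG).
Qed.

Lemma critical_equilibrium (p : C) : D p -> critical Ex Ey p ->
  exists u, u 0 = (- c)%C /\
    relative_equilibrium Gam (fun t => placed G G' c p (u t)).
Proof.
move=> Dp [c1 c2].
have Hs : sol (fun _ => p).
  move=> t; split=> //; rewrite -/Ex -/Ey c1 c2 !Rmult_0_r.
  by split; exact: is_derive_const.
have [u [u0 Hm]] := motion_of_solution G G' c GG _ Hs.
exists u; split=> //; split=> // t.
by apply/(same_orbit_placed G G' c GG) => //; exact: Lam0.
Qed.

Lemma equilibrium_critical (z : C) :
  forms (relative_equilibrium Gam) (configuration3 G G' c z) -> critical Ex Ey z.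
Proof.
move=> [m [Hm0 [Hm Heq]]].
have [phi [E0 [Hphi Epl]]] := solution_of_motion G G' c GG m z Hm Hm0.
apply: NNPP => Hreg; rewrite -E0 in Hreg.
have [t Ht] := regular_solution_moves phi Hphi Hreg.
apply: Ht; apply/(same_orbit_placed G G' c GG _ (m t o3) _ (m 0 o3)).
have -> : placed G G' c (phi t) (m t o3) = m t.
  by apply: functional_extensionality => i; rewrite Epl.
have -> : placed G G' c (phi 0) (m 0 o3) = m 0.
  by apply: functional_extensionality => i; rewrite Epl.
exact: Heq.
Qed.

Lemma near_orbit_placed (eps : R) (z u p u' l : C) : Lam l ->
  Cmod (z + l - p) < eps / 2 -> near_orbit eps (placed G G' c z u) (placed G G' c p u').
Proof.
move=> Hl Hz.
have a0 := share1_gt0 G G' GG; have b0 := share2_gt0 G G' GG; have ab := shares_sum G G' GG.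
exists (placed G G' c (p - l) u); split.
  apply/(same_orbit_placed G G' c GG) => //.
  have -> : (p - l - p = - l)%C by ring.
  exact: (lattice_opp _ _ _ _ _ HH).
have Hc := Cmod_ge_0 (z + l - p).
have E1 m w : (u + 2 * affine c m z - (u + 2 * affine c m w) = 2 * (RtoC m * (z - w)))%C.
  by rewrite -(affine_sub c); ring.
have E2 : (z - (p - l) = z + l - p)%C by ring.
have two : Cmod 2 = 2 by rewrite Cmod_R Rabs_pos_eq; lra.
apply: ord3P; rewrite /placed /tnth /= ?E1 ?E2.
- by rewrite !Cmod_mult two Cmod_R Rabs_pos_eq; nra.
- by rewrite !Cmod_mult two Cmod_R Rabs_Ropp Rabs_pos_eq; nra.
- by rewrite Cmod_sub_diag; lra.
Qed.

Lemma near_zero_relative_periodic : exists V : C -> Prop, open V /\ V (RtoC 0) /\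
  forall zeta : C, V zeta -> zeta <> RtoC 0 ->
    forms (relative_periodic_orbit Gam) (configuration3 G G' c zeta).
Proof.
have [V [oV [V0 HV]]] := near_zero_revisits a b c (share1_gt0 G G' GG) (share2_gt0 G G' GG)
  (shares_sum G G' GG) k k0.
exists V; split=> //; split=> // z Vz z0.
have [Dz [Hreg [phi [E0 [Hphi Hrev]]]]] := HV z Vz z0.
exact: relative_periodic_of_revisits Hphi E0 Hreg Hrev.
Qed.

Section CompactLevels.
Hypothesis Hwin : forall h, compact_window D E Lam h.
Hypothesis Hiso : isolated_critical D Ex Ey.
Hypothesis Hcrit : exists z, D z /\ critical Ex Ey z.

Lemma flow_exists (z : C) : D z -> exists phi, phi 0 = z /\ sol phi.
Proof. by move=> Dz; exact: (level_solution_exists _ _ _ _ _ HH k _ (Hwin (E z)) z Dz). Qed.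

Lemma flow_unique (phi psi : R -> C) (t0 : R) : sol phi -> sol psi -> phi t0 = psi t0 ->
  forall t, phi t = psi t.
Proof.
by move=> H1 H2; exact: (level_solution_unique _ _ _ _ _ HH k _ (Hwin (E (phi 0))) phi psi t0 H1 H2 erefl).
Qed.

Definition periodic_point (z : C) : Prop :=
  ~ critical Ex Ey z /\ exists phi, phi 0 = z /\ sol phi /\ revisits Lam phi.

(** The equilibria, and the points on solutions that tend to equilibria. *)
Definition exceptional (z : C) : Prop := D z /\ ~ periodic_point z.

Lemma solution_critical_constant (phi : R -> C) (s : R) : sol phi ->
  critical Ex Ey (phi s) -> forall t, phi t = phi s.
Proof.
move=> Hphi [c1 c2] t.
have Hs : sol (fun _ => phi s).
  move=> u; split; first by case: (Hphi s).
  by rewrite -/Ex -/Ey c1 c2 !Rmult_0_r; split; exact: is_derive_const.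
exact: (flow_unique phi _ s Hphi Hs erefl).
Qed.

(** A revisit at one time of a solution is, by uniqueness, a revisit at all
    times. *)
Lemma periodic_point_flow (phi : R -> C) (s : R) : sol phi ->
  periodic_point (phi 0) -> periodic_point (phi s).
Proof.
move=> Hphi [Hreg [psi [E0 [Hpsi [T [T0 HT]]]]]].
have Epsi := flow_unique psi phi 0 Hpsi Hphi E0.
rewrite !Epsi in HT.
split.
  move=> Hc; apply: Hreg.
  by rewrite (solution_critical_constant phi s Hphi Hc 0).
exists (fun t => phi (t + s)); split; first by rewrite Rplus_0_l.
split; first exact: solution_translate.
exists T; split=> //.
have HTn := lattice_opp _ _ _ _ _ HH _ HT.
have Hsh : sol (fun t => phi (t + T)%R + - (phi T - phi 0))%C.
  by apply: (solution_shift _ _ _ _ _ HH) => //; exact: solution_translate.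
have Eag := flow_unique phi _ 0 Hphi Hsh.
rewrite Rplus_0_l (Rplus_comm T).
have -> : (phi (s + T)%R - phi s = phi T - phi 0)%C; last by [].
have Es : phi s = (phi (s + T)%R + - (phi T - phi 0))%C.
  by apply: Eag; rewrite Rplus_0_l; ring.
by rewrite Es; ring.
Qed.

Lemma exceptional_limits (z : C) : exceptional z -> exists phi, phi 0 = z /\ sol phi /\
  exists p, D p /\ critical Ex Ey p /\ E p = E z /\ converges_to Lam phi p.
Proof.
move=> [Dz Hnp]; have [phi [E0 Hphi]] := flow_exists z Dz.
exists phi; split=> //; split=> //.
case: (classic (critical Ex Ey z)) => Hc.
  exists z; split=> //; split=> //; split=> // eps eps0; exists 0 => t _.
  exists (RtoC 0); split; first exact: (lattice_0 _ _ _ _ _ HH).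
  rewrite -E0 in Hc; rewrite (solution_critical_constant phi 0 Hphi Hc) E0 Cplus_0_r.
  by rewrite Cmod_sub_diag.
have EE : E (phi 0) = E z by rewrite E0.
have [Hrev|] := level_dichotomy _ _ _ _ _ HH k k0 _ (Hwin (E z)) phi Hiso Hphi EE.
  by exfalso; apply: Hnp; split=> //; exists phi.
by case=> p [Dp [Cp [Ep Hp]]]; exists p.
Qed.

(** Exceptional points have the energy of a critical point, and these energies
    are isolated. *)
Lemma exceptional_energy (z : C) : D z -> exists d, 0 < d /\
  forall x, Cmod (x - z) < d -> exceptional x -> E x = E z.
Proof.
move=> Dz.
have [e [e0 He]] := critical_energies_isolated _ _ _ _ _ HH _ (Hwin (E z)) Hiso.
have [d [d0 Hd]] := locally_lipschitz_continuous _ _ (energy_lipschitz _ _ _ _ _ HH z Dz) e e0.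
exists d; split=> // x /Hd Hx /exceptional_limits [phi [E0 [Hphi [p [Dp [Cp [Ep _]]]]]]].
by have := He p Dp Cp; rewrite -/E Ep => HE; exact: HE.
Qed.

(** Exceptional points near a regular one have its energy, and nearby points of
    equal energy lie on one solution. *)
Lemma exceptional_on_orbit (z : C) (phi : R -> C) : ~ critical Ex Ey z ->
  sol phi -> phi 0 = z -> exists d, 0 < d /\
  forall x, Cmod (x - z) < d -> exceptional x -> exists s, phi s = x.
Proof.
move=> Hreg Hphi E0; have Dz : D z by rewrite -E0; case: (Hphi 0).
have [d [d0 Hd]] := exceptional_energy z Dz.
have [r [r0 Hr]] := flow_box _ _ _ _ _ HH k k0 _ (Hwin (E z)) z Dz Hreg.
exists (Rmin d r); split; first exact: Rmin_pos.
move=> x Hx Hexc; have l1 := Rmin_l d r; have l2 := Rmin_r d r.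
have [|||s [_ Es]] := Hr z x phi _ _ erefl _ Hphi E0.
- by rewrite Cmod_sub_diag.
- lra.
- by apply: Hd => //; lra.
by exists s.
Qed.

Lemma regular_set_open : open (fun z => D z /\ ~ exceptional z).
Proof.
move=> z [Dz Hne]; apply/locally_Cmod.
have Hp : periodic_point z by apply: NNPP => h; apply: Hne.
have [d1 [d10 Hd1]] := domain_open _ _ _ _ _ HH z Dz.
have [Hreg [phi [E0 [Hphi _]]]] := Hp.
have [d2 [d20 Hd2]] := exceptional_on_orbit z phi Hreg Hphi E0.
exists (Rmin d1 d2); split; first exact: Rmin_pos.
move=> x Hx; have l1 := Rmin_l d1 d2; have l2 := Rmin_r d1 d2.
split; first by apply: Hd1; lra.
move=> Hexc; have [s Es] := Hd2 x ltac:(lra) Hexc.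
case: Hexc => _; apply; rewrite -Es; apply: periodic_point_flow => //.
by rewrite E0.
Qed.

Lemma energy_not_constant (z : C) : D z -> ~ critical Ex Ey z -> forall d, 0 < d ->
  exists x, Cmod (x - z) < d /\ E x <> E z.
Proof.
move=> Dz Hreg d d0; apply: NNPP => Hno; apply: Hreg.
have Hc x : Cmod (x - z) < d -> E x = E z by move=> Hx; apply: NNPP => h; apply: Hno; exists x.
have dir v w : Cmod (v, w) <= 1 -> Ex z * v + Ey z * w = 0.
  move=> Hvw; pose gam (s : R) : C := (Re z + s * v, Im z + s * w).
  have g0 : gam 0 = z by rewrite /gam !Rmult_0_l !Rplus_0_r; case: (z).
  have D1 : is_derive (fun s => Re (gam s)) 0 v by rewrite /gam /=; auto_derive => //; ring.
  have D2 : is_derive (fun s => Im (gam s)) 0 w by rewrite /gam /=; auto_derive => //; ring.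
  have := energy_chain _ _ _ _ _ HH gam 0 v w; rewrite g0 => /(_ Dz D1 D2) HE.
  rewrite -(is_derive_unique _ _ _ HE); transitivity (Derive (fun _ => E z) 0); last exact: Derive_const.
  apply: Derive_ext_loc; exists (mkposreal _ d0) => s.
  rewrite /ball /= /AbsRing_ball /abs /minus /plus /opp /= Ropp_0 Rplus_0_r => Hs.
  apply: Hc; have -> : (gam s - z)%C = (RtoC s * (v, w))%C.
    by rewrite /gam; case: (z) => ? ?; rewrite /Cminus /Cplus /Copp /Cmult /RtoC /=; congr pair; ring.
  by rewrite Cmod_mult Cmod_R; have := Rabs_pos s; have := Cmod_ge_0 (v, w); nra.
have h1 := dir 1 0; have h2 := dir 0 1.
have c1 : Cmod (1, 0) <= 1 by apply: Rle_trans (Cmod_le_sum _) _; rewrite /= Rabs_R0 Rabs_R1; lra.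
have c2 : Cmod (0, 1) <= 1 by apply: Rle_trans (Cmod_le_sum _) _; rewrite /= Rabs_R0 Rabs_R1; lra.
by split; [have := h1 c1 | have := h2 c2]; lra.
Qed.

Lemma regular_point_dense (z : C) (eps : R) : 0 < eps ->
  exists x, Cmod (x - z) < eps /\ D x /\ ~ critical Ex Ey x.
Proof.
move=> eps0.
have shift (x : C) (d : R) : 0 < d -> exists y, 0 < Cmod (y - x) /\ Cmod (y - x) < d.
  move=> d0; exists (x + RtoC (d / 2))%C.
  have -> : (x + RtoC (d / 2) - x = RtoC (d / 2))%C by ring.
  by rewrite Cmod_R Rabs_pos_eq; [split|]; lra.
have [y [Hy Dy]] : exists y, Cmod (y - z) < eps / 2 /\ D y.
  case: (classic (D z)) => Dz; first by exists z; rewrite Cmod_sub_diag; split=> //; lra.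
  have [r [r0 Hr]] := rel_energy_blowup a b c (share1_gt0 G G' GG) (share2_gt0 G G' GG)
    (shares_sum G G' GG) z Dz 0.
  have [y [h1 h2]] := shift z (Rmin r (eps / 2)) (Rmin_pos r (eps / 2) r0 ltac:(lra)).
  have l1 := Rmin_l r (eps / 2); have l2 := Rmin_r r (eps / 2).
  exists y; split; first lra.
  by apply: (proj1 (Hr y h1 _)); lra.
case: (classic (critical Ex Ey y)) => Cy; last by exists y; split=> //; lra.
have [e [e0 He]] := Hiso y Dy Cy.
have [d [d0 Hd]] := domain_open _ _ _ _ _ HH y Dy.
have m0 : 0 < Rmin (Rmin e d) (eps / 2) by repeat apply: Rmin_pos; lra.
have [x [h1 h2]] := shift y _ m0.
have l1 := Rmin_l (Rmin e d) (eps / 2); have l2 := Rmin_r (Rmin e d) (eps / 2).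
have l3 := Rmin_l e d; have l4 := Rmin_r e d.
have Dx : D x by apply: Hd; lra.
exists x; split; first by have := Cmod_sub_triangle y x z; lra.
split=> // Cx; move: h1; rewrite (He x Dx Cx ltac:(lra)) Cmod_sub_diag; lra.
Qed.

(** Near a regular point, leaving the energy level means leaving the exceptional
    set. *)
Lemma regular_set_dense : dense (fun z => D z /\ ~ exceptional z).
Proof.
move=> z eps eps0.
have [y [Hy [Dy Ry]]] := regular_point_dense z (eps / 2) ltac:(lra).
have [d [d0 Hd]] := exceptional_energy y Dy.
have [d' [d'0 Hd']] := domain_open _ _ _ _ _ HH y Dy.
have m0 : 0 < Rmin (Rmin d d') (eps / 2) by repeat apply: Rmin_pos; lra.
have [x [Hx HE]] := energy_not_constant y Dy Ry _ m0.
have l1 := Rmin_l (Rmin d d') (eps / 2); have l2 := Rmin_r (Rmin d d') (eps / 2).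
have l3 := Rmin_l d d'; have l4 := Rmin_r d d'.
exists x; split; last by have := Cmod_sub_triangle y x z; lra.
split; first by apply: Hd'; lra.
by move=> Hexc; apply: HE; apply: Hd => //; lra.
Qed.

Lemma exceptional_equilibrium (z : C) : D z -> critical Ex Ey z ->
  isolated_relative_equilibrium G G' c z.
Proof.
move=> Dz Cz; split.
  have [u [u0 Hu]] := critical_equilibrium z Dz Cz.
  exists (fun t => placed G G' c z (u t)); split=> //.
  by move=> i; rewrite u0 configuration3_eq.
have [e [e0 He]] := Hiso z Dz Cz.
have [d [d0 Hd]] := domain_open _ _ _ _ _ HH z Dz.
apply/locally_Cmod; exists (Rmin e d); split; first exact: Rmin_pos.
move=> x Hx Hne Hf; apply: Hne.
have l1 := Rmin_l e d; have l2 := Rmin_r e d.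
apply: He; first by apply: Hd; lra.
  exact: equilibrium_critical.
lra.
Qed.

(** The limit for negative times is that of the time-reversed solution, which
    cannot revisit either. *)
Lemma exceptional_separatrix (z : C) : exceptional z -> ~ critical Ex Ey z ->
  isolated_separatrix G G' c exceptional z.
Proof.
move=> Hexc Hreg.
have [phi [E0 [Hphi [p [Dp [Cp [Ep Hp]]]]]]] := exceptional_limits z Hexc.
have [u [u0 Hm]] := motion_of_solution G G' c GG phi Hphi.
exists (fun t => placed G G' c (phi t) (u t)); split.
  by move=> i; rewrite E0 u0 configuration3_eq.
split; last first.
  have [d [d0 Hd]] := exceptional_on_orbit z phi Hreg Hphi E0.
  apply/locally_Cmod; exists d; split=> // x Hx Hexc'.
  have [s Es] := Hd x Hx Hexc'; exists s.
  by rewrite configuration3_eq; apply/(same_orbit_placed G G' c GG) => //; rewrite Es; exact: Lam0.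
split=> //; split; last split.
- case=> _ Heq.
  have [t Ht] : exists t, ~ Lam (phi t - phi 0)%C by apply: regular_solution_moves; rewrite ?E0.
  by apply: Ht; exact/(same_orbit_placed G G' c GG)/Heq.
- have nk0 : - k <> 0 by lra.
  have Hback := solution_reverse _ _ _ _ _ Hphi.
  have EE : E (phi (- 0)) = E z by rewrite Ropp_0 E0.
  have [Hr|[p' [Dp' [Cp' [_ Hp']]]]] :=
    level_dichotomy _ _ _ _ _ HH (- k) nk0 _ (Hwin (E z)) _ Hiso Hback EE.
    exfalso; case: Hexc => _; apply; split=> //; exists phi; split=> //; split=> //.
    case: Hr => T [T0 HT]; exists T; split=> //.
    have Hs2 : sol (fun t => phi (t + - T)%R + - (phi (- T)%R - phi 0))%C.
      apply: (solution_shift _ _ _ _ _ HH); last exact: solution_translate.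
      by apply: (lattice_opp _ _ _ _ _ HH); rewrite Ropp_0 in HT.
    have Eag := flow_unique phi _ 0 Hphi Hs2.
    rewrite (Eag _ T); last by rewrite Rplus_0_l; ring.
    rewrite Rplus_opp_r.
    have -> : (phi 0 + - (phi (- T)%R - phi 0) - phi 0 = - (phi (- T)%R - phi 0))%C by ring.
    by apply: (lattice_opp _ _ _ _ _ HH); rewrite Ropp_0 in HT.
  have [v [v0 Hv]] := critical_equilibrium p' Dp' Cp'.
  exists (fun t => placed G G' c p' (v t)); split=> // eps eps0.
  have [T HT] := Hp' (eps / 2) ltac:(lra).
  exists (- T) => t Ht; have [l [Hl Hlt]] := HT (- t) ltac:(lra).
  by rewrite Ropp_involutive in Hlt; exact: near_orbit_placed Hl Hlt.
- have [v [v0 Hv]] := critical_equilibrium p Dp Cp.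
  exists (fun t => placed G G' c p (v t)); split=> // eps eps0.
  have [T HT] := Hp (eps / 2) ltac:(lra).
  exists T => t Ht; have [l [Hl Hlt]] := HT t ltac:(lra).
  exact: near_orbit_placed Hl Hlt.
Qed.

Lemma commensurable_classification : exists F : C -> Prop,
  (forall zeta : C, F zeta -> phase_space (configuration3 G G' c zeta)) /\
  (exists U : C -> Prop, open U /\ dense U /\
     forall zeta : C, U zeta <-> phase_space (configuration3 G G' c zeta) /\ ~ F zeta) /\
  (forall zeta : C, phase_space (configuration3 G G' c zeta) -> ~ F zeta ->
     forms (relative_periodic_orbit Gam) (configuration3 G G' c zeta)) /\
  (exists zeta : C, F zeta) /\
  (forall zeta : C, F zeta ->
     isolated_relative_equilibrium G G' c zeta \/ isolated_separatrix G G' c F zeta).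
Proof.
exists exceptional; split; last split; last split; last split.
- by move=> z [Dz _]; apply/phase_space_configuration3.
- exists (fun z => D z /\ ~ exceptional z); split; first exact: regular_set_open.
  split; first exact: regular_set_dense.
  by move=> z; rewrite phase_space_configuration3.
- move=> z /phase_space_configuration3 Dz Hn.
  have [Hreg [phi [E0 [Hphi Hrev]]]] : periodic_point z by apply: NNPP => h; apply: Hn.
  exact: relative_periodic_of_revisits Hphi E0 Hreg Hrev.
- have [z [Dz Cz]] := Hcrit; exists z; split=> //.
  by case.
- move=> z Hexc; case: (classic (critical Ex Ey z)) => Cz.
    by left; apply: exceptional_equilibrium => //; case: Hexc.
  by right; exact: exceptional_separatrix.
Qed.

End CompactLevels.
End Classification.

Lemma positive_rational_coprime (x : R) (m n : Z) : 0 < x -> n <> 0%Z -> x = IZR m / IZR n ->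
  exists p r : nat, is_true (leq 1 p) /\ is_true (leq 1 r) /\ is_true (div.coprime p r) /\
    x = INR r / INR p.
Proof.
move=> x0 n0 Ex.
have n0' : IZR n <> 0 by exact: not_0_IZR.
have m0 : m <> 0%Z by move=> E; move: x0; rewrite Ex E /Rdiv Rmult_0_l; lra.
pose M := Z.abs_nat m; pose N := Z.abs_nat n.
have M0 : (0 < M)%coq_nat by rewrite /M; lia.
have N0 : (0 < N)%coq_nat by rewrite /N; lia.
have EM : INR M = Rabs (IZR m) by rewrite /M INR_IZR_INZ -abs_IZR; congr IZR; lia.
have EN : INR N = Rabs (IZR n) by rewrite /N INR_IZR_INZ -abs_IZR; congr IZR; lia.
have ExMN : x = INR M / INR N.
  by rewrite EM EN -Rabs_div // -Ex Rabs_pos_eq //; lra.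
have g0 : is_true (leq 1 (gcdn M N)) by rewrite gcdn_gt0; apply/orP; left; apply/ssrnat.ltP.
have EMg := divnK (dvdn_gcdl M N); have ENg := divnK (dvdn_gcdr M N).
move: EMg ENg g0; set g := gcdn M N; set r := (divn M g); set p := (divn N g) => EMg ENg g0.
exists p, r; split.
  by rewrite lt0n; apply/eqP => E; move: ENg N0; rewrite E mul0n => <-; lia.
split.
  by rewrite lt0n; apply/eqP => E; move: EMg M0; rewrite E mul0n => <-; lia.
split.
  have : muln (gcdn p r) g = g.
    by rewrite muln_gcdl EMg ENg gcdnC.
  rewrite -{2}(mul1n g) => /eqP; rewrite eqn_pmul2r //.
have gR : INR g <> 0 by apply: not_0_INR; move: g0 => /ssrnat.leP; lia.
have pR : INR p <> 0.
  by apply: not_0_INR => E; move: ENg N0; rewrite E mul0n => <-; lia.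
by rewrite ExMN -EMg -ENg !mult_INR; field.
Qed.

Theorem theorem3 :
  forall (c : C) (G G' : R), c <> RtoC 0 -> 0 < G * G' ->
  (exists V : C -> Prop, open V /\ V (RtoC 0) /\
     forall zeta : C, V zeta -> zeta <> RtoC 0 ->
       forms (relative_periodic_orbit (vorticities3 G G'))
             (configuration3 G G' c zeta))
  /\
  ((exists p q : Z, q <> 0%Z /\ G / G' = IZR p / IZR q) ->
   exists E : C -> Prop,
     (forall zeta : C, E zeta -> phase_space (configuration3 G G' c zeta)) /\
     (exists U : C -> Prop, open U /\ dense U /\
        forall zeta : C,
          U zeta <-> phase_space (configuration3 G G' c zeta) /\ ~ E zeta) /\
     (forall zeta : C, phase_space (configuration3 G G' c zeta) -> ~ E zeta ->
        forms (relative_periodic_orbit (vorticities3 G G'))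
              (configuration3 G G' c zeta)) /\
     (exists zeta : C, E zeta) /\
     (forall zeta : C, E zeta ->
        isolated_relative_equilibrium G G' c zeta \/
        isolated_separatrix G G' c E zeta)).
Proof.
move=> c G G' _ GG; split; first exact: near_zero_relative_periodic.
move=> [m [n [n0 Emn]]].
have G'0 : G' <> 0 by nra.
have x0 : 0 < G / G'.
  apply: (Rmult_lt_reg_r (G' * G')); first exact: Rsqr_pos_lt.
  rewrite Rmult_0_l; by have -> : G / G' * (G' * G') = G * G' by field.
have [p [r [p1 [r1 [pr Er]]]]] := positive_rational_coprime _ m n x0 n0 Emn.
have p0 := INR_gt0 p p1; have r0 := INR_gt0 r r1.
have T0 := total_neq_0 G G' GG; rewrite /total in T0.
have EG : G = INR r / INR p * G' by rewrite -Er; field.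
have ET : G + G' = G' * (INR p + INR r) / INR p by rewrite {1}EG; field; lra.
have Ea : share1 G G' = INR p / (INR p + INR r).
  by rewrite /share1 /total ET; field; repeat split => //; lra.
have Eb : share2 G G' = INR r / (INR p + INR r).
  by rewrite /share2 /total ET {1}EG; field; repeat split => //; lra.
apply: commensurable_classification => //.
- move=> h; apply: (periodic_compact_window _ _ _ (share1_gt0 G G' GG) (share2_gt0 G G' GG)
    (shares_sum G G' GG) ((INR p + INR r) * PI)).
    by apply: Rmult_lt_0_compat; [lra | exact: PI_RGT_0].
  move=> l; exists (l * (Z.of_nat p + Z.of_nat r))%Z, (l * Z.of_nat p)%Z.
  rewrite !mult_IZR plus_IZR -!INR_IZR_INZ Ea; split; first by congr RtoC; ring.
  by field; lra.
- by rewrite Ea Eb; exact: relative_critical_isolated.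
- by rewrite Ea Eb; exact: relative_critical_exists.
Qed.
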